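(* Let $d\in\mathbb{N}$ and $m\in\mathbb{N}$. Then $$\lim_{n\to\infty}\frac{n^m\,a_n(I_d:H^{m}_{\rm mix}(\mathbb{T}^d)\to L_2(\mathbb{T}^d))}{(\ln n)^{(d-1)m}}=\Big[\frac{2^d}{(d-1)!}\Big]^m .$$
   Context: $\mathbb{N}=\{1,2,3,\dots\}$. $\mathbb{T}^d$ is the $d$-torus, represented by $[0,2\pi]^d$ with opposite sides identified. $L_2(\mathbb{T}^d)$ carries the norm $\|f|L_2(\mathbb{T}^d)\|=(\int_{\mathbb{T}^d}|f(x)|^2dx)^{1/2}$. For $m\in\mathbb{N}$, $H^m_{\rm mix}(\mathbb{T}^d)$ is the space of all $f\in L_2(\mathbb{T}^d)$ such that all distributional derivatives $D^\alpha f$ with $\alpha\in\mathbb{N}_0^d$, $|\alpha|_\infty=\max_j\alpha_j\le m$, belong to $L_2(\mathbb{T}^d)$, equipped with the norm $$\|f|H^m_{\rm mix}(\mathbb{T}^d)\|=\Big(\sum_{|\alpha|_\infty\le m}\|D^\alpha f|L_2(\mathbb{T}^d)\|^2\Big)^{1/2}.$$ Equivalently, $\|f|H^m_{\rm mix}(\mathbb{T}^d)\|^2=\sum_{k\in\mathbb{Z}^d}|c_k(f)|^2\prod_{j=1}^d\sum_{\alpha=0}^m|k_j|^{2\alpha}$ (with $0^0=1$), where $c_k(f)=(2\pi)^{-d/2}\int_{\mathbb{T}^d}f(x)e^{-ikx}dx$. $I_d$ denotes the identical embedding $f\mapsto f$. The approximation numbers of a bounded linear operator $T:X\to Y$ between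 Banach spaces are $a_n(T:X\to Y)=\inf\{\|T-A:X\to Y\| : A:X\to Y \text{ bounded linear},\ {\rm rank}\,A<n\}$, $n\in\mathbb{N}$. *)

(* Defs.v *)
From HB Require Import structures.
From mathcomp Require Export all_boot all_order all_algebra.
From mathcomp Require Export all_classical all_reals all_analysis.
From mathcomp Require Export complex.

Set Implicit Arguments.
Unset Strict Implicit.
Unset Printing Implicit Defensive.

Import Order.TTheory GRing.Theory Num.Theory.
Import numFieldNormedType.Exports.

Local Open Scope classical_set_scope.
Local Open Scope ring_scope.

Section circle.
Variable R : realType.

Definition circle_set : set (measurableTypeR R) := `[0, 2 * pi].

Let measurable_circle_set : measurable circle_set.
Proof. exact: measurable_itv. Qed.

Let circle_set_lty : (lebesgue_measure circle_set < +oo)%E.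
Proof. by rewrite lebesgue_measure_itv/=; case: ifPn => // _; rewrite ltry. Qed.

Definition circle_measure : {finite_measure set (measurableTypeR R) -> \bar R} :=
  mfrestr measurable_circle_set circle_set_lty.

End circle.
Arguments circle_set : clear implicits.

Section tuple_product.
Context d (T : measurableType d) (R : realType) (n : nat).

Definition tuple_cons (p : T * n.-tuple T) : n.+1.-tuple T := [tuple of p.1 :: p.2].

Lemma measurable_tuple_cons : measurable_fun [set: T * n.-tuple T] tuple_cons.
Proof. exact: measurable_cons. Qed.

Variables (m1 : {finite_measure set T -> \bar R})
          (m2 : {finite_measure set (n.-tuple T) -> \bar R}).

Definition cons_measure : set (n.+1.-tuple T) -> \bar R :=
  pushforward (m1 \x m2)%E tuple_cons.

Let cons_measure0 : cons_measure set0 = 0%E.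
Proof. by rewrite /cons_measure /pushforward preimage_set0 measure0. Qed.

Let cons_measure_ge0 A : (0 <= cons_measure A)%E.
Proof. by rewrite /cons_measure /pushforward measure_ge0. Qed.

Let cons_measure_sigma_additive : semi_sigma_additive cons_measure.
Proof.
exact: (@measure_semi_sigma_additive _ _ _
  (measure_function_pushforward__canonical__measure_function_Measure (m1 \x m2)%E
     measurable_tuple_cons)).
Qed.

HB.instance Definition _ := isMeasure.Build _ _ _ cons_measure
  cons_measure0 cons_measure_ge0 cons_measure_sigma_additive.

Let cons_measure_fin : fin_num_fun cons_measure.
Proof.
move=> U mU; rewrite ge0_fin_numE ?measure_ge0//.
have mc := measurable_tuple_cons.
apply: (@le_lt_trans _ _ (cons_measure setT)).
  by apply: le_measure; rewrite ?inE.
rewrite /cons_measure /pushforward preimage_setT -setXTT.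
rewrite product_measure1E//.
by rewrite lte_mul_pinfty// ?fin_num_measure// -ge0_fin_numE// fin_num_measure.
Qed.

HB.instance Definition _ := Measure_isFinite.Build _ _ _ cons_measure
  cons_measure_fin.

End tuple_product.

(* The d-fold product of Lebesgue measure restricted to [0, 2 pi]; see
   torus_measure_box. *)
Fixpoint torus_measure (R : realType) (d : nat) :
    {finite_measure set (d.-tuple (measurableTypeR R)) -> \bar R} :=
  match d with
  | 0 => \d_([tuple] : 0.-tuple (measurableTypeR R))
  | d'.+1 => cons_measure (circle_measure R) (torus_measure R d')
  end.

Lemma torus_measure_box (R : realType) (d : nat)
    (A : 'I_d -> set (measurableTypeR R)) :
  (forall i, measurable (A i)) ->
  torus_measure R d [set t | forall i, A i (tnth t i)] =
  (\prod_(i < d) lebesgue_measure (A i `&` circle_set R))%E.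
Proof.
elim: d A => [|d IH] A mA /=.
  by rewrite big_ord0 diracE mem_set// => -[].
rewrite big_ord_recl /= -IH//.
rewrite /cons_measure /pushforward.
set B := [set t | forall i, A (lift ord0 i) (tnth t i)].
have mB : measurable B.
  have -> : B = \bigcap_(i in [set: 'I_d])
      ((fun t : d.-tuple (measurableTypeR R) => tnth t i) @^-1` A (lift ord0 i)).
    by apply/seteqP; split => [t Bt i _|t Bt i]; [exact: Bt|exact: (Bt i)].
  apply: fin_bigcap_measurable => // i _.
  by rewrite -[X in measurable X]setTI; exact: measurable_tnth.
rewrite (_ : _ @^-1` _ = A ord0 `*` B) ?product_measure1E//.
apply/seteqP; split => -[x t] /=.
  by move=> H; split; [exact: (H ord0)|move=> i; have := H (lift ord0 i); rewrite tnthS].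
move=> [Ax Bt] i; have [j ->|->//] := unliftP ord0 i.
by rewrite tnthS; exact: Bt.
Qed.

Section torus_functions.
Variables (R : realType) (d : nat).

(* A function on the torus is given on R^d; only its restriction to
   [0, 2 pi]^d matters, since torus_measure is concentrated there. *)
Definition torus_fun := d.-tuple (measurableTypeR R) -> R[i]^o.

Implicit Types f g : torus_fun.

Definition torus_integral f : R[i] :=
  Complex (\int[torus_measure R d]_t complex.Re (f t))
          (\int[torus_measure R d]_t complex.Im (f t)).

Definition modulus f (t : d.-tuple (measurableTypeR R)) : R :=
  Normc.normc (f t).

Definition L2 : set torus_fun := [set f |
  [/\ measurable_fun setT (fun t => complex.Re (f t)),
      measurable_fun setT (fun t => complex.Im (f t)) &
      (Lnorm (torus_measure R d) 2%:E (EFin \o modulus f) < +oo)%E]].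

Definition L2norm f : R :=
  fine (Lnorm (torus_measure R d) 2%:E (EFin \o modulus f)).

Definition partial (j : 'I_d) (phi : 'rV[R]_d -> R[i]) : 'rV[R]_d -> R[i] :=
  fun x => Complex ('D_(delta_mx ord0 j) (fun y => complex.Re (phi y)) x)
                   ('D_(delta_mx ord0 j) (fun y => complex.Im (phi y)) x).

Definition iter_partial (s : seq 'I_d) (phi : 'rV[R]_d -> R[i]) :
  'rV[R]_d -> R[i] := foldr partial phi s.

Definition smooth (phi : 'rV[R]_d -> R[i]) := forall s : seq 'I_d,
  let psi := iter_partial s phi in
  [/\ continuous (fun x => complex.Re (psi x)),
      continuous (fun x => complex.Im (psi x)) &
      forall (j : 'I_d) (x : 'rV[R]_d),
        derivable (fun y => complex.Re (psi y)) x (delta_mx ord0 j) /\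
        derivable (fun y => complex.Im (psi y)) x (delta_mx ord0 j)].

Definition torus_periodic (phi : 'rV[R]_d -> R[i]) :=
  forall j : 'I_d, periodic phi ((2 * pi) *: delta_mx ord0 j).

(* alpha as the list of coordinates with j repeated alpha j times, so that
   iter_partial (multi_seq alpha) is D^alpha. *)
Definition multi_seq (alpha : 'I_d -> nat) : seq 'I_d :=
  flatten [seq nseq (alpha j) j | j <- enum 'I_d].

Definition row_of (t : d.-tuple (measurableTypeR R)) : 'rV[R]_d :=
  \row_j tnth t j.

(* g = D^alpha f as distributions on the torus, whose test functions are the
   smooth functions on R^d that are 2 pi-periodic in every variable. *)
Definition distr_deriv (alpha : 'I_d -> nat) f g :=
  forall phi : 'rV[R]_d -> R[i], smooth phi -> torus_periodic phi ->
    torus_integral (fun t => g t * phi (row_of t)) =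
    (-1) ^+ (\sum_j alpha j)%N *
    torus_integral (fun t => f t * iter_partial (multi_seq alpha) phi (row_of t)).

(* A representative of the L_2 function D^alpha f, if there is one; it is unique
   up to equality almost everywhere. *)
Definition Dmulti (alpha : 'I_d -> nat) f : torus_fun :=
  xget 0 [set g | L2 g /\ distr_deriv alpha f g].

(* {ffun 'I_d -> 'I_m.+1} enumerates the multi-indices with |alpha|_oo <= m. *)
Definition Hmix (m : nat) : set torus_fun := [set f | L2 f /\
  forall alpha : {ffun 'I_d -> 'I_m.+1},
    exists2 g, L2 g & distr_deriv (fun j => alpha j) f g].

Definition Hmix_norm (m : nat) f : R :=
  Num.sqrt (\sum_(alpha : {ffun 'I_d -> 'I_m.+1})
              L2norm (Dmulti (fun j => alpha j) f) ^+ 2).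

End torus_functions.

Arguments L2 : clear implicits.
Arguments Hmix : clear implicits.

(* Approximation numbers between two normed spaces X and Y whose elements are
   represented, up to equality almost everywhere, by functions: X is a linear
   subspace of E with a seminorm nX, and two elements of X are identified when
   nX vanishes on their difference; likewise for Y in F. An operator from X to Y
   is a map on representatives whose identities hold up to this identification;
   bounded_linear implies that it respects it. *)
Section approximation_numbers.
Context (R : realType) (E F : lmodType R[i]).
Variables (X : set E) (nX : E -> R) (Y : set F) (nY : F -> R).
Implicit Types T A : E -> F.

Definition opnorm T : \bar R :=
  ereal_sup [set (nY (T x))%:E | x in [set x | X x /\ nX x <= 1]].

Definition bounded_linear T :=
  [/\ forall x, X x -> Y (T x),
      forall (a : R[i]) x y, X x -> X y ->
        nY (T (a *: x + y) - (a *: T x + T y)) = 0 &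
      (opnorm T < +oo)%E].

Definition rank_lt (n : nat) T := exists r, (r < n)%N /\
  exists y : 'I_r -> F, (forall i, Y (y i)) /\
    forall x, X x -> exists c : 'I_r -> R[i], nY (T x - \sum_i c i *: y i) = 0.

Definition approx_number (n : nat) T : \bar R :=
  ereal_inf [set opnorm (T \- A) | A in [set A | bounded_linear A /\ rank_lt n A]].

End approximation_numbers.

(* Main.v *)
(* Testing D^alpha f = g against exponentials shows that the squared norm of f in
   H^m_mix is, up to the volume of the torus, the sum of w(k)^2 |c_k(f)|^2 with
   w(k)^2 = prod_j sum_(a <= m) |k_j|^(2a).  Hence, with N(r) the number of
   frequencies k such that w(k) <= r^m, truncating the Fourier series to these
   frequencies gives a_n <= r^-m as soon as N(r) < n; conversely, if n <= N(r), an
   operator of rank < n kills a nonzero trigonometric polynomial with frequencies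
   among them, so that a_n >= r^-m.  The squared weights lie between
   prod_j max(1, |k_j|)^(2m) and prod_j (1 + |k_j|)^(2m), so N(r) is, up to lower
   order terms, 2^d times the number of d-tuples of positive integers with product
   at most r, that is 2^d r (ln r)^(d-1) / (d-1)!; it remains to invert n = N(r).
   Completeness of the exponentials in L_2 does not go through approximate
   identities: the measurable sets whose indicator is an L_1 limit of trigonometric
   polynomials with values in [0, 1] form a sigma-algebra, which contains the
   "half-tori" {sin(b + t_j) > 0} and therefore all measurable sets. *)
Require Import Defs.
From mathcomp Require Import measurable_realfun.
From mathcomp Require Import zify ring lra.

Set Implicit Arguments.
Unset Strict Implicit.
Unset Printing Implicit Defensive.

Import Order.TTheory GRing.Theory Num.Theory.
Import numFieldNormedType.Exports.

Local Open Scope classical_set_scope.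
Local Open Scope ring_scope.

(** * Counting lattice points in hyperbolic crosses *)

(** The recursion for divisor sums evaluates them at all quotients [n %/ k], so a mere asymptotic
    statement cannot serve as induction hypothesis: they are bounded by explicit inequalities,
    uniform in the argument. [Dmulti] is an arbitrary L_2 solution of the distributional identity,
    about which only the Fourier coefficients are accessible. Completeness of the exponentials is
    therefore needed even to bound the Sobolev norm of a trigonometric polynomial, and not only for
    the truncation error. Infinite series are never formed: Bessel's inequality and its converse
    quantify over finite sets of frequencies. Operators are linear only up to functions of norm
    zero. Such functions have zero Fourier coefficients, so passing to coefficients turns identities
    modulo null functions into exact ones. N jumps, so [n = N(r)] has no solution in general.
    Instead r is chosen with N(r) < n <= N(r+1), which puts a_n between (r+1)^-m and r^-m; the gap
    closes because N(r+1)/N(r) and (r+1)/r tend to 1. *)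

Section lattice_points.
Local Open Scope nat_scope.

(** The number of [d]-tuples of positive integers with product at most [n], with [k] as first entry.
    For [d = 2] it is the summatory function of Dirichlet's divisor problem. *)
Fixpoint divisor_sum (d n : nat) : nat :=
  if d is d'.+1 then \sum_(1 <= k < n.+1) divisor_sum d' (n %/ k) else (0 < n).

Lemma divisor_sum0n d : divisor_sum d 0 = 0.
Proof. by case: d => //= d; rewrite big_geq. Qed.

Lemma leq_divisor_sumS d n : divisor_sum d n <= divisor_sum d.+1 n.
Proof.
case: n => [|n]; first by rewrite divisor_sum0n.
by rewrite /= big_ltn// divn1 leq_addr.
Qed.

Definition int_range (R : nat) : seq int :=
  0%R :: map Posz (iota 1 R) ++ map (fun k => - k%:Z : int)%R (iota 1 R).

(** Points are lists, so that recursion on the dimension peels off the head coordinate; [freq_of]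
    converts them into frequencies. *)
Fixpoint int_box (R d : nat) : seq (seq int) :=
  if d is d'.+1 then [seq k :: s | k <- int_range R, s <- int_box R d'] else [:: [::]].

Lemma mem_int_range R (k : int) : (k \in int_range R) = (`|k| <= R).
Proof.
rewrite /int_range inE mem_cat.
apply/idP/idP.
  case/or3P => [/eqP->//|/mapP[j]|/mapP[j]]; rewrite mem_iota => /andP[j1 jR] ->; lia.
move=> kR; case: (ltgtP k 0%R) => k0.
- apply/or3P; apply: Or33; apply/mapP; exists `|k|; last lia.
  by rewrite mem_iota; lia.
- apply/or3P; apply: Or32; apply/mapP; exists `|k|; last lia.
  by rewrite mem_iota; lia.
- by rewrite k0.
Qed.

Lemma uniq_int_range R : uniq (int_range R).
Proof.
rewrite /int_range cons_uniq cat_uniq !map_inj_uniq ?iota_uniq; try by move=> ? ?; lia.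
rewrite mem_cat /= andbT; apply/andP; split.
  by apply/norP; split; apply/mapP => -[j]; rewrite mem_iota; lia.
by apply/hasPn => x /mapP[a]; rewrite mem_iota => i1 ->; apply/mapP => -[j]; rewrite mem_iota; lia.
Qed.

Lemma mem_int_box R d (s : seq int) :
  (s \in int_box R d) = (size s == d) && all (fun k : int => `|k| <= R) s.
Proof.
elim: d s => [|d IH] s; first by rewrite inE; case: s.
apply/allpairsPdep/idP => [[k [t [kR tR ->]]]|].
  by rewrite /= eqSS -mem_int_range kR -IH.
case: s => // k s /=; rewrite eqSS => /and3P[sd kR sR].
by exists k, s; split => //; rewrite ?mem_int_range// IH sd.
Qed.

Lemma uniq_int_box R d : uniq (int_box R d).
Proof.
elim: d => // d IH; apply: allpairs_uniq => //; first exact: uniq_int_range.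
by move=> [k s] [l t] _ _ [-> ->].
Qed.

Lemma sum_int_range R (F : nat -> nat) :
  \sum_(k <- int_range R) F `|k| = F 0 + 2 * \sum_(1 <= k < R.+1) F k.
Proof.
rewrite /int_range big_cons big_cat /= !big_map /index_iota subn1 /=.
congr (_ + _); rewrite mul2n -addnn; congr (_ + _); apply: eq_bigr => k _.
by rewrite abszN.
Qed.

Section weighted_count.
Variables (g : nat -> nat) (R : nat).
Hypotheses (g0 : g 0 = 1) (g_gt0 : forall k, 0 < g k).

(** The weights used for [g] are [maxn 1] and [succn]. Both are at least 1 and dominate |k|, so the
    box loses no point as long as [n <= R]. *)
Definition weighted_count d n : nat :=
  \sum_(s <- int_box R d) (\prod_(k <- s) g `|k| <= n).

Lemma weighted_count0 n : weighted_count 0 n = (0 < n).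
Proof. by rewrite /weighted_count /= big_seq1 big_nil. Qed.

(** A zero head coordinate has weight 1 and leaves the bound [n] unchanged; k and -k contribute
    equally, whence the factor 2. *)
Lemma weighted_countS d n : weighted_count d.+1 n =
  weighted_count d n + 2 * \sum_(1 <= k < R.+1) weighted_count d (n %/ g k).
Proof.
have -> : weighted_count d.+1 n =
    \sum_(k <- int_range R) weighted_count d (n %/ g `|k|).
  rewrite /weighted_count big_allpairs_dep; apply: eq_bigr => k _.
  apply: eq_bigr => s _; rewrite big_cons leq_divRL; last exact: g_gt0.
  by rewrite mulnC.
by rewrite (sum_int_range R (fun k => weighted_count d (n %/ g k))) g0 divn1.
Qed.

Lemma weighted_countn0 d : weighted_count d 0 = 0.
Proof.
rewrite /weighted_count big1// => s _; rewrite leqn0.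
by apply/eqP; rewrite eqb0 -lt0n; apply: prodn_gt0 => i; exact: g_gt0.
Qed.

End weighted_count.

Lemma leq_weighted_count g h R d n : (forall k, g k <= h k) ->
  weighted_count h R d n <= weighted_count g R d n.
Proof.
move=> gh; apply: leq_sum => s _.
case: (leqP (\prod_(k <- s) h `|k|)) => // hn.
by rewrite (leq_trans _ hn)//; apply: leq_prod.
Qed.

Lemma weighted_count_maxn R d n : n <= R ->
  weighted_count (maxn 1) R d.+1 n = weighted_count (maxn 1) R d n +
    2 * \sum_(1 <= k < n.+1) weighted_count (maxn 1) R d (n %/ k).
Proof.
move=> nR; rewrite weighted_countS//; last by move=> k; lia.
congr (_ + 2 * _); rewrite (@big_cat_nat _ _ _ n.+1)//= [X in _ + X]big1_seq ?addn0.
  by apply: eq_big_nat => k /andP[k1 _]; congr (weighted_count _ _ _ (_ %/ _)); lia.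
move=> k; rewrite mem_index_iota /= => /andP[nk _].
rewrite divn_small; last lia.
by rewrite weighted_countn0// => ?; lia.
Qed.

(** The weight k+1 shifts the sum so that it starts at 2; completing it by the term k = 1 overshoots
    by twice the count in dimension [d], half of which the zero head coordinate supplies. The other
    half stands on the left to avoid a truncated subtraction. *)
Lemma weighted_count_succn R d n : 0 < n <= R ->
  weighted_count succn R d.+1 n + weighted_count succn R d n =
    2 * \sum_(1 <= k < n.+1) weighted_count succn R d (n %/ k).
Proof.
move=> /andP[n0 nR]; rewrite weighted_countS//.
rewrite [in RHS]big_ltn// divn1.
have -> : \sum_(1 <= k < R.+1) weighted_count succn R d (n %/ k.+1) =
          \sum_(2 <= k < n.+1) weighted_count succn R d (n %/ k).
  rewrite (@big_cat_nat _ _ _ n)//=; last lia.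
  rewrite [X in _ + X]big1_seq ?addn0; last first.
    move=> k; rewrite mem_index_iota /= => /andP[nk _].
    by rewrite divn_small ?weighted_countn0//; lia.
  by rewrite [in RHS]big_add1.
lia.
Qed.

(** The main term counts the signs of tuples without zero entry; a zero entry lowers the dimension.
    The constant 4^(d+1) closes the induction, since 2 * 4^(d+1) + 4^(d+1) + 2^(d+1) <= 4^(d+2). *)
Lemma weighted_count_maxn_le R d n : n <= R ->
  weighted_count (maxn 1) R d.+1 n <=
    2 ^ d.+1 * divisor_sum d.+1 n + 4 ^ d.+1 * divisor_sum d n.
Proof.
elim: d n => [|d IH] n nR.
  rewrite weighted_count_maxn// weighted_count0 /= expn1.
  by under eq_bigr do rewrite weighted_count0; lia.
rewrite weighted_count_maxn//.
have H : \sum_(1 <= k < n.+1) weighted_count (maxn 1) R d.+1 (n %/ k) <=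
    2 ^ d.+1 * divisor_sum d.+2 n + 4 ^ d.+1 * divisor_sum d.+1 n.
  rewrite [divisor_sum d.+2 n]/= [X in 4 ^ _ * X]/= !big_distrr -big_split /=.
  by apply: leq_sum => k _; apply: IH; rewrite (leq_trans (leq_div _ _)).
have := IH _ nR; have := leq_divisor_sumS d n.
have : 2 ^ d.+1 <= 4 ^ d.+1 by rewrite leq_exp2r.
rewrite (expnS 2 d.+1) (expnS 4 d.+1).
move: H; move: (2 ^ d.+1) (4 ^ d.+1) => a b.
move: (divisor_sum d.+2 n) (divisor_sum d.+1 n) (divisor_sum d n) => D2 D1 D0.
nia.
Qed.

(** The recursion for [succn] loses the count of one dimension less. That loss needs an upper bound,
    which comes from the count for the smaller weight [maxn 1]. *)
Lemma weighted_count_succn_ge R d n : n <= R ->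
  2 ^ d.+1 * divisor_sum d.+1 n <=
    weighted_count succn R d.+1 n + 4 ^ d.+1 * divisor_sum d n.
Proof.
elim: d n => [|d IH] [|n] nR; rewrite ?divisor_sum0n ?muln0//.
  have := @weighted_count_succn R 0 n.+1 nR.
  rewrite weighted_count0 /=; under eq_bigr do rewrite weighted_count0.
  by rewrite !expn1; lia.
have H1 := @weighted_count_succn R d.+1 n.+1 nR.
have H : 2 ^ d.+1 * divisor_sum d.+2 n.+1 <=
   \sum_(1 <= k < n.+2) weighted_count succn R d.+1 (n.+1 %/ k) +
   4 ^ d.+1 * divisor_sum d.+1 n.+1.
  rewrite [divisor_sum d.+2 _]/= [X in 4 ^ _ * X]/= !big_distrr -big_split /=.
  by apply: leq_sum => k _; apply: IH; rewrite (leq_trans (leq_div _ _)).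
have H2 : weighted_count succn R d.+1 n.+1 <=
    2 ^ d.+1 * divisor_sum d.+1 n.+1 + 4 ^ d.+1 * divisor_sum d n.+1.
  apply: leq_trans (weighted_count_maxn_le _ nR).
  by apply: leq_weighted_count => k; lia.
have := leq_divisor_sumS d n.+1.
have : 2 ^ d.+1 <= 4 ^ d.+1 by rewrite leq_exp2r.
rewrite (expnS 2 d.+1) (expnS 4 d.+1).
move: H1 H2 H; move: (2 ^ d.+1) (4 ^ d.+1) (\sum_(1 <= k < n.+2) _) => a b s.
move: (divisor_sum d.+2 _) (divisor_sum d.+1 _) (divisor_sum d _) => D2 D1 D0.
nia.
Qed.

(** This is the squared weight w(k)^2; comparing it with [r ^ (2 * m)] keeps the count inside the
    natural numbers. *)
Definition mix_weight m (s : seq int) :=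
  \prod_(k <- s) \sum_(a < m.+1) `|k| ^ (2 * a).

Definition mix_count d m r := count (fun s => mix_weight m s <= r ^ (2 * m)) (int_box r d).

(** In the induction step, (k+1)^2 >= k^2 + 1 makes room for the new term. *)
Lemma sum_exp_le m k : \sum_(a < m.+1) k ^ (2 * a) <= k.+1 ^ (2 * m).
Proof.
elim: m => [|m IH]; first by rewrite big_ord1.
rewrite big_ord_recr /= (leq_trans (leq_add IH (leqnn _)))//.
rewrite mulnS (expnD k) (expnD k.+1).
have : k ^ (2 * m) <= k.+1 ^ (2 * m) by case: (posnP m) => [->//|m0]; rewrite leq_exp2r// muln_gt0.
move: (k ^ (2 * m)) (k.+1 ^ (2 * m)) => a b ab.
have := leq_mul (leqnn (k ^ 2)) ab.
rewrite -[k.+1]addn1 sqrnD exp1n muln1 !mulnDl mul1n.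
by move: (k ^ 2 * a) (k ^ 2 * b) (2 * k * b) => x y z; lia.
Qed.

Lemma exp_maxn_le m k : maxn 1 k ^ (2 * m) <= \sum_(a < m.+1) k ^ (2 * a).
Proof.
case: k => [|k]; last by rewrite (maxn_idPr _)// big_ord_recr /= leq_addl.
by rewrite maxn0 exp1n big_ord_recl /= leq_addr.
Qed.

Lemma prod_expn (s : seq int) (F : int -> nat) n :
  (\prod_(k <- s) F k) ^ n = \prod_(k <- s) F k ^ n.
Proof. exact: (big_morph (expn^~ n) (fun x y => expnMn x y n) (exp1n n)). Qed.

Lemma mix_count_bounds d m r : 0 < m ->
  weighted_count succn r d r <= mix_count d m r <= weighted_count (maxn 1) r d r.
Proof.
move=> m0; rewrite /mix_count /weighted_count -!sum1_count [in X in _ <= X <= _]big_mkcond /=.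
have m2 : 0 < 2 * m by lia.
apply/andP; split; apply: leq_sum => s _.
  case: (leqP (\prod_(k <- s) `|k|.+1)) => // sr; rewrite ifT// /mix_weight.
  rewrite -(leq_exp2r _ _ m2) in sr; apply: leq_trans sr.
  rewrite prod_expn; apply: leq_prod => k _; exact: sum_exp_le.
case: ifP => // sr.
rewrite lt0b -(leq_exp2r _ _ m2) (leq_trans _ sr)//.
rewrite prod_expn; apply: leq_prod => k _; exact: exp_maxn_le.
Qed.

(** The box in [mix_count] cuts nothing off: the factor of one coordinate is at most the whole
    weight, the other factors being at least 1. *)
Lemma mem_mix_box d m r s : 0 < m -> size s = d -> mix_weight m s <= r ^ (2 * m) ->
  s \in int_box r d.
Proof.
move=> m0 sd sr; rewrite mem_int_box sd eqxx /=; apply/allP => k ks.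
have m2 : 0 < 2 * m by lia.
rewrite -(leq_exp2r _ _ m2) (leq_trans _ sr)// /mix_weight (big_rem k)//=.
apply: (@leq_trans (maxn 1 `|k| ^ (2 * m))); first by rewrite leq_exp2r// leq_maxr.
rewrite (leq_trans (exp_maxn_le _ _))// leq_pmulr//.
by apply: prodn_gt0 => i; rewrite big_ord_recl /=.
Qed.

End lattice_points.

(** * Two-sided estimates for the number of tuples with bounded product *)

Section divisor_sum_asymptotics.
Variable R : realType.
Implicit Types (x y a b : R) (d n k : nat).

(** The mean value inequality for x^(d+1): in the factorisation of the difference, the second factor
    is a sum of d+1 monomials between b^d and a^d. It converts differences of powers into
    telescoping sums. *)
Lemma lerB_exp d a b : 0 <= b -> b <= a ->
  d.+1%:R * (a - b) * b ^+ d <= a ^+ d.+1 - b ^+ d.+1 <= d.+1%:R * (a - b) * a ^+ d.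
Proof.
move=> b0 ba; have a0 := le_trans b0 ba; have ab : 0 <= a - b by rewrite subr_ge0.
have cst c : d.+1%:R * (a - b) * c = (a - b) * \sum_(i < d.+1) c.
  by rewrite sumr_const card_ord mulr_natl mulrnAl mulrnAr.
rewrite subrXX !cst; apply/andP; split; apply: ler_wpM2l => //; apply: ler_sum => i _ /=.
  have -> : b ^+ d = b ^+ (d - i) * b ^+ i by rewrite -exprD subnK// -ltnS.
  by apply: ler_wpM2r; rewrite ?exprn_ge0// lerXn2r.
have -> : a ^+ d = a ^+ (d - i) * a ^+ i by rewrite -exprD subnK// -ltnS.
by apply: ler_wpM2l; rewrite ?exprn_ge0// lerXn2r.
Qed.

(** Both bounds are ln(1 + x) <= x, at x = -1/(k+1) and at x = 1/k. *)
Lemma ln_natS_bounds k : (0 < k)%N ->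
  k.+1%:R^-1 <= ln (k.+1%:R : R) - ln k%:R <= k%:R^-1.
Proof.
move=> k0; have kR : (0 : R) < k%:R by rewrite ltr0n.
have kS : (0 : R) < k.+1%:R by rewrite ltr0n.
apply/andP; split.
  have := @le_ln1Dx R (- k.+1%:R^-1).
  have -> : 1 + - k.+1%:R^-1 = k%:R / k.+1%:R :> R.
    by rewrite -(natr1 k); field; rewrite natr1 gt_eqF.
  rewrite ln_div ?posrE// => H.
  suff : (-1 : R) < - k.+1%:R^-1 by move=> /H; rewrite lerNr opprB.
  by rewrite ltrN2 invf_lt1// ltr1n.
have := @le_ln1Dx R k%:R^-1.
have -> : 1 + k%:R^-1 = k.+1%:R / k%:R :> R.
  by rewrite -(natr1 k); field; rewrite gt_eqF.
rewrite ln_div ?posrE//; apply.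
by rewrite (lt_trans _ (_ : 0 < _)) ?invr_gt0// oppr_lt0.
Qed.

Lemma natr_divn_le n k x : n%:R <= x -> (n %/ k)%:R <= x / k%:R.
Proof.
move=> nx; have [->|k0] := posnP k; first by rewrite divn0 invr0 mulr0.
rewrite ler_pdivlMr ?ltr0n//; apply: le_trans nx.
by rewrite -natrM ler_nat leq_trunc_div.
Qed.

(* With y_k = ln(x/k) + d, the differences of y_k^(d+1)/(d+1) dominate
   y_(k+1)^d/(k+1), so the sum of the latter telescopes; the first term is absorbed
   in the shift from d to d+1. *)
Lemma divisor_sum_le d n x : 1 <= x -> n%:R <= x ->
  (divisor_sum d.+1 n)%:R <= x * (ln x + d%:R) ^+ d / d`!%:R.
Proof.
elim: d n x => [|d IH] n x x1 nx.
  rewrite expr0 divr1 mulr1 (le_trans _ nx)// ler_nat /=.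
  rewrite (@leq_trans (\sum_(1 <= k < n.+1) 1)%N)//.
    by apply: leq_sum => k _; exact: leq_b1.
  by rewrite sum_nat_const_nat muln1 subn1.
have x0 : 0 < x by rewrite (lt_le_trans _ x1).
have lnx : 0 <= ln x by rewrite ln_ge0.
have d1 : (0 : R) < d.+1%:R by rewrite ltr0n.
have fd : d`!%:R != 0 :> R by rewrite pnatr_eq0 -lt0n fact_gt0.
have [n0|n0] := posnP n.
  rewrite n0 divisor_sum0n mulr_ge0// mulr_ge0 ?exprn_ge0 ?addr_ge0// ltW//.
pose y k := ln x - ln k%:R + d%:R.
have lnk k : (0 < k)%N -> (k <= n)%N -> 0 <= ln x - ln k%:R.
  move=> k0 kn; rewrite subr_ge0 ler_ln ?posrE ?ltr0n//.
  by rewrite (le_trans _ nx)// ler_nat.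
have y0 k : (0 < k)%N -> (k <= n)%N -> 0 <= y k.
  by move=> k0 kn; rewrite addr_ge0// lnk.
have step k : (0 < k)%N -> (k <= n)%N ->
    (divisor_sum d.+1 (n %/ k))%:R <= x / d`!%:R * (y k ^+ d / k%:R).
  move=> k0 kn; have kR : (0 : R) < k%:R by rewrite ltr0n.
  have -> : x / d`!%:R * (y k ^+ d / k%:R) =
            x / k%:R * (ln (x / k%:R) + d%:R) ^+ d / d`!%:R.
    rewrite ln_div ?posrE// -/(y k); field.
    by rewrite fd lt0r_neq0.
  apply: IH; last exact: natr_divn_le.
  by rewrite ler_pdivlMr// mul1r (le_trans _ nx)// ler_nat.
have tele k : (0 < k)%N -> (k.+1 <= n)%N ->
    y k.+1 ^+ d / k.+1%:R <= (y k ^+ d.+1 - y k.+1 ^+ d.+1) / d.+1%:R.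
  move=> k0 kn; have /andP[l1 l2] := ln_natS_bounds k0.
  have yk : k.+1%:R^-1 <= y k - y k.+1.
    by rewrite (_ : y k - _ = ln k.+1%:R - ln k%:R)// /y; ring.
  have yle : y k.+1 <= y k.
    by rewrite -subr_ge0 (le_trans _ yk)// invr_ge0.
  have /andP[+ _] := @lerB_exp d (y k) (y k.+1) (y0 k.+1 isT kn) yle.
  rewrite ler_pdivlMr//; apply: le_trans.
  rewrite [leLHS](_ : _ = d.+1%:R * k.+1%:R^-1 * y k.+1 ^+ d); last by ring.
  apply: ler_wpM2r; first by rewrite exprn_ge0// y0.
  exact: ler_wpM2l (ltW d1) _ _ yk.
have Hsum j : (j < n)%N -> \sum_(1 <= k < j.+2) y k ^+ d / k%:R <=
    y 1%N ^+ d + (y 1%N ^+ d.+1 - y j.+1 ^+ d.+1) / d.+1%:R.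
  elim: j => [|j IHj] jn; first by rewrite big_nat1 divr1 subrr mul0r addr0.
  rewrite big_nat_recr//=; apply: le_trans (lerD (IHj (ltnW jn)) (tele j.+1 isT jn)) _.
  by rewrite -addrA -mulrDl addrA subrK.
rewrite [divisor_sum _ _]/= natr_sum.
apply: (@le_trans _ _ (\sum_(1 <= k < n.+1) x / d`!%:R * (y k ^+ d / k%:R))).
  by apply: ler_sum_nat => k /andP[k1 kn]; exact: step.
rewrite -mulr_sumr.
have := @Hsum n.-1; rewrite prednK// leqnn => /(_ isT) {}Hsum.
have y1 : y 1%N = ln x + d%:R by rewrite /y ln1 subr0.
have yn := y0 n n0 (leqnn n).
have Hb : y 1%N ^+ d + y 1%N ^+ d.+1 / d.+1%:R <= (y 1%N + 1) ^+ d.+1 / d.+1%:R.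
  have /andP[+ _] := @lerB_exp d (y 1%N + 1) (y 1%N) (y0 1%N isT n0) ltac:(by rewrite lerDl).
  rewrite [y 1%N + 1]addrC addrK mulr1 => H.
  by rewrite ler_pdivlMr// mulrDl divfK ?gt_eqF//; lra.
rewrite -(natr1 d) addrA -y1 [leRHS](_ : _ = x / d`!%:R * ((y 1%N + 1) ^+ d.+1 / d.+1%:R)).
  apply: ler_wpM2l; first by rewrite divr_ge0 ?ler0n// ltW.
  apply: le_trans Hsum _; apply: le_trans Hb; rewrite lerD2l mulrBl gerBl.
  by rewrite divr_ge0 ?exprn_ge0 ?ler0n.
rewrite factS natrM; field.
by rewrite fd nat1r lt0r_neq0.
Qed.

(* The parameter T is the price of the integer parts: n >= (1 - 1/T) x as soon as
   T <= x < n+1. *)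
Lemma divisor_sum_ge d n x T : 1 <= T -> T <= x -> x < n.+1%:R ->
  (1 - T^-1) * x * (ln x - ln T) ^+ d / d`!%:R <= (divisor_sum d.+1 n)%:R.
Proof.
move=> T1; have T0 : 0 < T by rewrite (lt_le_trans _ T1).
elim: d n x => [|d IH] n x Tx xn.
  rewrite expr0 divr1 mulr1.
  have -> : divisor_sum 1 n = n.
    rewrite /= (eq_big_nat _ _ (F2 := fun=> 1%N)).
      by rewrite sum_nat_const_nat muln1 subn1.
    by move=> k /andP[k1 kn]; rewrite divn_gt0// -ltnS kn.
  rewrite mulrBl mul1r lerBlDr (le_trans (ltW xn))// -(natr1 n) lerD2l.
  by rewrite mulrC ler_pdivlMr// mul1r.
have x0 : 0 < x by rewrite (lt_le_trans _ Tx).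
have d1 : (0 : R) < d.+1%:R by rewrite ltr0n.
have fd : d`!%:R != 0 :> R by rewrite pnatr_eq0 -lt0n fact_gt0.
have c0 : 0 <= 1 - T^-1 by rewrite subr_ge0 invf_le1.
(* Only the terms with k <= x/T are kept: for them x/k >= T, as the induction hypothesis demands. *)
pose z := x / T; have z0 : 0 < z by rewrite divr_gt0.
have z1 : 1 <= z by rewrite ler_pdivlMr// mul1r.
have lnz : ln z = ln x - ln T by rewrite ln_div ?posrE.
pose K := Num.truncn z.
have /andP[Kz zK] : K%:R <= z < K.+1%:R by apply: truncn_itv; rewrite ltW.
have K0 : (0 < K)%N by rewrite -ltnS -(ltr_nat R) (le_lt_trans z1).
have Kn : (K <= n)%N.
  rewrite -ltnS -(ltr_nat R) (le_lt_trans _ xn)// (le_trans Kz)//.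
  by rewrite ler_pdivrMr// ler_peMr// ltW.
pose l k := ln z - ln k%:R.
have l0 k : (0 < k)%N -> (k <= K)%N -> 0 <= l k.
  move=> k0 kK; rewrite subr_ge0 ler_ln ?posrE ?ltr0n//.
  by rewrite (le_trans _ Kz)// ler_nat.
have step k : (0 < k)%N -> (k <= K)%N ->
    (1 - T^-1) * x / d`!%:R * (l k ^+ d / k%:R) <= (divisor_sum d.+1 (n %/ k))%:R.
  move=> k0 kK; have kR : (0 : R) < k%:R by rewrite ltr0n.
  have -> : (1 - T^-1) * x / d`!%:R * (l k ^+ d / k%:R) =
      (1 - T^-1) * (x / k%:R) * (ln (x / k%:R) - ln T) ^+ d / d`!%:R.
    rewrite ln_div ?posrE// addrAC -lnz -/(l k); field.
    by rewrite fd !lt0r_neq0.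
  apply: IH.
    rewrite ler_pdivlMr// mulrC -ler_pdivlMr// (le_trans _ Kz)//.
    by rewrite ler_nat.
  (* The condition x < n+1 passes to quotients because n+1 <= k ([n %/ k] + 1). *)
  rewrite ltr_pdivrMr// -natrM (lt_le_trans xn)// ler_nat mulSn addnC.
  by rewrite {1}(divn_eq n k) -addnS leq_add2l ltn_pmod.
have tele k : (0 < k)%N -> (k.+1 <= K)%N ->
    (l k ^+ d.+1 - l k.+1 ^+ d.+1) / d.+1%:R <= l k ^+ d / k%:R.
  move=> k0 kK; have /andP[l1 l2] := ln_natS_bounds k0.
  have lk : l k - l k.+1 = ln k.+1%:R - ln k%:R by rewrite /l; ring.
  have lle : l k.+1 <= l k.
    by rewrite -subr_ge0 lk (le_trans _ l1)// invr_ge0.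
  have /andP[_ +] := @lerB_exp d (l k) (l k.+1) (l0 k.+1 isT kK) lle.
  rewrite ler_pdivrMr// lk => /le_trans; apply.
  rewrite [leRHS](_ : _ = d.+1%:R * k%:R^-1 * l k ^+ d); last by ring.
  apply: ler_wpM2r; first by rewrite exprn_ge0// l0// ltnW.
  exact: ler_wpM2l (ltW d1) _ _ l2.
have Hsum j : (j < K)%N -> (l 1%N ^+ d.+1 - l j.+1 ^+ d.+1) / d.+1%:R <=
    \sum_(1 <= k < j.+1) l k ^+ d / k%:R.
  elim: j => [|j IHj] jK; first by rewrite big_geq// subrr mul0r.
  rewrite big_nat_recr//=; apply: le_trans (lerD (IHj (ltnW jK)) (tele j.+1 isT jK)).
  by rewrite -mulrDl addrA subrK.
(* Telescoping up to K-1 leaves the remainder l_K^(d+1)/(d+1). The K-th summand covers it, since z <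
   K+1 gives l_K <= 1/K. *)
have last_term : l K ^+ d.+1 / d.+1%:R <= l K ^+ d / K%:R.
  have /andP[_ l2] := ln_natS_bounds K0.
  have lK : l K <= K%:R^-1.
    apply: le_trans l2; rewrite lerD2r ler_ln ?posrE ?ltr0n//; exact: ltW.
  rewrite exprSr -mulrA; apply: ler_wpM2l; first by rewrite exprn_ge0// l0.
  rewrite ler_pdivrMr// (le_trans lK)// ler_peMr ?invr_ge0//.
  by rewrite ler1n.
have l1 : l 1%N = ln x - ln T by rewrite /l ln1 subr0 lnz.
apply: (@le_trans _ _ (\sum_(1 <= k < K.+1) (1 - T^-1) * x / d`!%:R * (l k ^+ d / k%:R))).
  rewrite -mulr_sumr.
  rewrite [leLHS](_ : _ = (1 - T^-1) * x / d`!%:R * (l 1%N ^+ d.+1 / d.+1%:R)).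
    apply: ler_wpM2l; first by rewrite divr_ge0 ?ler0n// mulr_ge0// ltW.
    rewrite big_nat_recr//=; have := @Hsum K.-1; rewrite prednK// leqnn => /(_ isT) {}Hsum.
    by apply: le_trans (lerD Hsum last_term); rewrite -mulrDl subrK.
  rewrite l1 factS natrM; field.
  by rewrite fd nat1r !lt0r_neq0.
rewrite [divisor_sum _ _]/= [X in _ <= X%:R](@big_cat_nat _ _ _ K.+1)//= natrD natr_sum.
rewrite ler_wpDr ?ler0n//.
by apply: ler_sum_nat => k /andP[k1 kK]; exact: step.
Qed.

End divisor_sum_asymptotics.

(** * Asymptotics of the counting function *)

Section mix_count_asymptotics.
Variable R : realType.
Local Notation L n := (ln (n%:R : R)).

Lemma cvg_ln_nat : L n @[n --> \oo] --> +oo.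
Proof.
apply/cvgryPge => A; near=> n.
have An : expR A <= n%:R by near: n; exact: (cvgryPge (fun n : nat => n%:R : R)).1 (@cvgr_idn R) _.
by rewrite -(expRK A) ler_ln ?posrE ?expR_gt0// (lt_le_trans _ An)// expR_gt0.
Unshelve. all: end_near. Qed.

Lemma cvg_inv_y (f : nat -> R) : f n @[n --> \oo] --> +oo -> (f n)^-1 @[n --> \oo] --> 0.
Proof.
move=> fy; apply/gtr0_cvgV0 => //.
by apply: cvgry_gt.
Qed.

Lemma cvg_sqrt_y (f : nat -> R) : f n @[n --> \oo] --> +oo ->
  Num.sqrt (f n) @[n --> \oo] --> +oo.
Proof.
move=> fy; apply/cvgryPge => A; near=> n.
have fA : `|A| ^+ 2 <= f n by near: n; exact: (cvgryPge f).1 fy _.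
rewrite (le_trans (ler_norm A))// -(ler_sqr (_ : `|A| \is Num.nneg)) ?nnegrE//.
by rewrite sqr_sqrtr// (le_trans _ fA)// exprn_ge0.
Unshelve. all: end_near. Qed.

Lemma cvg_exp (f : nat -> R) (l : R) k : f n @[n --> \oo] --> l ->
  f n ^+ k @[n --> \oo] --> l ^+ k.
Proof. by move=> fl; apply: (cvg_comp f (fun x => x ^+ k)) fl _; exact: exprn_continuous. Qed.

(** The lower estimate is applied with T = exp(sqrt(ln n)): T tends to infinity, while ln T is
    negligible against ln n. Both 1 - 1/T and 1 - ln T / ln n are then at least 1 - 1/sqrt(ln n);
    the first occurs once and the second d times, whence the exponent d+1. *)
Lemma cvg_divisor_sum d :
  (divisor_sum d.+1 n)%:R / (n%:R * L n ^+ d) @[n --> \oo] --> (d`!%:R : R)^-1.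
Proof.
have Ly := cvg_ln_nat.
apply: (@squeeze_cvgr _ _ _ _
  (fun n => (1 - (Num.sqrt (L n))^-1) ^+ d.+1 / d`!%:R)
  (fun n => (1 + d%:R * (L n)^-1) ^+ d / d`!%:R)).
- near=> n.
  have n1 : (1 : R) <= n%:R by rewrite ler1n; near: n; exact: nbhs_infty_ge.
  have n0 : (0 : R) < n%:R by rewrite (lt_le_trans _ n1).
  have L1 : 1 <= L n by near: n; exact: (cvgryPge _).1 Ly _.
  have L0 : 0 < L n by rewrite (lt_le_trans _ L1).
  set s := Num.sqrt (L n).
  have s1 : 1 <= s by rewrite -[leLHS]sqrtr1 ler_wsqrtr.
  have s0 : 0 < s by rewrite (lt_le_trans _ s1).
  have sL : s ^+ 2 = L n by rewrite sqr_sqrtr// ltW.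
  have fd : 0 < d`!%:R :> R by rewrite ltr0n fact_gt0.
  apply/andP; split.
    rewrite ler_pdivlMr ?mulr_gt0 ?exprn_gt0//.
    have T1 : 1 <= expR s by rewrite -[leLHS]expR0 ler_expR ltW.
    have Tn : expR s <= n%:R.
      rewrite -[leRHS]lnK ?posrE// ler_expR -/(L n) -sL expr2.
      by rewrite ler_peMl// ltW.
    have nS : (n%:R : R) < n.+1%:R by rewrite ltr_nat.
    apply: le_trans (divisor_sum_ge d T1 Tn nS).
    rewrite expRK -/(L n) exprS.
    have -> : (L n - s) = L n * (1 - s^-1).
      by rewrite -sL; field; rewrite gt_eqF.
    set c := n%:R * L n ^+ d * (1 - s^-1) ^+ d / d`!%:R.
    rewrite exprMn [leLHS](_ : _ = (1 - s^-1) * c); last by rewrite /c; ring.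
    rewrite [leRHS](_ : _ = (1 - (expR s)^-1) * c); last by rewrite /c; ring.
    apply: ler_wpM2r.
      rewrite divr_ge0 ?ler0n// mulr_ge0 ?mulr_ge0 ?exprn_ge0 ?(ltW L0)//.
      by rewrite subr_ge0 invf_le1.
    rewrite lerD2l lerN2 lef_pV2 ?posrE ?expR_gt0//.
    by rewrite (le_trans _ (expR_ge1Dx s))// lerDr.
  rewrite ler_pdivrMr ?mulr_gt0 ?exprn_gt0//.
  apply: le_trans (divisor_sum_le d n1 (lexx _)) _.
  have -> : L n + d%:R = L n * (1 + d%:R / L n) by field; rewrite gt_eqF.
  rewrite exprMn le_eqVlt; apply/orP; left; apply/eqP; ring.
- rewrite [X in _ --> X](_ : _ = 1 ^+ d.+1 / d`!%:R); last by rewrite expr1n mul1r.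
  apply: cvgM; last exact: cvg_cst.
  apply: cvg_exp; rewrite -[X in _ --> X]subr0; apply: cvgB; first exact: cvg_cst.
  exact/cvg_inv_y/cvg_sqrt_y.
- rewrite [X in _ --> X](_ : _ = 1 ^+ d / d`!%:R); last by rewrite expr1n mul1r.
  apply: cvgM; last exact: cvg_cst.
  apply: cvg_exp; rewrite -[X in _ --> X]addr0; apply: cvgD; first exact: cvg_cst.
  rewrite -[X in _ --> X](mulr0 d%:R); apply: cvgM; first exact: cvg_cst.
  exact: cvg_inv_y.
Unshelve. all: end_near. Qed.

(** One dimension less costs a factor ln n; in dimension 0 the count is at most 1 and the factor n
    alone suffices. *)
Lemma cvg_divisor_sum_lower d :
  (divisor_sum d n)%:R / (n%:R * L n ^+ d) @[n --> \oo] --> (0 : R).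
Proof.
case: d => [|d].
  under eq_fun do rewrite expr0 mulr1.
  apply: (@squeeze_cvgr _ _ _ _ (fun=> 0) (fun n => n%:R^-1)).
  - near=> n; rewrite divr_ge0//= -[leRHS]mul1r ler_wpM2r ?invr_ge0//.
    by rewrite lern1 leq_b1.
  - exact: cvg_cst.
  - by apply: cvg_inv_y; exact: cvgr_idn.
have := cvgM (@cvg_divisor_sum d) (cvg_inv_y cvg_ln_nat).
rewrite mulr0 => /(_ eventually_filter) H; apply: (cvg_trans _ H).
apply: near_eq_cvg; near=> n => /=.
by rewrite -mulrA -invfM -[in LHS]mulrA -exprSr.
Unshelve. all: end_near. Qed.

Lemma cvg_mix_count d m : (0 < m)%N ->
  (mix_count d.+1 m r)%:R / (r%:R * L r ^+ d) @[r --> \oo] --> 2 ^+ d.+1 / (d`!%:R : R).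
Proof.
move=> m0.
pose A r : R := (divisor_sum d.+1 r)%:R / (r%:R * L r ^+ d).
pose B r : R := (divisor_sum d r)%:R / (r%:R * L r ^+ d).
apply: (@squeeze_cvgr _ _ _ _
  (fun r => 2 ^+ d.+1 * A r - 4 ^+ d.+1 * B r)
  (fun r => 2 ^+ d.+1 * A r + 4 ^+ d.+1 * B r)).
- near=> r; rewrite /A /B !mulrA -mulrBl -mulrDl.
  have i0 : 0 <= (r%:R * L r ^+ d)^-1.
    rewrite invr_ge0 mulr_ge0// exprn_ge0// ln_ge0// ler1n.
    by near: r; exact: nbhs_infty_ge.
  have /andP[N1 N2] := mix_count_bounds d.+1 r m0.
  have H1 := weighted_count_succn_ge d (leqnn r).
  have H2 := weighted_count_maxn_le d (leqnn r).
  apply/andP; split; apply: ler_wpM2r => //; rewrite ?lerBlDr -!natrX -!natrM -?natrD ler_nat; lia.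
- rewrite -[X in _ --> X]subr0; apply: cvgB.
    by apply: cvgM; [exact: cvg_cst|exact: cvg_divisor_sum].
  rewrite -[X in _ --> X](mulr0 (4 ^+ d.+1)).
  by apply: cvgM; [exact: cvg_cst|exact: cvg_divisor_sum_lower].
- rewrite -[X in _ --> X]addr0; apply: cvgD.
    by apply: cvgM; [exact: cvg_cst|exact: cvg_divisor_sum].
  rewrite -[X in _ --> X](mulr0 (4 ^+ d.+1)).
  by apply: cvgM; [exact: cvg_cst|exact: cvg_divisor_sum_lower].
Unshelve. all: end_near. Qed.

End mix_count_asymptotics.

(** A crude bound that makes N(r) positive and unbounded for the inversion. Of the two copies of the
    sum in the recursion, one has n terms that are at least 1, and in the other the term k = 1 pays
    for the count in dimension [d]. *)
Lemma leq_weighted_count_succn R d n : (n <= R)%N ->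
  (n <= weighted_count succn R d.+1 n)%N.
Proof.
case: n => [//|n] nR.
have pos e k : (0 < k <= R)%N -> (0 < weighted_count succn R e k)%N.
  case/andP; elim: e k => [|e IH] k k0 kR; first by rewrite weighted_count0 k0.
  by rewrite weighted_countS// ltn_addr// IH.
have := @weighted_count_succn R d n.+1 nR.
suff : (n.+1 + weighted_count succn R d n.+1 <=
  2 * \sum_(1 <= k < n.+2) weighted_count succn R d (n.+1 %/ k))%N by lia.
rewrite mul2n -addnn leq_add//; last by rewrite big_ltn// divn1 leq_addr.
rewrite (@leq_trans (\sum_(1 <= k < n.+2) 1)%N)//.
  by rewrite sum_nat_const_nat muln1 subn1.
rewrite big_nat_cond [leqRHS]big_nat_cond; apply: leq_sum => k /andP[/andP[k0 kn] _].
by rewrite pos// divn_gt0// -ltnS kn (leq_trans (leq_div _ _)).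
Qed.

Lemma leq_mix_count d m r : (0 < m)%N -> (r <= mix_count d.+1 m r)%N.
Proof.
move=> m0; have /andP[+ _] := mix_count_bounds d.+1 r m0.
exact/leq_trans/leq_weighted_count_succn.
Qed.

(** * From the counting function to the approximation numbers *)

Section inversion.
Variables (R : realType) (d m : nat) (N : nat -> nat) (C : R).
Local Notation L n := (ln (n%:R : R)).
Hypotheses (C0 : 0 < C) (Nge : forall r, (r <= N r)%N).
Hypothesis Ncvg : (N r)%:R / (r%:R * L r ^+ d) @[r --> \oo] --> C.

Lemma cvg_ratioS : r.+1%:R / r%:R @[r --> \oo] --> (1 : R).
Proof.
have H : 1 + r%:R^-1 @[r --> \oo] --> (1 + 0 : R).
  by apply: cvgD; [exact: cvg_cst|apply: cvg_inv_y; exact: cvgr_idn].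
rewrite addr0 in H; apply: (cvg_trans _ H); apply: near_eq_cvg; near=> r.
have r0 : r%:R != 0 :> R by rewrite pnatr_eq0 -lt0n; near: r; exact: nbhs_infty_gt.
by field.
Unshelve. all: end_near. Qed.

Lemma cvg_ln_ratioS : L r.+1 / L r @[r --> \oo] --> (1 : R).
Proof.
apply: (@squeeze_cvgr _ _ _ _ (fun=> 1) (fun r => 1 + r%:R^-1 * (L r)^-1)).
- near=> r.
  have r1 : (1 < r)%N by near: r; exact: nbhs_infty_gt.
  have L0 : 0 < L r by rewrite ln_gt0// ltr1n.
  have r0 := ltnW r1.
  rewrite ler_pdivlMr// mul1r ler_pdivrMr// mulrDl mul1r divfK ?gt_eqF//.
  have /andP[H1 H2] := ln_natS_bounds R r0.
  by rewrite -lerBlDl H2 andbT -subr_ge0 (le_trans _ H1)// invr_ge0.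
- exact: cvg_cst.
- rewrite -[X in _ --> X]addr0; apply: cvgD; first exact: cvg_cst.
  rewrite -[X in _ --> X](mulr0 (0 : R)); apply: cvgM; apply: cvg_inv_y.
    exact: cvgr_idn.
  exact: cvg_ln_nat.
Unshelve. all: end_near. Qed.

(** With s the square root of ln r, ln ln r = 2 ln s <= 2 s, and s is negligible against ln r. *)
Lemma cvg_lnln : ln (L r) / L r @[r --> \oo] --> (0 : R).
Proof.
apply: (@squeeze_cvgr _ _ _ _ (fun=> 0) (fun r => 2 * (Num.sqrt (L r))^-1)).
- near=> r.
  have L1 : 1 <= L r by near: r; exact: (cvgryPge _).1 (@cvg_ln_nat R) _.
  have L0 : 0 < L r by rewrite (lt_le_trans _ L1).
  set s := Num.sqrt (L r).
  have s0 : 0 < s by rewrite sqrtr_gt0.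
  have sL : s ^+ 2 = L r by rewrite sqr_sqrtr// ltW.
  have r1 : (1 : R) <= r%:R by rewrite ler1n; near: r; exact: nbhs_infty_ge.
  rewrite divr_ge0 ?ln_ge0 ?(ltW L0)//=.
  rewrite -sL lnXn// -[ln s *+ 2]mulr_natl ler_pdivrMr ?exprn_gt0// -mulrA ler_wpM2l//.
  rewrite expr2 mulrA mulVf ?gt_eqF// mul1r; exact/ltW/ln_sublinear.
- exact: cvg_cst.
- rewrite -[X in _ --> X](mulr0 (2 : R)); apply: cvgM; first exact: cvg_cst.
  by apply: cvg_inv_y; apply: cvg_sqrt_y; exact: cvg_ln_nat.
Unshelve. all: end_near. Qed.

(** Taking logarithms in the asymptotics of N gives ln N(r) = ln r + d ln ln r + O(1). *)
Lemma cvg_ln_count : L (N r) / L r @[r --> \oo] --> (1 : R).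
Proof.
have H : ln ((N r)%:R / (r%:R * L r ^+ d)) * (L r)^-1 + (1 + d%:R * (ln (L r) / L r))
    @[r --> \oo] --> ln C * 0 + (1 + d%:R * 0).
  apply: cvgD.
    apply: cvgM; last by apply: cvg_inv_y; exact: cvg_ln_nat.
    by apply: (cvg_comp _ (@ln R)) Ncvg _; exact: continuous_ln.
  apply: cvgD; first exact: cvg_cst.
  apply: cvgM; first exact: cvg_cst.
  exact: cvg_lnln.
rewrite !mulr0 add0r addr0 in H; apply: (cvg_trans _ H); apply: near_eq_cvg; near=> r.
have r1 : (1 < r)%N by near: r; exact: nbhs_infty_gt.
have L0 : 0 < L r by rewrite ln_gt0// ltr1n.
have r0 : (0 : R) < r%:R by rewrite ltr0n ltnW.
have N0 : (0 : R) < (N r)%:R by rewrite ltr0n (leq_trans (ltnW r1)).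
rewrite ln_div ?posrE ?mulr_gt0 ?exprn_gt0// lnM ?posrE ?exprn_gt0// lnXn// -mulr_natl.
by field; rewrite gt_eqF.
Unshelve. all: end_near. Qed.

(** For N(r) < n <= N(r+1) this quotient dominates n / (r (ln n)^d), by n <= N(r+1) and ln r <= ln
    n. *)
Lemma cvg_count_upper :
  (N r.+1)%:R / (r%:R * L r ^+ d) @[r --> \oo] --> C.
Proof.
have NS : (N r.+1)%:R / (r.+1%:R * L r.+1 ^+ d) @[r --> \oo] --> C 
  by have := Ncvg; rewrite -(cvg_shiftS (fun r => (N r)%:R / (r%:R * L r ^+ d))).
have H := cvgM (cvgM NS cvg_ratioS) (cvg_exp (k := d) cvg_ln_ratioS).
rewrite expr1n !mulr1 in H; have {}H := H eventually_filter eventually_filter.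
apply: (cvg_trans _ H); apply: near_eq_cvg; near=> r => /=.
have r1 : (1 < r)%N by near: r; exact: nbhs_infty_gt.
have L0 : 0 < L r by rewrite ln_gt0// ltr1n.
have LS0 : 0 < L r.+1 by rewrite ln_gt0// ltr1n (ltn_trans r1).
have r0 : (0 : R) < r%:R by rewrite ltr0n ltnW.
rewrite expr_div_n; field.
by rewrite !expf_neq0 ?gt_eqF// nat1r.
Unshelve. all: end_near. Qed.

(** For N(r) < n <= N(r+1) this quotient is at most n / ((r+1) (ln n)^d). The logarithm of N(r+1) is
    needed because ln n may exceed ln(r+1). *)
Lemma cvg_count_lower :
  (N r)%:R / (r.+1%:R * L (N r.+1) ^+ d) @[r --> \oo] --> C.
Proof.
have lnNS : L (N r.+1) / L r.+1 @[r --> \oo] --> (1 : R).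
  by have := cvg_ln_count; rewrite -(cvg_shiftS (fun r => L (N r) / L r)).
have H1 : (r.+1%:R / r%:R)^-1 @[r --> \oo] --> (1 : R)^-1.
  by apply: cvgV cvg_ratioS; exact: oner_neq0.
have H2 : ((L (N r.+1) / L r.+1 * (L r.+1 / L r)) ^+ d)^-1 @[r --> \oo] --> (1 : R)^-1.
  apply: cvgV; first exact: oner_neq0.
  rewrite [X in _ --> X](_ : _ = (1 * 1) ^+ d); last by rewrite mulr1 expr1n.
  by apply: cvg_exp; apply: cvgM => //; exact: cvg_ln_ratioS.
have H := cvgM (cvgM Ncvg H1) H2.
rewrite !invr1 !mulr1 in H; have {}H := H eventually_filter eventually_filter.
apply: (cvg_trans _ H); apply: near_eq_cvg; near=> r => /=.
have r1 : (1 < r)%N by near: r; exact: nbhs_infty_gt.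
have L0 : 0 < L r by rewrite ln_gt0// ltr1n.
have LS0 : 0 < L r.+1 by rewrite ln_gt0// ltr1n (ltn_trans r1).
have LN0 : 0 < L (N r.+1) by rewrite ln_gt0// ltr1n (leq_trans r1)// ltnW.
have r0 : (0 : R) < r%:R by rewrite ltr0n ltnW.
rewrite exprMn !expr_div_n; field.
by rewrite !expf_neq0 ?gt_eqF// nat1r.
Unshelve. all: end_near. Qed.

(** The least index at which N reaches [n] is a successor once n > N(0), and its predecessor solves
    the inequalities. Any solution tends to infinity: when n exceeds the maximum of N over [0, A],
    the index rho(n) + 1 lies beyond A. *)
Lemma count_inverse : exists rho : nat -> nat, rho n @[n --> \oo] --> \oo /\
  \forall n \near \oo, (N (rho n) < n <= N (rho n).+1)%N.
Proof.
pose P n r := (N r < n <= N r.+1)%N.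
have ex n : (N 0 < n)%N -> exists r, P n r.
  move=> n0; have exn : exists r, (n <= N r)%N by exists n.
  case: (ex_minnP exn) => [[|r] nr rmin]; first by rewrite leqNgt n0 in nr.
  exists r; rewrite /P nr andbT ltnNge; apply/negP => /rmin; lia.
pose rho n := xget 0%N [set r | P n r].
have rhoP n : (N 0 < n)%N -> P n (rho n).
  by move=> /ex[r Pr]; rewrite /rho; case: xgetP => [x _ //|/(_ r)].
exists rho; split; last first.
  near=> n; apply: rhoP; near: n; exact: nbhs_infty_gt.
apply/cvgnyPge => A; near=> n.
have n0 : (\max_(r < A.+1) N r < n)%N by near: n; exact: nbhs_infty_gt.
have /rhoP/andP[_ nr] : (N 0 < n)%N.
  by rewrite (leq_ltn_trans _ n0)// (@leq_bigmax _ (fun r : 'I_A.+1 => N r) ord0).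
rewrite leqNgt; apply/negP => rA.
have := leq_trans n0 nr; rewrite ltnNge => /negP; apply.
have rA1 : ((rho n).+1 < A.+1)%N by rewrite ltnS.
exact: (@leq_bigmax _ (fun r : 'I_A.+1 => N r) (Ordinal rA1)).
Unshelve. all: end_near. Qed.

Lemma cvg_inverse_count (a : nat -> \bar R) :
  (forall n r, (0 < r)%N -> (N r < n)%N -> (a n <= (r%:R ^- m)%:E)%E) ->
  (forall n r, (0 < n)%N -> (0 < r)%N -> (n <= N r)%N -> ((r%:R ^- m)%:E <= a n)%E) ->
  ((n%:R ^+ m / L n ^+ (d * m))%:E * a n)%E @[n --> \oo] --> (C ^+ m)%:E.
Proof.
move=> a_le a_ge; have [rho [rhoy rhoP]] := count_inverse.
pose U r : R := ((N r.+1)%:R / (r%:R * L r ^+ d)) ^+ m.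
pose V r : R := ((N r)%:R / (r.+1%:R * L (N r.+1) ^+ d)) ^+ m.
(* For large [n] the two hypotheses make [a n] finite, so that the squeeze can take place in the
   reals. *)
have bounds : \forall n \near \oo, exists b : R, a n = b%:E /\
    V (rho n) <= n%:R ^+ m / L n ^+ (d * m) * b <= U (rho n).
  near=> n.
  have r1 : (1 < rho n)%N.
    by near: n; move/cvgnyPgt : rhoy; apply.
  have r0 := ltnW r1.
  have /andP[Nn nN] : (N (rho n) < n <= N (rho n).+1)%N by near: n.
  set r := rho n in r1 r0 Nn nN *.
  have n1 : (1 < n)%N by rewrite (leq_trans r1)// (leq_trans (Nge _))// ltnW.
  have n0 := ltnW n1.
  have an1 := a_le n r r0 Nn.
  have an2 := a_ge n r.+1 n0 isT nN.
  have afin : a n \is a fin_num.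
    by rewrite fin_numE gt_eqF ?(lt_le_trans _ an2) ?ltNyr//= lt_eqF// (le_lt_trans an1)// ltry.
  exists (fine (a n)); rewrite fineK//; split=> //.
  move: an1 an2; rewrite -(fineK afin) !lee_fin => an1 an2.
  have Ln : 0 < L n by rewrite ln_gt0// ltr1n.
  have Lr : 0 < L r by rewrite ln_gt0// ltr1n.
  have rR : (0 : R) < r%:R by rewrite ltr0n.
  have rSR : (0 : R) < r.+1%:R by rewrite ltr0n.
  have nR : (0 : R) < n%:R by rewrite ltr0n.
  have NR : (0 : R) < (N r.+1)%:R by rewrite ltr0n (leq_trans n0).
  have LrLn : L r <= L n by rewrite ler_ln ?posrE// ler_nat (leq_trans (Nge r))// ltnW.
  have LnLN : L n <= L (N r.+1) by rewrite ler_ln ?posrE// ler_nat.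
  have LN : 0 < L (N r.+1) by rewrite (lt_le_trans Ln).
  have K0 : 0 <= n%:R ^+ m / L n ^+ (d * m) by rewrite divr_ge0// exprn_ge0// ltW.
  apply/andP; split.
    apply: le_trans (ler_wpM2l K0 an2).
    rewrite exprM -exprVn -expr_div_n -exprMn.
    rewrite /V lerXn2r ?nnegrE ?divr_ge0 ?mulr_ge0 ?exprn_ge0 ?invr_ge0 ?(ltW Ln) ?(ltW LN)//.
    rewrite -mulrA -invfM [_ * r.+1%:R]mulrC.
    apply: ler_pM; rewrite ?invr_ge0 ?mulr_ge0 ?exprn_ge0 ?(ltW LN)// ?ler_nat ?(ltnW Nn)//.
    rewrite lef_pV2 ?posrE ?mulr_gt0 ?exprn_gt0// ler_pM2l// lerXn2r ?nnegrE ?(ltW Ln) ?(ltW LN)//.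
  apply: le_trans (ler_wpM2l K0 an1) _.
  rewrite exprM -exprVn -expr_div_n -exprMn.
  rewrite /U lerXn2r ?nnegrE ?divr_ge0 ?mulr_ge0 ?exprn_ge0 ?invr_ge0 ?(ltW Ln) ?(ltW Lr)//.
  rewrite -mulrA -invfM [_ * r%:R]mulrC.
  apply: ler_pM; rewrite ?invr_ge0 ?mulr_ge0 ?exprn_ge0 ?(ltW Ln)// ?ler_nat//.
  rewrite lef_pV2 ?posrE ?mulr_gt0 ?exprn_gt0// ler_pM2l// lerXn2r ?nnegrE ?(ltW Ln) ?(ltW Lr)//.
apply: cvg_EFin.
  near=> n; have [b [-> _]] : exists b : R, a n = b%:E /\
    V (rho n) <= n%:R ^+ m / L n ^+ (d * m) * b <= U (rho n) by near: n.
  by [].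
apply: (@squeeze_cvgr _ _ _ _ (V \o rho) (U \o rho)).
- near=> n; have [b [/= -> ]] : exists b : R, a n = b%:E /\
    V (rho n) <= n%:R ^+ m / L n ^+ (d * m) * b <= U (rho n) by near: n.
  by [].
- by apply: cvg_comp rhoy _; apply: cvg_exp; exact: cvg_count_lower.
- by apply: cvg_comp rhoy _; apply: cvg_exp; exact: cvg_count_upper.
Unshelve. all: end_near. Qed.

End inversion.

(** * Integration of continuous functions on the torus *)

Section continuous_rows.
Variables (R : realType) (d : nat).
Local Notation T := (d.-tuple (measurableTypeR R)).
Implicit Types (f : 'rV[R]_d -> R) (t : T).

Lemma measurable_tuple_box (A : 'I_d -> set (measurableTypeR R)) :
  (forall j, measurable (A j)) -> measurable [set t : T | forall j, A j (tnth t j)].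
Proof.
move=> mA.
have -> : [set t : T | forall j, A j (tnth t j)] =
    \bigcap_(j in [set: 'I_d]) ((fun t : T => tnth t j) @^-1` A j).
  by apply/seteqP; split => [t At j _|t At j]; [exact: At|exact: (At j)].
apply: fin_bigcap_measurable => // j _.
by rewrite -[X in measurable X]setTI; exact: measurable_tnth.
Qed.

(* A function that factors through countably many grid points is measurable, and
   a continuous function is the limit of such functions. *)
Lemma measurable_continuous_row f : continuous f -> measurable_fun setT (f \o @row_of R d).
Proof.
move=> cf.
pose grid (n : nat) (t : T) : 'rV[R]_d :=
  \row_j ((Num.floor (n.+1%:R * tnth t j : R))%:~R / n.+1%:R).
apply: (@measurable_fun_cvg _ _ _ _ (fun n => f \o grid n)) => [n|t _]; last first.
  apply: (cvg_comp _ f); last exact: cf.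
  apply/cvg_ballP => e e0; near=> n; split=> // i j; rewrite ord1 !mxE /=.
  have n0 : (0 : R) < n.+1%:R by rewrite ltr0n.
  rewrite /ball /= -[X in X - _](mulfK (lt0r_neq0 n0)) -mulrBl normrM normfV.
  rewrite (gtr0_norm n0) ltr_pdivrMr// [_ * n.+1%:R]mulrC.
  rewrite ger0_norm; last by rewrite subr_ge0 floor_le.
  apply: (@lt_trans _ _ 1).
    by rewrite ltrBlDl; have := floorD1_gt (n.+1%:R * tnth t j : R); rewrite intrD.
  rewrite -ltr_pdivrMr// div1r; near: n.
  have : (e^-1 : R) < (Num.trunc e^-1).+1%:R by rewrite truncnS_gt.
  move=> /ltW H; exists (Num.trunc e^-1).+1 => // n /= Hn.
  by rewrite invf_plt ?posrE//; apply: (le_lt_trans H); rewrite ltr_nat.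
move=> _ B mB; rewrite setTI.
pose side (z : d.-tuple int) (j : 'I_d) : set (measurableTypeR R) :=
  [set x | Num.floor (n.+1%:R * x : R) = tnth z j].
pose cell z : set T := [set t | forall j, side z j (tnth t j)].
pose pt (z : d.-tuple int) : 'rV[R]_d := \row_j ((tnth z j)%:~R / n.+1%:R).
have mcell z : measurable (cell z).
  apply: (@measurable_tuple_box (side z)) => j.
  rewrite (_ : side z j = `[(tnth z j)%:~R / n.+1%:R, (tnth z j + 1)%:~R / n.+1%:R[%classic).
    exact: measurable_itv.
  have n0 : (0 : R) < n.+1%:R by rewrite ltr0n.
  apply/seteqP; split => x /=; rewrite in_itv/=.
    by move=> <-; rewrite ler_pdivrMr// ltr_pdivlMr// mulrC floor_le floorD1_gt.
  by rewrite ler_pdivrMr// ltr_pdivlMr// mulrC /side /= => /floor_def.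
(* [f \o grid n] is constant on each cell, so the preimage is the union of the cells whose grid
   point is sent into [B]; [pickle] makes this union countable. *)
have -> : (f \o grid n) @^-1` B =
    \bigcup_k (if unpickle k is Some z then
      (if `[< B (f (pt z)) >] then cell z else set0) else set0).
  apply/seteqP; split => [t /= Bt|t [k _]].
    exists (pickle [tuple Num.floor (n.+1%:R * tnth t j : R) | j < d]) => //.
    rewrite pickleK.
    rewrite (_ : pt _ = grid n t); last by apply/rowP => j; rewrite !mxE tnth_mktuple.
    by rewrite asboolT// => j /=; rewrite /side /= tnth_mktuple.
  case: unpickle => // z; case: asboolP => //= Bz ct.
  rewrite (_ : grid n t = pt z)//; apply/rowP => j; rewrite !mxE; congr (_%:~R / _).
  exact: ct.
apply: bigcupT_measurable => k; case: unpickle => // z; case: ifP => // _.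
Unshelve. all: end_near. Qed.

Local Notation mu := (torus_measure R d).

Lemma torus_measure_coord_null (A : set (measurableTypeR R)) (j : 'I_d) :
  measurable A -> lebesgue_measure (A `&` circle_set R) = 0%E ->
  mu [set t | A (tnth t j)] = 0%E.
Proof.
move=> mA A0; pose B i : set (measurableTypeR R) := if i == j then A else setT.
have -> : [set t : T | A (tnth t j)] = [set t | forall i, B i (tnth t i)].
  apply/seteqP; split => [t At i|t /(_ j)]; rewrite /B ?eqxx//=.
  by case: eqP => [->|].
rewrite torus_measure_box; last by move=> i; rewrite /B; case: ifP.
by rewrite (bigD1 j)//= /B eqxx A0 mul0e.
Qed.

Lemma circle_length_gt0 : 0 < 2 * pi :> R.
Proof. by rewrite mulr_gt0// pi_gt0. Qed.

(* torus_measure does not see the points off the cube, so composition with the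
   projection onto the cube makes a continuous function bounded without changing
   its integral. *)
Definition clamp_circle (x : R) : R := Num.min (Num.max 0 x) (2 * pi).

Definition clamp_tuple (t : T) : T := [tuple clamp_circle (tnth t j) | j < d].

Lemma clamp_circle_in x : clamp_circle x \in `[0, 2 * pi].
Proof.
have pi0 := ltW circle_length_gt0.
by rewrite in_itv/= /clamp_circle le_min le_max lexx pi0 /= ge_min lexx orbT.
Qed.

Lemma clamp_circle_id x : circle_set R x -> clamp_circle x = x.
Proof.
rewrite /circle_set /= in_itv/= => /andP[x0 x1].
by rewrite /clamp_circle max_r// min_l.
Qed.

Lemma measurable_clamp_tuple : measurable_fun setT clamp_tuple.
Proof.
apply/measurable_fun_tnthP => j.
rewrite (_ : _ \o _ = clamp_circle \o (fun t : T => tnth t j)); last first.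
  by apply/funext => t /=; rewrite tnth_mktuple.
apply: measurableT_comp; last exact: measurable_tnth.
apply: measurable_minr; last exact: measurable_cst.
by apply: measurable_maxr; [exact: measurable_cst|exact: measurable_id].
Qed.

Definition off_cube : set T := \bigcup_(j in [set: 'I_d]) [set t | (~` circle_set R) (tnth t j)].

Lemma measurable_off_cube : measurable off_cube.
Proof.
apply: fin_bigcup_measurable => // j _.
rewrite -[X in measurable X]setTI; apply: measurable_tnth => //.
by apply: measurableC; exact: measurable_itv.
Qed.

Lemma off_cube_null : mu off_cube = 0%E.
Proof.
have nj (j : 'I_d) : mu.-negligible [set t : T | (~` circle_set R) (tnth t j)].
  exists [set t : T | (~` circle_set R) (tnth t j)]; split => //.
    rewrite -[X in measurable X]setTI; apply: measurable_tnth => //.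
    by apply: measurableC; exact: measurable_itv.
  apply: torus_measure_coord_null; first by apply: measurableC; exact: measurable_itv.
  by rewrite setICl measure0.
apply: measure_negligible; first exact: measurable_off_cube.
apply: (@negligibleS _ _ _ _ (\big[setU/set0]_(j : 'I_d)
    [set t : T | (~` circle_set R) (tnth t j)])).
  by move=> t [j _ Cj]; rewrite (bigD1 j)//=; left.
by elim/big_ind : _ => //; [exact: negligible_set0|exact: negligibleU].
Qed.

Lemma on_cube t : ~ off_cube t -> forall j, circle_set R (tnth t j).
Proof. by move=> Nt j; apply: contrapT => Cj; apply: Nt; exists j. Qed.

Lemma clamp_tuple_id t : ~ off_cube t -> clamp_tuple t = t.
Proof.
by move=> /on_cube Nt; apply: eq_from_tnth => j; rewrite tnth_mktuple clamp_circle_id.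
Qed.

Lemma bounded_clamp f : continuous f -> exists M, forall t, `|f (row_of (clamp_tuple t))| <= M.
Proof.
move=> cf.
have cK : compact [set v : 'rV[R]_d | forall j, `[0, 2 * pi]%classic (v ord0 j)].
  by apply: (@rV_compact _ _ (fun=> `[0, 2 * pi]%classic)) => j; exact: segment_compact.
have := compact_bounded (continuous_compact (continuous_subspaceT cf) cK).
move=> [M [_ MP]]; exists (M + 1) => t.
apply: (MP (M + 1)); first by rewrite ltrDl.
by exists (row_of (clamp_tuple t)) => // j; rewrite mxE tnth_mktuple; exact: clamp_circle_in.
Qed.

Lemma integrable_bounded (g : T -> R) M : measurable_fun setT g ->
  (forall t, `|g t| <= M) -> mu.-integrable setT (EFin \o g).
Proof.
move=> mg gM; apply: measurable_bounded_integrable => //.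
  by rewrite ltey_eq fin_num_measure.
exists M; split; first exact: num_real.
by move=> x Mx t _; apply: (le_trans (gM t)); exact: ltW.
Qed.

Lemma integrable_clamp f : continuous f ->
  mu.-integrable setT (EFin \o (fun t => f (row_of (clamp_tuple t)))).
Proof.
move=> cf; have [M fM] := bounded_clamp cf.
apply: integrable_bounded fM.
exact: (measurableT_comp (measurable_continuous_row cf) measurable_clamp_tuple).
Qed.

Lemma integrable_continuous_row f : continuous f ->
  mu.-integrable setT (EFin \o (f \o @row_of R d)).
Proof.
move=> cf; have mf := measurable_continuous_row cf.
apply/(@negligible_integrable _ _ _ _ setT off_cube) => //.
- exact: measurable_off_cube.
- exact/measurable_EFinP.
- exact: off_cube_null.
apply: (@eq_integrable _ _ _ _ _ _ (EFin \o (fun t => f (row_of (clamp_tuple t))))).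
- by apply: measurableD => //; exact: measurable_off_cube.
- by move=> t; rewrite inE => -[_ Nt] /=; rewrite clamp_tuple_id.
apply: integrableS (integrable_clamp cf) => //.
by apply: measurableD => //; exact: measurable_off_cube.
Qed.

Lemma integral_clamp f : continuous f ->
  (\int[mu]_t (f (row_of t))%:E = \int[mu]_t (f (row_of (clamp_tuple t)))%:E)%E.
Proof.
move=> cf.
rewrite (@negligible_integral _ _ _ _ setT off_cube)//=; last 3 first.
- exact: measurable_off_cube.
- exact: integrable_continuous_row.
- exact: off_cube_null.
rewrite [RHS](@negligible_integral _ _ _ _ setT off_cube)//=; last 3 first.
- exact: measurable_off_cube.
- exact: integrable_clamp.
- exact: off_cube_null.
by apply: eq_integral => t; rewrite inE => -[_ Nt]; rewrite clamp_tuple_id.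
Qed.

End continuous_rows.

(** * Integration along one coordinate *)

Section slices.
Variable R : realType.
Local Notation T d := (d.-tuple (measurableTypeR R)).

Definition set_coord d (t : T d) (j : 'I_d) (x : R) : T d :=
  [tuple if i == j then x else tnth t i | i < d].

Lemma integral_circle_measure (g : R -> R) M :
  measurable_fun setT g -> (forall x, `|g x| <= M) ->
  (\int[circle_measure R]_x (g x)%:E = \int[lebesgue_measure]_(x in `[0%R, (2 * pi)%R]) (g x)%:E)%E.
Proof.
move=> mg gM.
have mC : measurable (circle_set R) by exact: measurable_itv.
rewrite (@negligible_integral _ _ _ _ setT (~` circle_set R))//.
- rewrite setTD setCK; apply: (@eq_measure_integral _ _ _ _ lebesgue_measure) => A mA AC.
  by rewrite /circle_measure /= /mfrestr /= /mrestr setIidl.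
- exact: measurableC.
- apply: measurable_bounded_integrable => //.
    by rewrite ltey_eq fin_num_measure.
  exists M; split; first exact: num_real.
  by move=> x Mx t _; apply: (le_trans (gM t)); exact: ltW.
- rewrite /circle_measure /= /mfrestr /= /mrestr setICl; exact: measure0.
Qed.

(** Fubini's theorem along the recursive construction of the torus measure. If [j] is the head
    coordinate, it is integrated first; otherwise the head is frozen and the induction hypothesis
    applies to the tail. The bound [M] gives integrability and is inherited by slices. *)
Lemma integral_torus_slice0 d (F : T d -> R) (j : 'I_d) M :
  measurable_fun setT F -> (forall t, `|F t| <= M) ->
  (forall t, \int[circle_measure R]_x (F (set_coord t j x))%:E = 0)%E ->
  (\int[torus_measure R d]_t (F t)%:E = 0)%E.
Proof.
elim: d F j => [F []//|d IH] F j mF FM F0.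
have mcons := @measurable_tuple_cons _ (measurableTypeR R) d.
have mFc : measurable_fun setT (F \o @tuple_cons _ (measurableTypeR R) d).
  exact: measurableT_comp.
have iF : ((circle_measure R) \x (torus_measure R d))%E.-integrable setT
    (EFin \o (F \o @tuple_cons _ (measurableTypeR R) d)).
  apply: measurable_bounded_integrable => //.
    have P := @product_measure1E _ _ _ _ R (circle_measure R) (torus_measure R d)
      setT setT measurableT measurableT.
    have : (circle_measure R setT * torus_measure R d setT < +oo)%E.
      by rewrite lte_mul_pinfty// ?fin_num_measure// -ge0_fin_numE// fin_num_measure.
    by rewrite -P setXTT.
  exists M; split; first exact: num_real.
  by move=> x Mx t _; apply: (le_trans (FM _)); exact: ltW.
transitivity (\int[((circle_measure R) \x (torus_measure R d))%E]_z
    (EFin \o (F \o @tuple_cons _ (measurableTypeR R) d)) z)%E.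
  rewrite -[LHS]/(\int[pushforward ((circle_measure R) \x (torus_measure R d))%E
    (@tuple_cons _ (measurableTypeR R) d)]_t (F t)%:E)%E.
  by rewrite integral_pushforward//; exact/measurable_EFinP.
case: (unliftP ord0 j) => [i ji|j0].
  rewrite -integral12_prod_meas1//.
  rewrite (eq_integral (fun=> 0%E)) ?integral0// => x _.
  rewrite /fubini_F /=; apply: (IH (fun t => F (tuple_cons (x, t))) i) => //.
    by apply: measurableT_comp mFc _; exact: pair1_measurable.
  move=> t; rewrite -(F0 (tuple_cons (x, t))); apply: eq_integral => y _.
  congr (F _)%:E; apply: eq_from_tnth => l; rewrite ji tnth_mktuple.
  case: (unliftP ord0 l) => [l'|] ->.
    by rewrite !tnthS (inj_eq lift_inj) tnth_mktuple.
  by rewrite /= !tnth0.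
rewrite -integral21_prod_meas1//.
rewrite (eq_integral (fun=> 0%E)) ?integral0// => t _.
rewrite /fubini_G /= -(F0 (@tuple_cons _ (measurableTypeR R) d (0%R, t))).
apply: eq_integral => y _.
congr (F _)%:E; apply: eq_from_tnth => l; rewrite j0 tnth_mktuple.
case: (unliftP ord0 l) => [k|] ->; last by rewrite /= !tnth0.
by rewrite /= !tnthS.
Qed.

End slices.

(** * Derivatives along lines and their integrals over a period *)

Section line_derivatives.
Variables (R : realType) (d : nat).
Implicit Types (u : 'rV[R]_d -> R) (x v : 'rV[R]_d).

(** The difference quotients coincide. This reduces directional derivatives to the one-variable
    fundamental theorem of calculus. *)
Lemma is_derive_line u x v (a l : R) :
  is_derive a 1 (fun h : R => u (x + h *: v)) l <-> is_derive (x + a *: v) v u l.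
Proof.
have E : (fun h : R => h^-1 *:
      (((fun h : R => u (x + h *: v)) \o shift a) (h *: (1 : R)) - u (x + a *: v))) =
    (fun h : R => h^-1 *: ((u \o shift (x + a *: v)) (h *: v) - u (x + a *: v))).
  apply/funext => h /=; congr (_ *: (u _ - _)).
  by rewrite scaler1 scalerDl [in RHS]addrCA.
by split => -[d1 d2]; split; rewrite /derivable /derive ?E// in d1 d2 *; rewrite -?E.
Qed.

(** On each line parallel to the j-th axis the integral is the increment of [u] over a period, which
    is 0. *)
Lemma integral_partial_eq0 u (j : 'I_d) (v := delta_mx ord0 j : 'rV[R]_d) :
  (forall x, derivable u x v) -> continuous (fun x => 'D_v u x) ->
  (forall x, u (x + (2 * pi) *: v) = u x) ->
  (\int[torus_measure R d]_t ('D_v u (row_of t))%:E = 0)%E.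
Proof.
move=> du cdu pu; rewrite (integral_clamp cdu).
have [M FM] := bounded_clamp cdu.
have mF : measurable_fun setT (fun t => 'D_v u (row_of (clamp_tuple (d := d) t))).
  exact: (measurableT_comp (measurable_continuous_row cdu) (@measurable_clamp_tuple R d)).
apply: (integral_torus_slice0 (j := j) mF FM) => t.
have mc : measurable_fun setT (fun x : measurableTypeR R => set_coord t j x).
  apply/measurable_fun_tnthP => l.
  rewrite (_ : _ \o _ = (fun a : measurableTypeR R => if l == j then a else tnth t l)).
    by case: (l == j); [exact: measurable_id|exact: measurable_cst].
  by apply/funext => x /=; rewrite tnth_mktuple.
rewrite (@integral_circle_measure _
  (fun a : R => 'D_v u (row_of (clamp_tuple (set_coord t j a)))) M).
(* Clamping fixes the varying coordinate on [0, 2 pi], so the slice is the segment that starts at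
   [x0], whose j-th coordinate is 0. *)
- pose x0 := row_of (clamp_tuple (set_coord t j 0)).
  transitivity (\int[lebesgue_measure]_(x in `[0%R, (2 * pi)%R]) ('D_v u (x0 + x *: v))%:E)%E.
    apply: eq_integral => x; rewrite inE => x02.
    congr ('D_v u _)%:E; apply/rowP => l; rewrite !mxE !tnth_mktuple eqxx /=.
    have c0 : clamp_circle (0 : R) = 0.
      by apply: clamp_circle_id; rewrite /circle_set /= in_itv/= lexx ltW ?circle_length_gt0.
    case: (l == j); last by rewrite mulr0 addr0.
    by rewrite c0 add0r mulr1 clamp_circle_id.
  have cline : continuous (fun x : R => x0 + x *: v).
    by move=> x; apply: cvgD; [exact: cvg_cst|apply: cvgZr_tmp; exact: cvg_id].
  pose U (x : R) := u (x0 + x *: v).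
  have dU (x : R) : is_derive x 1 U ('D_v u (x0 + x *: v)).
    by apply/is_derive_line; apply/derivableP.
  have cU : continuous U.
    by move=> x; apply: differentiable_continuous; apply/derivable1_diffP; exact: ex_derive.
  rewrite (@continuous_FTC2 _ _ U).
  + rewrite /U scale0r addr0 pu subee//.
  + exact: circle_length_gt0.
  + apply: continuous_subspaceT => x.
    by apply: (@continuous_comp _ _ _ (fun a : R => x0 + a *: v) (fun y => 'D_v u y));
      [exact: cline|exact: cdu].
  + split; first by move=> x _; exact: ex_derive.
      by apply: cvg_at_right_filter; exact: cU.
    by apply: cvg_at_left_filter; exact: cU.
  + by move=> x _; rewrite derive1E derive_val.
- exact: measurableT_comp mF mc.
- by move=> x; exact: FM.
Qed.

End line_derivatives.

(** * Exponentials and integration by parts *)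

Section complex_rows.
Variables (R : realType) (d : nat).
Local Notation Re := (@complex.Re R).
Local Notation Im := (@complex.Im R).
Implicit Types (phi psi : 'rV[R]_d -> R[i]) (k l : {ffun 'I_d -> int}) (x : 'rV[R]_d).
Local Notation delta j := (delta_mx ord0 j : 'rV[R]_d).

Lemma complexReM (a b : R[i]) : Re (a * b) = Re a * Re b - Im a * Im b.
Proof. by case: a b => [a1 a2] [b1 b2]. Qed.

Lemma complexImM (a b : R[i]) : Im (a * b) = Re a * Im b + Im a * Re b.
Proof. by case: a b => [a1 a2] [b1 b2]. Qed.

Lemma complexReD (a b : R[i]) : Re (a + b) = Re a + Re b.
Proof. by case: a b => [a1 a2] [b1 b2]. Qed.

Lemma complexImD (a b : R[i]) : Im (a + b) = Im a + Im b.
Proof. by case: a b => [a1 a2] [b1 b2]. Qed.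

Lemma complexReN (a : R[i]) : Re (- a) = - Re a.
Proof. by case: a. Qed.

Lemma complexImN (a : R[i]) : Im (- a) = - Im a.
Proof. by case: a. Qed.

Lemma complexP (a b : R[i]) : Re a = Re b -> Im a = Im b -> a = b.
Proof. by case: a b => [a1 a2] [b1 b2] /= -> ->. Qed.

Definition ccontinuous phi := continuous (fun x => Re (phi x)) /\ continuous (fun x => Im (phi x)).

Definition cderivable j phi := forall x,
  derivable (fun y => Re (phi y)) x (delta j) /\ derivable (fun y => Im (phi y)) x (delta j).

Lemma continuous_rowM (f g : 'rV[R]_d -> R) : continuous f -> continuous g ->
  continuous (fun x => f x * g x).
Proof. by move=> cf cg x; exact: (continuousM (cf x) (cg x)). Qed.

Lemma continuous_rowD (f g : 'rV[R]_d -> R) : continuous f -> continuous g ->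
  continuous (fun x => f x + g x).
Proof. by move=> cf cg x; exact: (continuousD (cf x) (cg x)). Qed.

Lemma continuous_rowB (f g : 'rV[R]_d -> R) : continuous f -> continuous g ->
  continuous (fun x => f x - g x).
Proof. by move=> cf cg x; exact: (continuousB (cf x) (cg x)). Qed.

Lemma ccontinuousM phi psi : ccontinuous phi -> ccontinuous psi ->
  ccontinuous (fun x => phi x * psi x).
Proof.
move=> [rp ip] [rs ij]; split.
  under eq_fun do rewrite complexReM.
  by apply: continuous_rowB; exact: continuous_rowM.
under eq_fun do rewrite complexImM.
by apply: continuous_rowD; exact: continuous_rowM.
Qed.

Lemma ccontinuousD phi psi : ccontinuous phi -> ccontinuous psi ->
  ccontinuous (fun x => phi x + psi x).
Proof.
move=> [rp ip] [rs ij]; split.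
  by under eq_fun do rewrite complexReD; exact: continuous_rowD.
by under eq_fun do rewrite complexImD; exact: continuous_rowD.
Qed.

Lemma cderivableM j phi psi : cderivable j phi -> cderivable j psi ->
  cderivable j (fun x => phi x * psi x) /\
  partial j (fun x => phi x * psi x) = fun x => partial j phi x * psi x + phi x * partial j psi x.
Proof.
move=> dp ds.
have DR x : is_derive x (delta j) (fun y => Re (phi y * psi y))
    (Re (partial j phi x * psi x + phi x * partial j psi x)).
  have [/derivableP rp /derivableP ip] := dp x; have [/derivableP rs /derivableP ij] := ds x.
  under eq_fun do rewrite complexReM.
  apply: is_derive_eq; rewrite complexReD !complexReM /partial /= /GRing.scale /=; ring.
have DI x : is_derive x (delta j) (fun y => Im (phi y * psi y))
    (Im (partial j phi x * psi x + phi x * partial j psi x)).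
  have [/derivableP rp /derivableP ip] := dp x; have [/derivableP rs /derivableP ij] := ds x.
  under eq_fun do rewrite complexImM.
  apply: is_derive_eq; rewrite complexImD !complexImM /partial /= /GRing.scale /=; ring.
split.
  by move=> x; split; [have := DR x|have := DI x]; case.
by apply/funext => x; apply: complexP; [have := DR x|have := DI x]; case.
Qed.

Lemma partial_periodic j phi : torus_periodic phi -> torus_periodic (partial j phi).
Proof.
have E (g : 'rV[R]_d -> R) (v p x : 'rV[R]_d) : (forall y, g (y + p) = g y) ->
    'D_v g (x + p) = 'D_v g x.
  move=> gp; rewrite /derive.
  suff -> : (fun h : R => h^-1 *: ((g \o shift (x + p)) (h *: v) - g (x + p))) =
    (fun h : R => h^-1 *: ((g \o shift x) (h *: v) - g x)) by [].
  by apply/funext => h /=; rewrite addrA !gp.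
by move=> pp l x; apply: complexP; apply: E => y; rewrite pp.
Qed.

Definition phase k x : R := \sum_j (k j)%:~R * x ord0 j.

Definition cexp k x : R[i] := Complex (cos (phase k x)) (sin (phase k x)).

Lemma phaseD k l x : phase (k + l) x = phase k x + phase l x.
Proof.
by rewrite /phase -big_split; apply: eq_bigr => j _; rewrite ffunE intrD mulrDl.
Qed.

Lemma phaseN k x : phase (- k) x = - phase k x.
Proof.
by rewrite /phase -sumrN; apply: eq_bigr => j _; rewrite ffunE mulrNz mulNr.
Qed.

Lemma phase0 x : phase 0 x = 0.
Proof. by rewrite /phase big1// => j _; rewrite ffunE mul0r. Qed.

Lemma phase_line k x j (h : R) : phase k (x + h *: delta j) = phase k x + (k j)%:~R * h.
Proof.
rewrite /phase; under eq_bigr do rewrite mxE mulrDr; rewrite big_split /=; congr (_ + _).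
rewrite (bigD1 j)//= big1 ?addr0; last first.
  by move=> l lj; rewrite !mxE eqxx (negbTE lj) mulr0 mulr0.
by rewrite !mxE !eqxx mulr1.
Qed.

Lemma continuous_phase k : continuous (phase k).
Proof.
rewrite /phase; elim: (index_enum _) => [|j s IH].
  by under eq_fun do rewrite big_nil; exact: cst_continuous.
under eq_fun do rewrite big_cons.
apply: continuous_rowD => //; apply: continuous_rowM; first by exact: cst_continuous.
exact: coord_continuous.
Qed.

Lemma cexpD k l x : cexp (k + l) x = cexp k x * cexp l x.
Proof.
apply: complexP; rewrite ?complexReM ?complexImM /= phaseD; first exact: cosD.
by rewrite sinD addrC.
Qed.

Lemma cexp0 x : cexp 0 x = 1.
Proof. by apply: complexP; rewrite /= phase0 ?cos0 ?sin0. Qed.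

Lemma cexpN k x : cexp (- k) x = Complex (cos (phase k x)) (- sin (phase k x)).
Proof. by rewrite /cexp phaseN cosN sinN. Qed.

Lemma periodic_int (f : R -> R) (p : R) (z : int) a :
  periodic f p -> f (a + z%:~R * p) = f a.
Proof.
move=> fp; case: z => n; first by rewrite -pmulrn mulr_natl periodicn.
rewrite NegzE mulrNz mulNr -[in RHS](subrK (n.+1%:~R * p) a).
by rewrite -pmulrn mulr_natl periodicn.
Qed.

Lemma cexp_periodic k : torus_periodic (cexp k).
Proof.
move=> j x; rewrite /cexp phase_line [2 * pi]mulr_natl.
by rewrite (periodic_int _ _ (@cosD2pi R)) (periodic_int _ _ (@sinD2pi R)).
Qed.

Lemma ccontinuous_cexp k : ccontinuous (cexp k).
Proof.
split=> x /=; apply: continuous_comp; first exact: continuous_phase.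
- exact: continuous_cos.
- exact: continuous_phase.
- exact: continuous_sin.
Qed.

Lemma ccontinuous_cst (c : R[i]) : ccontinuous (fun=> c).
Proof. by split; exact: cst_continuous. Qed.

Lemma cderivable_cexp k j : cderivable j (cexp k) /\
  partial j (cexp k) = fun x => Complex 0 (k j)%:~R * cexp k x.
Proof.
have DL x : is_derive (0 : R) 1 (fun h : R => phase k x + (k j)%:~R * h) (k j)%:~R.
  by apply: is_derive_eq; rewrite /GRing.scale /=; ring.
have DR x : is_derive x (delta j) (fun y => Re (cexp k y)) (- sin (phase k x) * (k j)%:~R).
  rewrite -[in is_derive x](addr0 x) -[in X in is_derive X](scale0r (delta j)).
  apply/is_derive_line => /=; under eq_fun do rewrite phase_line.
  have := DL x => Dx; apply: is_derive_eq.
  rewrite /GRing.scale /= mulr0 addr0; ring.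
have DI x : is_derive x (delta j) (fun y => Im (cexp k y)) (cos (phase k x) * (k j)%:~R).
  rewrite -[in is_derive x](addr0 x) -[in X in is_derive X](scale0r (delta j)).
  apply/is_derive_line => /=; under eq_fun do rewrite phase_line.
  have := DL x => Dx; apply: is_derive_eq.
  rewrite /GRing.scale /= mulr0 addr0; ring.
split.
  by move=> x; split; [have := DR x|have := DI x]; case.
apply/funext => x; apply: complexP; rewrite ?complexReM ?complexImM /=.
  by have := DR x; case => _ ->; ring.
by have := DI x; case => _ ->; ring.
Qed.

Local Notation mu := (torus_measure R d).
Implicit Types f g : torus_fun R d.

Definition cintegrable f := mu.-integrable setT (EFin \o (fun t => Re (f t))) /\
  mu.-integrable setT (EFin \o (fun t => Im (f t))).

Lemma cintegrable_row phi : ccontinuous phi -> cintegrable (phi \o @row_of R d).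
Proof.
by move=> [rp ip]; split; [exact: (integrable_continuous_row rp)|
                           exact: (integrable_continuous_row ip)].
Qed.

Lemma torus_integralD f g : cintegrable f -> cintegrable g ->
  torus_integral (fun t => f t + g t) = torus_integral f + torus_integral g.
Proof.
move=> [rf i_f] [rg ig]; rewrite /torus_integral.
under [X in Complex X _]eq_Rintegral do rewrite complexReD.
under [X in Complex _ X]eq_Rintegral do rewrite complexImD.
by rewrite !RintegralD.
Qed.

Lemma cintegrableD f g : cintegrable f -> cintegrable g -> cintegrable (fun t => f t + g t).
Proof.
move=> [rf i_f] [rg ig]; split.
  rewrite (_ : _ \o _ = (EFin \o (fun t => Re (f t))) \+ (EFin \o (fun t => Re (g t))))%E.
    exact: integrableD.
  by apply/funext => t /=; rewrite complexReD EFinD.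
rewrite (_ : _ \o _ = (EFin \o (fun t => Im (f t))) \+ (EFin \o (fun t => Im (g t))))%E.
  exact: integrableD.
by apply/funext => t /=; rewrite complexImD EFinD.
Qed.

Lemma integrable_lin (a b : R) (u v : d.-tuple (measurableTypeR R) -> R) :
  mu.-integrable setT (EFin \o u) -> mu.-integrable setT (EFin \o v) ->
  mu.-integrable setT (EFin \o (fun t => a * u t + b * v t)) /\
  \int[mu]_t (a * u t + b * v t) = a * \int[mu]_t u t + b * \int[mu]_t v t.
Proof.
move=> iu iv.
have iau : mu.-integrable setT (EFin \o (fun t => a * u t)).
  rewrite (_ : _ \o _ = fun t => a%:E * (EFin \o u) t)%E; first exact: integrableZl.
  by apply/funext => t /=; rewrite EFinM.
have ibv : mu.-integrable setT (EFin \o (fun t => b * v t)).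
  rewrite (_ : _ \o _ = fun t => b%:E * (EFin \o v) t)%E; first exact: integrableZl.
  by apply/funext => t /=; rewrite EFinM.
split; last by rewrite RintegralD// !RintegralZl.
rewrite (_ : _ \o _ = (EFin \o (fun t => (a * u t)%R)) \+ (EFin \o (fun t => (b * v t)%R)))%E.
  exact: integrableD.
by apply/funext => t /=; rewrite EFinD.
Qed.

Lemma cintegrableZ (c : R[i]) f : cintegrable f ->
  cintegrable (fun t => c * f t) /\ torus_integral (fun t => c * f t) = c * torus_integral f.
Proof.
move=> [rf i_f].
have [I1 E1] := integrable_lin (Re c) (- Im c) rf i_f.
have [I2 E2] := integrable_lin (Im c) (Re c) rf i_f.
have ER : (fun t => Re (c * f t)) = (fun t => Re c * Re (f t) + - Im c * Im (f t)).
  by apply/funext => t; rewrite complexReM mulNr.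
have EI : (fun t => Im (c * f t)) = (fun t => Im c * Re (f t) + Re c * Im (f t)).
  by apply/funext => t; rewrite complexImM addrC.
split; first by rewrite /cintegrable ER EI.
apply: complexP; rewrite ?complexReM ?complexImM /= ?ER ?EI ?E1 ?E2; first by rewrite mulNr.
by rewrite addrC.
Qed.

Lemma torus_integral_partial0 j phi : cderivable j phi -> ccontinuous (partial j phi) ->
  torus_periodic phi -> torus_integral (fun t => partial j phi (row_of t)) = 0.
Proof.
move=> dp [cr ci] pp; apply: complexP => /=; rewrite /Rintegral.
  rewrite integral_partial_eq0//; first by move=> x; have [] := dp x.
  by move=> x; rewrite pp.
rewrite integral_partial_eq0//; first by move=> x; have [] := dp x.
by move=> x; rewrite pp.
Qed.

Lemma smooth_iter s phi : smooth phi -> ccontinuous (iter_partial s phi) /\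
  forall j, cderivable j (iter_partial s phi).
Proof.
move=> sp; have [c1 c2 c3] := sp s; split; first by split.
by move=> j x; exact: c3.
Qed.

Lemma iter_partial_periodic s phi : torus_periodic phi -> torus_periodic (iter_partial s phi).
Proof. by move=> pp; elim: s => //= j s; exact: partial_periodic. Qed.

(* cexp k is an eigenvector of the iterated derivative along s, with this
   eigenvalue. *)
Definition freq_factor k (s : seq 'I_d) : R[i] := \prod_(j <- s) Complex 0 (k j)%:~R.

(** The constant [c] is general because the induction moves the factor i k_j of the first index into
    it. The derivative of [cexp k * psi] along [j] has integral 0, and the product rule splits it
    into the two integrals to be exchanged. *)
Lemma torus_integral_by_parts (c : R[i]) k s phi : smooth phi -> torus_periodic phi ->
  torus_integral (fun t => c * freq_factor k s * cexp k (row_of t) * phi (row_of t)) =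
  (-1) ^+ size s * torus_integral (fun t => c * cexp k (row_of t) * iter_partial s phi (row_of t)).
Proof.
move=> sp pp; elim: s c => [|j s IH] c.
  by rewrite /freq_factor big_nil expr0 mul1r; under eq_fun do rewrite mulr1.
pose psi := iter_partial s phi.
have [cpsi dpsi] := smooth_iter s sp.
have [cpsij _] := smooth_iter (j :: s) sp.
have [de Ee] := cderivable_cexp k j.
have ce := ccontinuous_cexp k.
have [dep Eep] := cderivableM de (dpsi j).
have I1 : ccontinuous (fun x => partial j (cexp k) x * psi x).
  apply: ccontinuousM => //; rewrite Ee; apply: ccontinuousM => //; exact: ccontinuous_cst.
have I2 : ccontinuous (fun x => cexp k x * partial j psi x) by exact: ccontinuousM.
have H0 : torus_integral (fun t => partial j (cexp k) (row_of t) * psi (row_of t)) +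
    torus_integral (fun t => cexp k (row_of t) * partial j psi (row_of t)) = 0.
  have := torus_integral_partial0 dep; rewrite Eep => H.
  rewrite -(torus_integralD (cintegrable_row I1) (cintegrable_row I2)); apply: H.
    exact: ccontinuousD.
  by move=> l x; rewrite cexp_periodic (iter_partial_periodic _ pp).
have -> : (fun t => c * freq_factor k (j :: s) * cexp k (row_of t) * phi (row_of t)) =
    (fun t => (c * Complex 0 (k j)%:~R) * freq_factor k s * cexp k (row_of t) * phi (row_of t)).
  by apply/funext => t; rewrite /freq_factor big_cons !mulrA.
rewrite IH exprS mulN1r mulNr -mulrN; congr (_ * _).
have -> : (fun t => c * Complex 0 (k j)%:~R * cexp k (row_of t) * iter_partial s phi (row_of t)) =
    (fun t => c * (partial j (cexp k) (row_of t) * psi (row_of t))).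
  by apply/funext => t; rewrite Ee !mulrA.
rewrite (cintegrableZ c (cintegrable_row I1)).2.
under [X in - torus_integral X]eq_fun do rewrite -mulrA.
rewrite (cintegrableZ c (cintegrable_row I2)).2 -mulrN; congr (_ * _).
by apply/eqP; rewrite -addr_eq0; apply/eqP; exact: H0.
Qed.

Definition trig_sum (p : seq (R[i] * {ffun 'I_d -> int})) : torus_fun R d :=
  fun t => \sum_(u <- p) u.1 * cexp u.2 (row_of t).

Lemma size_multi_seq (alpha : 'I_d -> nat) : size (multi_seq alpha) = (\sum_j alpha j)%N.
Proof.
rewrite /multi_seq size_flatten /shape -map_comp sumnE big_map big_enum /=.
by apply: eq_bigr => j _; rewrite size_nseq.
Qed.

Lemma trig_sum_distr_deriv (alpha : 'I_d -> nat) p : distr_deriv alpha (trig_sum p)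
  (trig_sum [seq (u.1 * freq_factor u.2 (multi_seq alpha), u.2) | u <- p]).
Proof.
move=> phi sp pp; rewrite -size_multi_seq; set s := multi_seq alpha.
have [cp _] := smooth_iter [::] sp.
have [cps _] := smooth_iter s sp.
have cu (c : R[i]) k psi : ccontinuous psi -> ccontinuous (fun x => c * cexp k x * psi x).
  move=> cpsi; apply: ccontinuousM => //; apply: ccontinuousM.
    exact: ccontinuous_cst.
  exact: ccontinuous_cexp.
have csum (q : seq (R[i] * {ffun 'I_d -> int})) psi : ccontinuous psi ->
    cintegrable (fun t => trig_sum q t * psi (row_of t)).
  move=> cpsi; elim: q => [|u q IH].
    rewrite (_ : (fun _ => _) = (fun=> 0) \o @row_of R d).
      exact/cintegrable_row/ccontinuous_cst.
    by apply/funext => t; rewrite /trig_sum big_nil mul0r.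
  rewrite (_ : (fun _ => _) = (fun t => u.1 * cexp u.2 (row_of t) * psi (row_of t) +
      trig_sum q t * psi (row_of t))).
    apply: cintegrableD => //; exact: (cintegrable_row (cu u.1 u.2 psi cpsi)).
  by apply/funext => t; rewrite /trig_sum big_cons mulrDl.
elim: p => [|u p IH].
  rewrite /=; under eq_fun do rewrite /trig_sum big_nil mul0r.
  under [X in _ = _ * torus_integral X]eq_fun do rewrite /trig_sum big_nil mul0r.
  have -> : @torus_integral R d (fun=> 0) = 0.
    by apply: complexP => /=; rewrite /Rintegral integral0.
  by rewrite mulr0.
rewrite /=.
have -> : (fun t => trig_sum ((u.1 * freq_factor u.2 s, u.2) ::
      [seq (v.1 * freq_factor v.2 s, v.2) | v <- p]) t * phi (row_of t)) =
    (fun t => u.1 * freq_factor u.2 s * cexp u.2 (row_of t) * phi (row_of t) +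
      trig_sum [seq (v.1 * freq_factor v.2 s, v.2) | v <- p] t * phi (row_of t)).
  by apply/funext => t; rewrite /trig_sum big_cons mulrDl.
have -> : (fun t => trig_sum (u :: p) t * iter_partial s phi (row_of t)) =
    (fun t => u.1 * cexp u.2 (row_of t) * iter_partial s phi (row_of t) +
      trig_sum p t * iter_partial s phi (row_of t)).
  by apply/funext => t; rewrite /trig_sum big_cons mulrDl.
rewrite torus_integralD; last 2 first.
- exact: (cintegrable_row (cu _ _ _ cp)).
- exact: csum.
rewrite [in RHS]torus_integralD; last 2 first.
- exact: (cintegrable_row (cu _ _ _ cps)).
- exact: csum.
by rewrite IH mulrDr torus_integral_by_parts.
Qed.

Lemma iter_partial_cexp s k (c : R[i]) :
  iter_partial s (fun x => c * cexp k x) = fun x => c * freq_factor k s * cexp k x.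
Proof.
elim: s => [|j s IH] /=; first by rewrite /freq_factor big_nil; under [RHS]eq_fun do rewrite mulr1.
rewrite IH; have [de Ee] := cderivable_cexp k j.
have dc (a : R[i]) : cderivable j (fun=> a).
  by move=> x; split; exact: derivable_cst.
have [_ ->] := cderivableM (dc (c * freq_factor k s)) de.
apply/funext => x; rewrite Ee /freq_factor big_cons.
have -> : partial j (fun=> c * freq_factor k s) x = 0.
  by apply: complexP; rewrite /partial /= derive_cst.
by rewrite mul0r add0r !mulrA; congr (_ * _); rewrite -!mulrA; congr (_ * _); exact: mulrC.
Qed.

Lemma smooth_cexp k : smooth (cexp k).
Proof.
have E : cexp k = fun x => 1 * cexp k x by apply/funext => x; rewrite mul1r.
move=> s psi; rewrite /psi E iter_partial_cexp.
have [c1 c2] : ccontinuous (fun x => 1 * freq_factor k s * cexp k x).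
  by apply: ccontinuousM; [exact: ccontinuous_cst|exact: ccontinuous_cexp].
split=> // j x.
have dc (a : R[i]) : cderivable j (fun=> a).
  by move=> y; split; exact: derivable_cst.
by have [/(_ x)] := cderivableM (dc (1 * freq_factor k s)) (cderivable_cexp k j).1.
Qed.

End complex_rows.

(** * The space L_2 of the torus and its inner product *)

Section L2_space.
Variables (R : realType) (d : nat).
Local Notation Re := (@complex.Re R).
Local Notation Im := (@complex.Im R).
Local Notation mu := (torus_measure R d).
Local Notation T := (d.-tuple (measurableTypeR R)).
Implicit Types f g h : torus_fun R d.

Definition sqmod (z : R[i]) : R := Re z ^+ 2 + Im z ^+ 2.

Lemma sqmod_ge0 z : 0 <= sqmod z.
Proof. by rewrite addr_ge0// sqr_ge0. Qed.

Lemma sqmodM z w : sqmod (z * w) = sqmod z * sqmod w.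
Proof. by rewrite /sqmod complexReM complexImM; ring. Qed.

Lemma sqmodD_le z w : sqmod (z + w) <= 2 * sqmod z + 2 * sqmod w.
Proof.
rewrite /sqmod complexReD complexImD -subr_ge0.
rewrite (_ : _ - _ = (Re z - Re w) ^+ 2 + (Im z - Im w) ^+ 2); last by ring.
by rewrite addr_ge0// sqr_ge0.
Qed.

Lemma sqmod_normc (z : R[i]) : Normc.normc z ^+ 2 = sqmod z.
Proof. by case: z => a b; rewrite sqr_sqrtr ?addr_ge0 ?sqr_ge0. Qed.

Lemma measurable_sqmod f : measurable_fun setT (fun t => Re (f t)) ->
  measurable_fun setT (fun t => Im (f t)) -> measurable_fun setT (fun t => sqmod (f t)).
Proof. by move=> mr mi; apply: measurable_funD; exact: measurable_funX. Qed.

Lemma Lnorm_sq f :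
  (Lnorm mu 2%:E (EFin \o modulus f) `^ 2 = \int[mu]_t (sqmod (f t))%:E)%E.
Proof.
rewrite poweR_Lnorm//; apply: eq_integral => t _ /=.
by rewrite powR_mulrn// real_normK ?num_real// sqmod_normc.
Qed.

Lemma L2P f : L2 R d f <-> [/\ measurable_fun setT (fun t => Re (f t)),
  measurable_fun setT (fun t => Im (f t)) & mu.-integrable setT (EFin \o (fun t => sqmod (f t)))].
Proof.
have iE : measurable_fun setT (fun t => Re (f t)) -> measurable_fun setT (fun t => Im (f t)) ->
    mu.-integrable setT (EFin \o (fun t => sqmod (f t))) <->
    (Lnorm mu 2%:E (EFin \o modulus f) < +oo)%E.
  move=> mr mi.
  have aE : (\int[mu]_t `|(EFin \o (fun t => sqmod (f t))) t| =
             \int[mu]_t (sqmod (f t))%:E)%E.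
    by apply: eq_integral => t _; rewrite gee0_abs// lee_fin sqmod_ge0.
  split=> [/integrableP[_]|Nf].
    rewrite aE -Lnorm_sq => H; rewrite ltey; apply/eqP => E; move: H.
    by rewrite E poweRyr.
  apply/integrableP; split; first by apply/measurable_EFinP; exact: measurable_sqmod.
  by rewrite aE -Lnorm_sq poweR_lty.
by split=> -[mr mi N]; split=> //; exact/iE.
Qed.

Lemma L2norm_sqE f : L2 R d f -> L2norm f ^+ 2 = \int[mu]_t sqmod (f t).
Proof.
move=> -[mr mi Nf]; rewrite /L2norm /Rintegral -Lnorm_sq.
have := Lnorm_ge0 mu 2%:E (EFin \o modulus f); move: Nf.
case: (Lnorm _ _ _) => [r||]//= _; rewrite lee_fin => r0.
by rewrite powR_mulrn.
Qed.

Lemma L2norm_ge0 f : 0 <= L2norm f.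
Proof. exact/fine_ge0/Lnorm_ge0. Qed.

Lemma measurable_ReM f g :
  measurable_fun setT (fun t => Re (f t)) -> measurable_fun setT (fun t => Im (f t)) ->
  measurable_fun setT (fun t => Re (g t)) -> measurable_fun setT (fun t => Im (g t)) ->
  measurable_fun setT (fun t => Re (f t * g t)) /\ measurable_fun setT (fun t => Im (f t * g t)).
Proof.
move=> rf jf rg jg; split.
  under eq_fun do rewrite complexReM.
  by apply: measurable_funB; exact: measurable_funM.
under eq_fun do rewrite complexImM.
by apply: measurable_funD; exact: measurable_funM.
Qed.

Lemma L2_dominated f g (a b : R) h : L2 R d f -> L2 R d g ->
  measurable_fun setT (fun t => Re (h t)) -> measurable_fun setT (fun t => Im (h t)) ->
  (forall t, sqmod (h t) <= a * sqmod (f t) + b * sqmod (g t)) -> L2 R d h.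
Proof.
move=> /L2P[_ _ f2] /L2P[_ _ g2] mr mi hle; apply/L2P; split=> //.
have [I _] := integrable_lin a b f2 g2.
apply: le_integrable I => //; first by apply/measurable_EFinP; exact: measurable_sqmod.
move=> t _ /=; rewrite lee_fin ger0_norm ?sqmod_ge0//.
exact: le_trans (hle t) (ler_norm _).
Qed.

Lemma L2_0 : L2 R d 0.
Proof.
apply/L2P; split; [exact: measurable_cst|exact: measurable_cst|].
rewrite (_ : _ \o _ = cst 0%E); first exact: integrable0.
by apply/funext => t /=; rewrite /sqmod /= expr0n addr0.
Qed.

Lemma L2_add f g : L2 R d f -> L2 R d g -> L2 R d (f + g).
Proof.
move=> Lf Lg; apply: (L2_dominated (a := 2) (b := 2) Lf Lg) => [||t].
- rewrite (_ : (fun _ => _) = (fun t => Re (f t) + Re (g t))).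
    by case: Lf => ? _ _; case: Lg => ? _ _; exact: measurable_funD.
  by apply/funext => t; rewrite -complexReD.
- rewrite (_ : (fun _ => _) = (fun t => Im (f t) + Im (g t))).
    by case: Lf => _ ? _; case: Lg => _ ? _; exact: measurable_funD.
  by apply/funext => t; rewrite -complexImD.
- exact: sqmodD_le.
Qed.

Lemma L2_scale (c : R[i]) f : L2 R d f -> L2 R d (c *: f).
Proof.
move=> Lf; have [mr mi _] := Lf.
have [m1 m2] := @measurable_ReM (fun=> c) f (measurable_cst _) (measurable_cst _) mr mi.
apply: (L2_dominated (a := sqmod c) (b := 0) Lf Lf) => // t.
by rewrite mul0r addr0 -sqmodM.
Qed.

Lemma L2_opp f : L2 R d f -> L2 R d (- f).
Proof. by rewrite -scaleN1r; exact: L2_scale. Qed.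

Lemma L2_sub f g : L2 R d f -> L2 R d g -> L2 R d (f - g).
Proof. by move=> Lf Lg; apply: L2_add => //; exact: L2_opp. Qed.

Lemma conjcRe (z : R[i]) : Re (conjc z) = Re z. Proof. by case: z. Qed.

Lemma conjcIm (z : R[i]) : Im (conjc z) = - Im z. Proof. by case: z. Qed.

Definition ip f g : R[i] := torus_integral (fun t => f t * conjc (g t)).

Lemma cintegrable_ip f g : L2 R d f -> L2 R d g -> cintegrable (fun t => f t * conjc (g t)).
Proof.
move=> /L2P[fr fi f2] /L2P[gr gi g2].
have [m1 m2] : measurable_fun setT (fun t => Re (f t * conjc (g t))) /\
    measurable_fun setT (fun t => Im (f t * conjc (g t))).
  apply: measurable_ReM => //.
    by under eq_fun do rewrite conjcRe.
  under eq_fun do rewrite conjcIm; exact: measurableT_comp.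
have [I _] := integrable_lin 1 1 f2 g2.
have abs2 (a b c e : R) : `|a * c + b * e| <= a ^+ 2 + b ^+ 2 + (c ^+ 2 + e ^+ 2).
  have := sqr_ge0 (a - c); have := sqr_ge0 (b - e); have := sqr_ge0 (a + c).
  have := sqr_ge0 (b + e); have := sqr_ge0 a; have := sqr_ge0 b; have := sqr_ge0 c.
  by have := sqr_ge0 e; rewrite ler_norml !expr2 => *; apply/andP; split; nra.
split; apply: le_integrable I => //; try exact/measurable_EFinP.
  move=> t _ /=; rewrite lee_fin complexReM conjcRe conjcIm mulrN opprK !mul1r.
  rewrite [leRHS]ger0_norm; last exact: addr_ge0 (sqmod_ge0 _) (sqmod_ge0 _).
  exact: abs2.
move=> t _ /=; rewrite lee_fin complexImM conjcRe conjcIm !mul1r.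
rewrite [leRHS]ger0_norm; last exact: addr_ge0 (sqmod_ge0 _) (sqmod_ge0 _).
rewrite mulrN addrC -mulrN.
rewrite (le_trans (abs2 _ _ _ _))// sqrrN /sqmod; lra.
Qed.

Lemma ip_linear (c : R[i]) f g h : L2 R d f -> L2 R d g -> L2 R d h ->
  ip (c *: f + g) h = c * ip f h + ip g h.
Proof.
move=> Lf Lg Lh; rewrite /ip -(cintegrableZ c (cintegrable_ip Lf Lh)).2.
rewrite -torus_integralD; last 2 first.
- by have [] := cintegrableZ c (cintegrable_ip Lf Lh).
- exact: cintegrable_ip.
congr torus_integral; apply/funext => t; rewrite mulrA -mulrDl; congr (_ * _).
Qed.

Lemma torus_integral_conj f : cintegrable f ->
  torus_integral (fun t => conjc (f t)) = conjc (torus_integral f).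
Proof.
move=> [_ fi]; apply: complexP; rewrite ?conjcRe ?conjcIm /=.
  by apply: eq_Rintegral => t _; rewrite conjcRe.
rewrite -mulN1r -RintegralZl//; apply: eq_Rintegral => t _.
by rewrite conjcIm mulN1r.
Qed.

Lemma ip_conj f g : L2 R d f -> L2 R d g -> ip g f = conjc (ip f g).
Proof.
move=> Lf Lg; rewrite /ip -torus_integral_conj; last exact: cintegrable_ip.
congr torus_integral; apply/funext => t; rewrite rmorphM /= conjcK mulrC //.
Qed.

Lemma ip_sq f : L2 R d f -> ip f f = Complex (L2norm f ^+ 2) 0.
Proof.
move=> Lf; rewrite L2norm_sqE//; apply: complexP => /=.
  apply: eq_Rintegral => t _; rewrite complexReM conjcRe conjcIm /sqmod; ring.
transitivity (\int[mu]_(t in setT) (0 : R)); last by rewrite /Rintegral integral0.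
by apply: eq_Rintegral => t _; rewrite complexImM conjcRe conjcIm; ring.
Qed.

Lemma L2_row (phi : 'rV[R]_d -> R[i]) : ccontinuous phi -> L2 R d (phi \o @row_of R d).
Proof.
move=> [cr ci]; apply/L2P; split.
- exact: measurable_continuous_row cr.
- exact: measurable_continuous_row ci.
- apply: (@integrable_continuous_row _ _ (fun x => sqmod (phi x))).
  by apply: continuous_rowD; under eq_fun do rewrite expr2; exact: continuous_rowM.
Qed.

Lemma ccontinuous_trig_sum p : ccontinuous (fun x : 'rV[R]_d => \sum_(u <- p) u.1 * cexp u.2 x).
Proof.
elim: p => [|u p IH].
  by under eq_fun do rewrite big_nil; exact: ccontinuous_cst.
under eq_fun do rewrite big_cons; apply: ccontinuousD => //.
by apply: ccontinuousM; [exact: ccontinuous_cst|exact: ccontinuous_cexp].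
Qed.

Lemma L2_trig_sum p : L2 R d (trig_sum p).
Proof. exact: L2_row (ccontinuous_trig_sum p). Qed.

End L2_space.

(** * Completeness of the exponentials *)

Section real_trig.
Variables (R : realType) (d : nat).
Local Notation Re := (@complex.Re R).
Local Notation Im := (@complex.Im R).
Local Notation mu := (torus_measure R d).
Local Notation T := (d.-tuple (measurableTypeR R)).
Implicit Types (q : T -> R) (A B : set T).

Definition real_trig q := exists p, forall t, trig_sum p t = Complex (q t) 0.

Lemma trig_sum_cat (p p' : seq (R[i] * {ffun 'I_d -> int})) t :
  trig_sum (p ++ p') t = trig_sum p t + trig_sum p' t.
Proof. by rewrite /trig_sum big_cat. Qed.

Lemma trig_sum_mul (p p' : seq (R[i] * {ffun 'I_d -> int})) t :
  trig_sum [seq (u.1 * v.1, u.2 + v.2) | u <- p, v <- p'] t =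
  trig_sum p t * trig_sum p' t.
Proof.
rewrite /trig_sum big_allpairs_dep mulr_suml; apply: eq_bigr => u _.
rewrite mulr_sumr; apply: eq_bigr => v _ /=.
by rewrite cexpD mulrACA.
Qed.

Lemma real_trig_cst c : real_trig (fun=> c).
Proof.
by exists [:: (Complex c 0, 0)] => t; rewrite /trig_sum big_seq1 /= cexp0 mulr1.
Qed.

Lemma real_trigD q q' : real_trig q -> real_trig q' -> real_trig (fun t => q t + q' t).
Proof.
move=> [p Ep] [p' Ep']; exists (p ++ p') => t.
rewrite trig_sum_cat Ep Ep'; apply: complexP => //=; exact: addr0.
Qed.

Lemma real_trigM q q' : real_trig q -> real_trig q' -> real_trig (fun t => q t * q' t).
Proof.
move=> [p Ep] [p' Ep']; exists [seq (u.1 * v.1, u.2 + v.2) | u <- p, v <- p'] => t.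
rewrite trig_sum_mul Ep Ep'; apply: complexP; rewrite ?complexReM ?complexImM /=; ring.
Qed.

Lemma real_trigN q : real_trig q -> real_trig (fun t => - q t).
Proof.
move=> tq; rewrite (_ : (fun _ => _) = (fun t => -1 * q t)).
  by apply: real_trigM => //; exact: real_trig_cst.
by apply/funext => t; rewrite mulN1r.
Qed.

Lemma real_trig_onem q : real_trig q -> real_trig (fun t => 1 - q t).
Proof. by move=> tq; apply: real_trigD; [exact: real_trig_cst|exact: real_trigN]. Qed.

Lemma real_trigX q n : real_trig q -> real_trig (fun t => q t ^+ n).
Proof.
move=> tq; elim: n => [|n IH]; first exact: real_trig_cst.
by under eq_fun do rewrite exprS; exact: real_trigM.
Qed.

Lemma real_trig_sin (j : 'I_d) b : real_trig (fun t => sin (b + tnth t j)).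
Proof.
pose k : {ffun 'I_d -> int} := [ffun l => (l == j)%:Z].
have phk t : phase k (@row_of R d t) = tnth t j.
  rewrite /phase (bigD1 j)//= big1 ?addr0; last by move=> l lj; rewrite ffunE (negbTE lj) mul0r.
  by rewrite ffunE eqxx mul1r mxE.
(* The coefficients are e^(ib)/(2i) = (sin b - i cos b)/2 and its conjugate. *)
exists [:: (Complex (sin b / 2) (- (cos b / 2)), k); (Complex (sin b / 2) (cos b / 2), - k)] => t.
rewrite /trig_sum big_cons big_seq1 /= cexpN /cexp phk.
apply: complexP; rewrite ?complexReD ?complexImD ?complexReM ?complexImM /= ?sinD; lra.
Qed.

Lemma measurable_real_trig q : real_trig q -> measurable_fun setT q.
Proof.
move=> [p Ep]; have [+ _ _] := L2_trig_sum (R := R) p.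
by rewrite (_ : (fun t => Re _) = q)//; apply/funext => t; rewrite Ep.
Qed.

(* The bounds 0 <= q <= 1 make the products of approximants approximants of the
   intersections. *)
Definition trig_approx A := measurable A /\ forall e, 0 < e ->
  exists q, [/\ real_trig q, forall t, 0 <= q t <= 1 &
    (\int[mu]_t `|\1_A t - q t|%:E <= e%:E)%E].

Lemma measurable_dist A q : measurable A -> real_trig q ->
  measurable_fun setT (fun t => `|\1_A t - q t|%:E).
Proof.
move=> mA tq; apply/measurable_EFinP; apply: measurableT_comp => //.
by apply: measurable_funB; [exact: measurable_indic|exact: measurable_real_trig].
Qed.

Lemma trig_approxC A : trig_approx A -> trig_approx (~` A).
Proof.
move=> [mA aA]; split; first exact: measurableC.
move=> e e0; have [q [tq q01 qe]] := aA e e0.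
exists (fun t => 1 - q t); split; first exact: real_trig_onem.
  by move=> t; have /andP[q0 q1] := q01 t; rewrite subr_ge0 q1 lerBlDr lerDl.
apply: le_trans qe; rewrite le_eqVlt; apply/orP; left; apply/eqP.
apply: eq_integral => t _; congr (_%:E).
have -> : \1_(~` A) t = 1 - \1_A t :> R.
  by rewrite !indicE in_setC; case: (t \in A); rewrite /= ?subrr ?subr0.
by rewrite -normrN; congr `|_|; ring.
Qed.

Lemma trig_approxI A B : trig_approx A -> trig_approx B -> trig_approx (A `&` B).
Proof.
move=> [mA aA] [mB aB]; split; first exact: measurableI.
move=> e e0; have e2 : 0 < e / 2 by rewrite divr_gt0.
have [q [tq q01 qe]] := aA _ e2; have [q' [tq' q01' qe']] := aB _ e2.
exists (fun t => q t * q' t); split; first exact: real_trigM.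
  move=> t; have /andP[q0 q1] := q01 t; have /andP[q0' q1'] := q01' t.
  by rewrite mulr_ge0//= -[leRHS]mulr1 ler_pM.
rewrite [e]splitr EFinD; apply: le_trans (leeD qe qe').
rewrite -ge0_integralD//; try exact: measurable_dist.
apply: ge0_le_integral => //.
- by apply: measurable_dist; [exact: measurableI|exact: real_trigM].
- by apply: emeasurable_funD; exact: measurable_dist.
move=> t _; rewrite -EFinD lee_fin indicI /=.
have /andP[q0 q1] := q01 t; have /andP[q0' q1'] := q01' t.
have B1 : `|\1_B t : R| <= 1 by rewrite indicE; case: (t \in B); rewrite ?normr1 ?normr0.
rewrite (_ : _ - _ = (\1_A t - q t) * \1_B t + q t * (\1_B t - q' t)); last by ring.
rewrite (le_trans (ler_normD _ _))// !normrM lerD//.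
  by rewrite -[leRHS]mulr1 ler_pM.
by rewrite -[leRHS]mul1r ler_pM// ger0_norm.
Qed.

Lemma trig_approx_ae A B (N : set T) : trig_approx A -> measurable B -> measurable N ->
  mu N = 0%E -> (forall t, ~ N t -> A t <-> B t) -> trig_approx B.
Proof.
move=> [mA aA] mB mN N0 AB; split=> // e e0; have [q [tq q01 qe]] := aA e e0.
exists q; split=> //; apply: le_trans qe; rewrite le_eqVlt; apply/orP; left; apply/eqP.
apply: ae_eq_integral => //; try exact: measurable_dist.
exists N; split => // t /= H; apply: contrapT => Nt; apply: H => _.
congr (`|_ - _|%:E); rewrite !indicE.
have [H1 H2] := AB t Nt.
by congr (_%:R); congr nat_of_bool; apply/idP/idP; rewrite !inE.
Qed.

Lemma trig_approx0 : trig_approx set0.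
Proof.
split=> // e e0; exists (fun=> 0); split; first exact: real_trig_cst.
  by move=> _; rewrite lexx ler01.
rewrite (eq_integral (fun=> 0%E)) ?integral0 ?lee_fin ?(ltW e0)// => t _.
by rewrite indic0 subr0 normr0.
Qed.

Lemma trig_approxU A B : trig_approx A -> trig_approx B -> trig_approx (A `|` B).
Proof.
move=> aA aB; rewrite -(setCK (A `|` B)) setCU.
by apply: trig_approxC; apply: trig_approxI; exact: trig_approxC.
Qed.

(** By continuity from below, some finite union misses at most e/2 of the measure; an approximant of
    that finite union to within e/2 serves for the whole. *)
Lemma trig_approx_bigcup (A : nat -> set T) : (forall n, trig_approx (A n)) ->
  trig_approx (\bigcup_n A n).
Proof.
move=> aA; have mA n : measurable (A n) by have [] := aA n.
have mU : measurable (\bigcup_n A n) by exact: bigcupT_measurable.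
split=> // e e0; have e2 : 0 < e / 2 by rewrite divr_gt0.
pose S n := \big[setU/set0]_(l < n.+1) A l.
have aS n : trig_approx (S n).
  by rewrite /S; elim/big_ind : _ => //; [exact: trig_approx0|exact: trig_approxU].
have mS n : measurable (S n) by have [] := aS n.
have SU : \bigcup_n S n = \bigcup_n A n by exact: bigcup_bigsetU_bigcup.
have Scvg : (mu \o S) n @[n --> \oo] --> mu (\bigcup_n A n).
  rewrite -SU; apply: nondecreasing_cvg_mu => //; first by rewrite SU.
  move=> n k nk; apply/subsetPset; rewrite /S -!bigcup_mkord => t [l /= ln At].
  by exists l => //=; exact: leq_trans ln _.
have [n Hn] : exists n, (mu (\bigcup_n A n) <= mu (S n) + (e / 2)%:E)%E.
  have Ufin : mu (\bigcup_n A n) \is a fin_num by exact: fin_num_measure.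
  move: Scvg; rewrite -(fineK Ufin) => /fine_cvgP[_ /cvgrPdist_lt /(_ _ e2)[n _ Hn]].
  exists n; have := Hn n (leqnn n); rewrite /= => H.
  have Sfin : mu (S n) \is a fin_num by exact: fin_num_measure.
  rewrite -(fineK Sfin) -EFinD lee_fin -lerBlDl.
  exact/ltW/(le_lt_trans (ler_norm _) H).
have [_ /(_ _ e2)[q [tq q01 qe]]] := aS n.
exists q; split=> //.
have SsubU : S n `<=` \bigcup_n A n by rewrite -SU => t St; exists n.
rewrite [e]splitr EFinD.
apply: (@le_trans _ _
  (\int[mu]_t ((\1_(\bigcup_n A n `\` S n) t)%:E + `|\1_(S n) t - q t|%:E))%E).
  apply: ge0_le_integral => //.
  - exact: measurable_dist.
  - apply: emeasurable_funD; last exact: measurable_dist.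
    by apply/measurable_EFinP; apply: measurable_indic; exact: measurableD.
  move=> t _; rewrite -EFinD lee_fin.
  have -> : \1_(\bigcup_n A n `\` S n) t = \1_(\bigcup_n A n) t - \1_(S n) t :> R.
    rewrite !indicE; case: (boolP (t \in S n)) => tS.
      rewrite (mem_set (SsubU _ (set_mem tS))) subrr memNset// => -[_].
      by move: tS; rewrite inE.
    rewrite subr0; congr (_%:R); congr nat_of_bool; apply/idP/idP; rewrite !inE; first by case.
    by move=> Ut; split=> // St; move: tS; rewrite notin_setE.
  rewrite -[X in _ <= X + _]ger0_norm; last first.
    rewrite subr_ge0 !indicE; case: (boolP (t \in S n)) => // tS.
    by rewrite (mem_set (SsubU _ (set_mem tS))).
  by rewrite (le_trans _ (ler_normD _ _))// addrA subrK.
rewrite ge0_integralD//.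
- rewrite integral_indic ?setIT; last 2 first.
  + exact: measurableT.
  + exact: measurableD.
  apply: leeD => //; rewrite measureD//; last by rewrite ltey_eq fin_num_measure.
  by rewrite setIidr// leeBlDl ?fin_num_measure.
- by apply/measurable_EFinP; apply: measurable_indic; exact: measurableD.
- exact: measurable_dist.
Qed.

Lemma bernoulli_lower (y : R) N : 0 <= y <= 1 -> 1 - N%:R * y <= (1 - y) ^+ N.
Proof.
move=> /andP[y0 y1]; elim: N => [|N IH]; first by rewrite mul0r subr0 expr0.
rewrite exprS (le_trans _ (ler_wpM2l _ IH)) ?subr_ge0// -(natr1 N).
have : 0 <= N%:R * (y * y) by rewrite mulr_ge0// mulr_ge0.
by move: (N%:R : R) => M; nra.
Qed.

(** This makes (1 - y)^N small when N y is large; [bernoulli_lower] keeps it near 1 when N y is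
    small. *)
Lemma bernoulli_upper (y : R) N : 0 <= y <= 1 -> (1 - y) ^+ N * (1 + N%:R * y) <= 1.
Proof.
move=> /andP[y0 y1]; elim: N => [|N IH]; first by rewrite mul0r addr0 expr0 mulr1.
apply: le_trans IH; rewrite exprSr -mulrA ler_wpM2l ?exprn_ge0 ?subr_ge0//.
rewrite -(natr1 N); have : 0 <= (N%:R : R) by [].
by move: (N%:R : R) => M M0; nra.
Qed.

(* These polynomials converge to the indicator of [0, 1/2[ on [0, 1] minus 1/2,
   as in the Brosowski-Deutsch proof of the Stone-Weierstrass theorem. *)
Lemma cvg_step_poly (u : R) : 0 <= u <= 1 -> u != 2^-1 ->
  (1 - u ^+ n) ^+ (2 ^ n) @[n --> \oo] --> ((u < 2^-1)%R%:R : R).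
Proof.
move=> /andP[u0 u1] u2.
have un n : 0 <= u ^+ n <= 1 by rewrite exprn_ge0// exprn_ile1.
(* With N = 2^n and y = u^n, the product N y in Bernoulli's inequalities is (2u)^n, which tends to 0
   or to infinity according to the side of 1/2 on which u lies. *)
have pow2 n : (2 ^ n)%:R * u ^+ n = (2 * u) ^+ n by rewrite natrX exprMn.
case: ltP => /= u12.
  have c0 : (2 * u) ^+ n @[n --> \oo] --> (0 : R).
    by apply: cvg_expr; rewrite ger0_norm ?mulr_ge0//; lra.
  apply: (@squeeze_cvgr _ _ _ _ (fun n => 1 - (2 * u) ^+ n) (fun=> 1)).
  - near=> n; rewrite -pow2 bernoulli_lower//=.
    have /andP[a b] := un n.
    by rewrite exprn_ile1 ?subr_ge0// gerBl.
  - by rewrite -[X in _ --> X]subr0; apply: cvgB => //; exact: cvg_cst.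
  - exact: cvg_cst.
have u3 : 1 < 2 * u.
  have : 2^-1 < u by rewrite lt_neqAle eq_sym u2.
  lra.
have c0 : (2 * u)^-1 ^+ n @[n --> \oo] --> (0 : R).
  by apply: cvg_expr; rewrite ger0_norm ?invr_ge0 ?mulr_ge0// invf_lt1// (lt_trans _ u3).
apply: (@squeeze_cvgr _ _ _ _ (fun=> 0) (fun n => (2 * u)^-1 ^+ n)) => //; last exact: cvg_cst.
near=> n; have /andP[a b] := un n; rewrite exprn_ge0 ?subr_ge0//=.
have p0 : 0 < (2 * u) ^+ n by rewrite exprn_gt0// (lt_trans _ u3).
rewrite exprVn -[leRHS]mul1r ler_pdivlMr// (le_trans _ (bernoulli_upper (2 ^ n) (un n)))//.
by rewrite pow2 ler_wpM2l ?exprn_ge0 ?subr_ge0// lerDr.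
Unshelve. all: end_near. Qed.

Lemma trig_approx_pos s : real_trig s -> (forall t, `|s t| <= 1) ->
  mu [set t | s t = 0] = 0%E -> trig_approx [set t | 0 < s t].
Proof.
move=> ts s1 s0; have ms := measurable_real_trig ts.
have mA : measurable [set t | 0 < s t].
  rewrite (_ : [set t | 0 < s t] = s @^-1` `]0, +oo[%classic).
    by rewrite -[X in measurable X]setTI; apply: ms.
  by apply/seteqP; split => t /=; rewrite in_itv/= andbT.
have mN : measurable [set t | s t = 0].
  rewrite (_ : [set t | s t = 0] = s @^-1` [set 0])//.
  by rewrite -[X in measurable X]setTI; apply: ms.
split=> // e e0.
(* This maps [-1, 1] onto [0, 1] and turns s > 0 into u < 1/2. The step polynomials in u converge to
   the indicator off the null set s = 0 and are bounded by 1, so dominated convergence gives the L_1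
   limit. *)
pose u t := (1 - s t) * 2^-1.
have u01 t : 0 <= u t <= 1.
  by have := s1 t; rewrite ler_norml /u => /andP[a b]; apply/andP; split; lra.
pose q n t := (1 - u t ^+ n) ^+ (2 ^ n).
have tq n : real_trig (q n).
  apply: real_trigX; apply: real_trig_onem; apply: real_trigX; apply: real_trigM.
    exact: real_trig_onem.
  exact: real_trig_cst.
have q01 n t : 0 <= q n t <= 1.
  have /andP[a b] := u01 t.
  by rewrite exprn_ge0 ?exprn_ile1 ?subr_ge0 ?gerBl ?exprn_ile1 ?exprn_ge0.
have icst : mu.-integrable setT (cst 1%E : T -> \bar R).
  apply/integrableP; split; first exact: measurable_cst.
  under eq_integral do rewrite /= normr1.
  by rewrite integral_cst// mul1e ltey_eq fin_num_measure.
have [] := @dominated_convergence _ _ _ mu setT measurableT (fun n t => (q n t)%:E)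
  (fun t => (\1_[set t | 0 < s t] t)%:E) (cst 1%E).
- by move=> n; apply/measurable_EFinP; exact: measurable_real_trig.
- by apply/measurable_EFinP; exact: measurable_indic.
- exists [set t | s t = 0]; split => // t /= H; apply: contrapT => st; apply: H => _.
  apply: cvg_EFin; first by near=> n.
  have st' : s t != 0 by exact/eqP.
  rewrite (_ : \1__ t = (u t < 2^-1)%R%:R); last first.
    rewrite indicE; congr (_%:R); congr nat_of_bool.
    by apply/idP/idP; rewrite inE /= /u; lra.
  apply: cvg_step_poly => //; apply: contra st' => /eqP; rewrite /u => ?; apply/eqP; lra.
- exact: icst.
- apply: aeW => t n _ /=; rewrite lee_fin.
  by have /andP[a b] := q01 n t; rewrite ger0_norm.
move=> _ + _ => /fine_cvgP[Ifin /cvgrPdist_lt /(_ _ e0) Ilt].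
have [N _ HN] : \forall n \near \oo,
    (\int[mu]_t `|(\1_[set t | (0 < s t)%R] t)%:E - (q n t)%:E| <= e%:E)%E.
  near=> k.
  have kfin : (\int[mu]_t `|(q k t)%:E - (\1_[set t | (0 < s t)%R] t)%:E|)%E \is a fin_num.
    by near: k.
  have : `|0 - fine (\int[mu]_t `|(q k t)%:E - (\1_[set t | (0 < s t)%R] t)%:E|)%E| < e.
    by near: k.
  rewrite sub0r normrN => H.
  have -> : (\int[mu]_t `|(\1_[set t | (0 < s t)%R] t)%:E - (q k t)%:E| =
            \int[mu]_t `|(q k t)%:E - (\1_[set t | (0 < s t)%R] t)%:E|)%E.
    by apply: eq_integral => t _; rewrite -!EFinB !abse_EFin distrC.
  rewrite -(fineK kfin) lee_fin; exact/ltW/(le_lt_trans (ler_norm _) H).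
exists (q N); split=> //.
have := HN N (leqnn N).
by under eq_integral do rewrite -EFinB abse_EFin.
Unshelve. all: end_near. Qed.

End real_trig.

(** * Approximation of indicators of all measurable sets *)

Section trig_generates.
Variables (R : realType) (d : nat).
Local Notation mu := (torus_measure R d).
Local Notation T := (d.-tuple (measurableTypeR R)).
Implicit Types (A B : set T).

(** Reduction modulo pi preserves |sin| and lands in [0, pi[, where 0 is the only zero. *)
Lemma sin_eq0_int (x : R) : sin x = 0 -> exists z : int, x = z%:~R * pi.
Proof.
move=> sx; have pi0 := pi_gt0 R.
pose z := Num.floor (x / pi); exists z; apply/eqP; rewrite -subr_eq0; apply/eqP.
have y0 : 0 <= x - z%:~R * pi.
  by rewrite subr_ge0 -ler_pdivlMr// floor_le.
have y1 : x - z%:~R * pi < pi.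
  rewrite ltrBlDl -[X in _ < _ + X]mul1r -mulrDl -ltr_pdivrMr//.
  by have := floorD1_gt (x / pi); rewrite intrD.
have per : periodic (fun y : R => `|sin y|) pi.
  by move=> y; rewrite sinDpi normrN.
have := periodic_int (- z) x per; rewrite sx normr0 mulrNz mulNr => /eqP.
rewrite normr_eq0 => /eqP s0; apply/eqP; rewrite eq_le y0 andbT leNgt; apply/negP => y2.
by have := sin_gt0_pi (x := x - z%:~R * pi); rewrite y2 y1 s0 ltxx => /(_ isT).
Qed.

Lemma sin_zero_null (j : 'I_d) (b : R) : mu [set t | sin (b + tnth t j) = 0] = 0%E.
Proof.
pose Z : set (measurableTypeR R) := [set x : R | sin (b + x) = 0].
have mZ : measurable Z.
  rewrite (_ : Z = (fun x : R => sin (b + x)) @^-1` [set 0])//.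
  rewrite -[X in measurable X]setTI.
  have : measurable_fun setT (fun x : measurableTypeR R => sin (b + x) : R).
    apply: measurableT_comp; first by apply: continuous_measurable_fun; exact: continuous_sin.
    by apply: measurable_funD; [exact: measurable_cst|exact: measurable_id].
  by move=> H; apply: H.
apply: (@torus_measure_coord_null _ _ Z) => //.
apply: countable_lebesgue_measure0.
apply: (@sub_countable _ _ _ [set (z%:~R * pi - b) | z in [set: int]]); last first.
  by apply: (card_le_trans (card_image_le _ _)); exact: countableP.
apply: subset_card_le => x [/= sx _]; have [z zE] := sin_eq0_int sx.
by exists z => //; rewrite -zE addrC addKr.
Qed.

Lemma trig_approx_sin (j : 'I_d) (b : R) : trig_approx [set t : T | 0 < sin (b + tnth t j)].
Proof.
apply: (trig_approx_pos (real_trig_sin j b)) => [t|]; last exact: sin_zero_null.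
by rewrite ler_norml sin_geN1 sin_le1.
Qed.

Lemma trig_approx_Nsin (j : 'I_d) (b : R) : trig_approx [set t : T | sin (b + tnth t j) < 0].
Proof.
have := trig_approx_sin j (b + pi).
rewrite (_ : [set t : T | 0 < _] = [set t : T | sin (b + tnth t j) < 0])//.
by apply/seteqP; split => t /=; rewrite addrAC sinDpi oppr_gt0.
Qed.

Lemma coord_null (j : 'I_d) (a : R) : mu [set t | tnth t j = a] = 0%E.
Proof.
have := @torus_measure_coord_null R d [set a] j; apply.
  exact: measurable_set1.
by apply: countable_lebesgue_measure0; exact: sub_countable (subset_card_le (@subIsetl _ _ _)) _.
Qed.

(** Two half-tori cut out an interval up to a null set. For 0 < b <= pi, the condition sin x > 0
    confines x to ]0, pi[, where sin(x - b) < 0 means x < b. For pi < b < 2 pi, the condition sin x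
    < 0 confines x to ]pi, 2 pi[, where sin(x - b) > 0 means x > b, and a complement is taken. *)
Lemma trig_approx_le (j : 'I_d) (b : R) : trig_approx [set t : T | tnth t j <= b].
Proof.
have pi0 := pi_gt0 R.
have mj : measurable_fun setT (fun t : T => tnth t j) by exact: measurable_tnth.
have mb : measurable [set t : T | tnth t j <= b].
  rewrite (_ : [set t : T | _] = (fun t : T => tnth t j) @^-1` `]-oo, b]%classic).
    by rewrite -[X in measurable X]setTI; apply: mj => //; exact: measurable_itv.
  by apply/seteqP; split => t /=; rewrite in_itv.
have m1 (a : R) : measurable [set t : T | tnth t j = a].
  rewrite (_ : [set t : T | _] = (fun t : T => tnth t j) @^-1` [set a])//.
  by rewrite -[X in measurable X]setTI; apply: mj => //; exact: measurable_set1.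
pose N : set T := @off_cube R d `|` [set t | tnth t j = 0] `|` [set t | tnth t j = pi]
  `|` [set t | tnth t j = 2 * pi] `|` [set t | tnth t j = b].
have mN : measurable N.
  by do ?[apply: measurableU => //]; exact: measurable_off_cube.
have N0 : mu N = 0%E.
  have U0 (A B : set T) : measurable A -> measurable B -> mu A = 0%E -> mu B = 0%E ->
      mu (A `|` B) = 0%E by move=> mA mB A0 B0; rewrite null_set_setU.
  rewrite /N !U0 ?off_cube_null ?coord_null//; do ?[apply: measurableU => //];
    exact: measurable_off_cube.
have Nx t : ~ N t -> [/\ 0 < tnth t j, tnth t j < 2 * pi, tnth t j != pi & tnth t j != b].
  move=> Nt.
  have /on_cube/(_ j) : ~ @off_cube R d t by move=> H; apply: Nt; do 4 left.
  rewrite /circle_set /= in_itv/= => /andP[x0 x2]; split.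
  - by rewrite lt_neqAle x0 andbT eq_sym; apply/eqP => H; apply: Nt; do 3 left; right.
  - by rewrite lt_neqAle x2 andbT; apply/eqP => H; apply: Nt; do 1 left; right.
  - by apply/eqP => H; apply: Nt; do 2 left; right.
  - by apply/eqP => H; apply: Nt; right.
have spos (y : R) : 0 < y -> y < pi -> 0 < sin y.
  by move=> y1 y2; apply: sin_gt0_pi; rewrite y1 y2.
have sneg (y : R) : - pi < y -> y < 0 -> sin y < 0.
  by move=> y1 y2; rewrite -oppr_gt0 -sinN; apply: spos; lra.
have sneg2 (y : R) : pi < y -> y < 2 * pi -> sin y < 0.
  move=> y1 y2; rewrite -(subrK pi y) sinDpi oppr_lt0; apply: spos; lra.
have [b0|b0] := leP b 0.
  apply: (trig_approx_ae (@trig_approx0 R d) mb mN N0) => t /Nx[x0 x2 _ _].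
  by split=> //= xb; have := lt_le_trans x0 (le_trans xb b0); rewrite ltxx.
have [b2|b2] := leP (2 * pi) b.
  apply: (trig_approx_ae (trig_approxC (@trig_approx0 R d)) mb mN N0) => t /Nx[x0 x2 _ _].
  by split=> [_ /=|_ //]; rewrite ltW// (lt_le_trans x2).
have [bpi|bpi] := leP b pi.
  have H (x : R) : 0 < x -> x < 2 * pi -> x != pi -> x != b ->
      0 < sin (0 + x) /\ sin (- b + x) < 0 <-> x <= b.
    move=> x0 x2 xpi xb; rewrite add0r; split=> [[sx sbx]|xle].
      rewrite leNgt; apply/negP => xgt.
      have xltpi : x < pi.
        rewrite ltNge le_eqVlt eq_sym (negbTE xpi) /=; apply/negP => /sneg2 /(_ x2).
        by move=> /(lt_trans sx); rewrite ltxx.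
      have : 0 < sin (- b + x) by apply: spos; lra.
      by move=> /lt_trans /(_ sbx); rewrite ltxx.
    have xlt : x < b by rewrite lt_neqAle xb.
    by split; [apply: spos|apply: sneg]; lra.
  apply: (trig_approx_ae (trig_approxI (trig_approx_sin j 0) (trig_approx_Nsin j (- b))) mb mN N0).
  by move=> t /Nx[x0 x2 xpi xb]; exact: H.
have H (x : R) : 0 < x -> x < 2 * pi -> x != pi -> x != b ->
    ~ (sin (0 + x) < 0 /\ 0 < sin (- b + x)) <-> x <= b.
  move=> x0 x2 xpi xb; rewrite add0r; split=> [nH|xle [sx sbx]].
    rewrite leNgt; apply/negP => xgt; apply: nH; split.
      by apply: sneg2 => //; lra.
    by apply: spos; lra.
  have xlt : x < b by rewrite lt_neqAle xb.
  have : sin (- b + x) < 0.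
    apply: sneg; last lra.
    have : pi < x.
      rewrite ltNge le_eqVlt (negbTE xpi) /=; apply/negP => /(spos _ x0).
      by move=> /lt_trans /(_ sx); rewrite ltxx.
    lra.
  by move=> /lt_trans /(_ sbx); rewrite ltxx.
apply: (trig_approx_ae (trig_approxC (trig_approxI (trig_approx_Nsin j 0)
  (trig_approx_sin j (- b)))) mb mN N0).
by move=> t /Nx[x0 x2 xpi xb]; exact: H.
Qed.

(** The half-open intervals generate the Borel sets and are differences of half-lines. *)
Lemma trig_approx_coord (j : 'I_d) (B : set (measurableTypeR R)) : measurable B ->
  trig_approx [set t : T | B (tnth t j)].
Proof.
apply: (@smallest_sub _ _ _ [set B | trig_approx [set t : T | B (tnth t j)]]).
  split => [|A aA|A aA] /=.
  - by rewrite (_ : [set _ | _] = set0); [exact: trig_approx0|apply/seteqP; split].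
  - rewrite (_ : [set _ | _] = ~` [set t : T | A (tnth t j)]); first exact: trig_approxC.
    by apply/seteqP; split => t /=; [case|split].
  - rewrite (_ : [set _ | _] = \bigcup_k [set t : T | A k (tnth t j)]).
      exact: trig_approx_bigcup.
    by apply/seteqP; split => t /= [k kE H]; exists k.
move=> _ [[a b] _ <-] /=.
rewrite (_ : [set _ | _] = [set t : T | tnth t j <= b] `&` ~` [set t : T | tnth t j <= a]).
  apply: trig_approxI; first exact: trig_approx_le.
  by apply: trig_approxC; exact: trig_approx_le.
apply/seteqP; split => t /=; rewrite in_itv/=.
  by move=> /andP[ta tb]; split => //; apply/negP; rewrite -ltNge.
by move=> [tb /negP]; rewrite -ltNge => ->.
Qed.

Lemma trig_approx_measurable A : measurable A -> trig_approx A.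
Proof.
apply: (@smallest_sub _ _ _ (@trig_approx R d)).
  split => [|B aB|B aB]; first exact: trig_approx0.
  - by rewrite setTD; exact: trig_approxC.
  - exact: trig_approx_bigcup.
move=> B; rewrite -bigcup_seq => -[j _ [C mC <-]].
by rewrite setTI; exact: trig_approx_coord.
Qed.

End trig_generates.

(** * Density of trigonometric polynomials in L_2 *)

Section trig_dense.
Import HBSimple HBNNSimple.
Variables (R : realType) (d : nat).
Local Notation Re := (@complex.Re R).
Local Notation Im := (@complex.Im R).
Local Notation mu := (torus_measure R d).
Local Notation T := (d.-tuple (measurableTypeR R)).
Implicit Types (g h q : T -> R).

Definition l2_approx g := measurable_fun setT g /\ forall e, 0 < e ->
  exists2 q, real_trig q & (\int[mu]_t ((g t - q t) ^+ 2)%:E <= e%:E)%E.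

Lemma measurable_sqB g h : measurable_fun setT g -> measurable_fun setT h ->
  measurable_fun setT (fun t => ((g t - h t) ^+ 2)%:E).
Proof.
by move=> mg mh; apply/measurable_EFinP; apply: measurable_funX; exact: measurable_funB.
Qed.

(** Since (a + b)^2 <= 2 a^2 + 2 b^2, two errors of e/4 add up to e. The function [k] is free so
    that the lemma covers sums as well as chains of approximations. *)
Lemma l2_dist_triangle (g g' h h' k : T -> R) (e : R) :
  measurable_fun setT g -> measurable_fun setT g' ->
  measurable_fun setT h -> measurable_fun setT h' -> measurable_fun setT k ->
  (forall t, k t = (g t - g' t) + (h t - h' t)) ->
  (\int[mu]_t ((g t - g' t) ^+ 2)%:E <= (e / 4)%:E)%E ->
  (\int[mu]_t ((h t - h' t) ^+ 2)%:E <= (e / 4)%:E)%E ->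
  (\int[mu]_t (k t ^+ 2)%:E <= e%:E)%E.
Proof.
move=> mg mg' mh mh' mk kE ge he.
have sq0 (a : R) : (0%:E <= (a ^+ 2)%:E)%E by rewrite lee_fin sqr_ge0.
apply: (@le_trans _ _ (\int[mu]_t (2%:E * (((g t - g' t) ^+ 2)%:E + ((h t - h' t) ^+ 2)%:E)))%E).
  apply: ge0_le_integral => //.
  - by apply/measurable_EFinP; exact: measurable_funX.
  - by apply: measurable_funeM; apply: emeasurable_funD; exact: measurable_sqB.
  move=> t _; rewrite kE -EFinD -EFinM lee_fin -subr_ge0.
  rewrite (_ : _ - _ = ((g t - g' t) - (h t - h' t)) ^+ 2); last by ring.
  exact: sqr_ge0.
rewrite ge0_integralZl//; last 2 first.
- by apply: emeasurable_funD; exact: measurable_sqB.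
- by move=> t _; rewrite adde_ge0 ?sq0.
rewrite ge0_integralD//; try exact: measurable_sqB; try by move=> t _; exact: sq0.
apply: (@le_trans _ _ (2%:E * ((e / 4)%:E + (e / 4)%:E))%E).
  by apply: lee_wpmul2l => //; exact: leeD.
by rewrite -EFinD -EFinM lee_fin; lra.
Qed.

Lemma l2_approxD g h : l2_approx g -> l2_approx h -> l2_approx (fun t => g t + h t).
Proof.
move=> [mg ag] [mh ah]; split; first exact: measurable_funD.
move=> e e0; have e4 : 0 < e / 4 by rewrite divr_gt0.
have [q tq qe] := ag _ e4; have [q' tq' qe'] := ah _ e4.
exists (fun t => q t + q' t); first exact: real_trigD.
have mq := measurable_real_trig tq; have mq' := measurable_real_trig tq'.
apply: (@l2_dist_triangle g q h q' (fun t => g t + h t - (q t + q' t))) => //.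
  by apply: measurable_funB; exact: measurable_funD.
by move=> t; rewrite opprD addrACA.
Qed.

Lemma l2_approxZ c g : l2_approx g -> l2_approx (fun t => c * g t).
Proof.
move=> [mg ag]; split; first exact: measurable_funM.
(* The summand 1 keeps the denominator positive when [c] is 0. *)
move=> e e0; have ec : 0 < e / (c ^+ 2 + 1) by rewrite divr_gt0// ltr_wpDl// sqr_ge0.
have [q tq qe] := ag _ ec.
exists (fun t => c * q t); first by apply: real_trigM => //; exact: real_trig_cst.
have mq := measurable_real_trig tq.
rewrite (eq_integral (fun t => (c ^+ 2)%:E * ((g t - q t) ^+ 2)%:E)%E); last first.
  by move=> t _; rewrite -EFinM -exprMn mulrBr.
rewrite ge0_integralZl ?lee_fin ?sqr_ge0//; last 2 first.
- exact: measurable_sqB.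
- by move=> t _; rewrite lee_fin sqr_ge0.
apply: le_trans (lee_wpmul2l _ qe) _; first by rewrite lee_fin sqr_ge0.
rewrite -EFinM lee_fin mulrA ler_pdivrMr ?ltr_wpDl ?sqr_ge0// mulrC ler_wpM2l// ?(ltW e0)//.
by rewrite lerDl.
Qed.

(** The indicator and its approximant take values in [0, 1], so the square of their difference is at
    most its absolute value: L_1 closeness gives L_2 closeness. *)
Lemma l2_approx_indic (A : set T) : measurable A -> l2_approx (\1_A).
Proof.
move=> mA; split; first exact: measurable_indic.
move=> e e0; have [_ /(_ _ e0)[q [tq q01 qe]]] := trig_approx_measurable mA.
exists q => //; apply: le_trans qe; apply: ge0_le_integral => //.
- by move=> t _; rewrite lee_fin sqr_ge0.
- by apply: measurable_sqB; [exact: measurable_indic|exact: measurable_real_trig].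
- exact: measurable_dist.
move=> t _; rewrite lee_fin -real_normK ?num_real// expr2 ler_piMl//.
have /andP[q0 q1] := q01 t.
by rewrite ler_norml indicE; case: (t \in A) => /=; apply/andP; split; lra.
Qed.

Lemma l2_approx_nnsfun (f : {nnsfun T >-> R}) : l2_approx (fun t => f t).
Proof.
have -> : (fun t => f t) = fun t =>
    \sum_(y <- finmap.enum_fset (fset_set (range f))) y * \1_(f @^-1` [set y]) t.
  by apply/funext => t; rewrite fimfunE fsbig_finite.
elim: (finmap.enum_fset _) => [|y s IH].
  under eq_fun do rewrite big_nil.
  have := l2_approxZ 0 (l2_approx_indic measurableT).
  by under eq_fun do rewrite mul0r.
under eq_fun do rewrite big_cons.
by apply: l2_approxD => //; apply: l2_approxZ; exact: l2_approx_indic.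
Qed.

Lemma l2_approx_lim g : measurable_fun setT g ->
  (forall e, 0 < e -> exists2 h, l2_approx h & (\int[mu]_t ((g t - h t) ^+ 2)%:E <= e%:E)%E) ->
  l2_approx g.
Proof.
move=> mg H; split=> // e e0; have e4 : 0 < e / 4 by rewrite divr_gt0.
have [h [mh ah] he] := H _ e4; have [q tq qe] := ah _ e4; exists q => //.
have mq := measurable_real_trig tq.
apply: (@l2_dist_triangle g h h q (fun t => g t - q t)) => //.
  exact: measurable_funB.
by move=> t; rewrite addrA subrK.
Qed.

(** Simple functions s_n increasing to g satisfy (g - s_n)^2 <= g^2, which is the dominating
    function for dominated convergence. *)
Lemma l2_approx_ge0 g : measurable_fun setT g -> (forall t, 0 <= g t) ->
  mu.-integrable setT (EFin \o (fun t => g t ^+ 2)) -> l2_approx g.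
Proof.
move=> mg g0 ig; apply: l2_approx_lim => // e e0.
have mgE : measurable_fun setT (EFin \o g) by exact/measurable_EFinP.
have g0E (t : T) : setT t -> (0 <= (EFin \o g) t)%E by move=> _ /=; rewrite lee_fin.
pose s := nnsfun_approx measurableT mgE.
have s_cvg t : s n t @[n --> \oo] --> g t.
  by have := cvg_nnsfun_approx measurableT mgE g0E (I : setT t) => /fine_cvgP[].
have s_le n t : 0 <= s n t <= g t.
  rewrite fun_ge0 /=.
  have nd : nondecreasing_seq (fun n => s n t).
    by move=> a b ab; exact/lefP/nd_nnsfun_approx.
  have := nondecreasing_cvgn_le nd (cvgP _ (s_cvg t)) n.
  by rewrite (cvg_lim _ (s_cvg t)).
have [] := @dominated_convergence _ _ _ mu setT measurableT
  (fun n t => ((g t - s n t) ^+ 2)%:E) (cst 0%E) (EFin \o (fun t => g t ^+ 2)).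
- by move=> n; exact: measurable_sqB.
- exact: measurable_cst.
- apply: aeW => t _; apply: cvg_EFin; first by near=> n.
  rewrite [X in _ --> X](_ : _ = (g t - g t) ^+ 2); last by rewrite subrr expr0n.
  apply: (cvg_comp (fun n => g t - s n t) (fun x => x ^+ 2)).
    by apply: cvgB; [exact: cvg_cst|exact: s_cvg].
  exact: exprn_continuous.
- exact: ig.
- apply: aeW => t n _ /=; rewrite lee_fin ger0_norm ?sqr_ge0//.
  by have /andP[a b] := s_le n t; rewrite lerXn2r ?nnegrE ?subr_ge0// gerBl.
move=> _ + _ => /fine_cvgP[Ifin /cvgrPdist_lt /(_ _ e0) Ilt].
have [n _ Hn] : \forall n \near \oo, (\int[mu]_t ((g t - s n t) ^+ 2)%:E <= e%:E)%E.
  near=> k.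
  have kfin : (\int[mu]_t `|((g t - s k t) ^+ 2)%:E - 0|)%E \is a fin_num by near: k.
  have : `|0 - fine (\int[mu]_t `|((g t - s k t) ^+ 2)%:E - 0|)%E| < e by near: k.
  rewrite sub0r normrN => H.
  have -> : (\int[mu]_t ((g t - s k t) ^+ 2)%:E = \int[mu]_t `|((g t - s k t) ^+ 2)%:E - 0|)%E.
    by apply: eq_integral => t _; rewrite sube0 gee0_abs// lee_fin sqr_ge0.
  rewrite -(fineK kfin) lee_fin; exact/ltW/(le_lt_trans (ler_norm _) H).
exists (s n); first exact: l2_approx_nnsfun.
exact: Hn n (leqnn n).
Unshelve. all: end_near. Qed.

Lemma l2_approx_all g : measurable_fun setT g ->
  mu.-integrable setT (EFin \o (fun t => g t ^+ 2)) -> l2_approx g.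
Proof.
move=> mg ig.
have part (h : T -> R) : measurable_fun setT h -> (forall t, 0 <= h t) ->
    (forall t, h t <= `|g t|) -> l2_approx h.
  move=> mh h0 hg; apply: l2_approx_ge0 => //.
  apply: le_integrable ig => //.
    by apply/measurable_EFinP; exact: measurable_funX.
  move=> t _ /=; rewrite lee_fin !ger0_norm ?sqr_ge0//.
  by rewrite -[leRHS]real_normK ?num_real// lerXn2r ?nnegrE.
have ap : l2_approx (fun t => Num.max (g t) 0).
  apply: part => [|t|t]; first by apply: measurable_maxr => //; exact: measurable_cst.
    by rewrite le_max lexx orbT.
  by rewrite ge_max normr_ge0 ler_norm.
have an : l2_approx (fun t => Num.max (- g t) 0).
  apply: part => [|t|t].
  - by apply: measurable_maxr; [exact: measurableT_comp|exact: measurable_cst].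
  - by rewrite le_max lexx orbT.
  - by rewrite ge_max normr_ge0 -normrN ler_norm.
have := l2_approxD ap (l2_approxZ (-1) an).
rewrite (_ : (fun _ => _) = g)//; apply/funext => t.
by case: (leP (g t) 0) => gt; case: (leP (- g t) 0) => gt'; lra.
Qed.

Lemma trig_sum_dense (f : torus_fun R d) e : L2 R d f -> 0 < e ->
  exists p, L2norm (f - trig_sum p) ^+ 2 <= e.
Proof.
move=> Lf e0; have [mr mi i2] := (L2P f).1 Lf.
have e2 : 0 < e / 2 by rewrite divr_gt0.
have ir : mu.-integrable setT (EFin \o (fun t => Re (f t) ^+ 2)).
  apply: le_integrable i2 => //; first by apply/measurable_EFinP; exact: measurable_funX.
  move=> t _ /=; rewrite lee_fin !ger0_norm ?sqr_ge0 ?sqmod_ge0//.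
  by rewrite lerDl sqr_ge0.
have ii : mu.-integrable setT (EFin \o (fun t => Im (f t) ^+ 2)).
  apply: le_integrable i2 => //; first by apply/measurable_EFinP; exact: measurable_funX.
  move=> t _ /=; rewrite lee_fin !ger0_norm ?sqr_ge0 ?sqmod_ge0//.
  by rewrite lerDr sqr_ge0.
have [_ /(_ _ e2)[q [p pE] qe]] := l2_approx_all mr ir.
have [_ /(_ _ e2)[q' [p' pE'] qe']] := l2_approx_all mi ii.
pose ip' : seq (R[i] * {ffun 'I_d -> int}) := [seq (Complex 0 1 * u.1, u.2) | u <- p'].
have ipE t : trig_sum ip' t = Complex 0 (q' t).
  rewrite /trig_sum big_map; under eq_bigr do rewrite /= -mulrA.
  rewrite -mulr_sumr -/(trig_sum p' t) pE'.
  by apply: complexP; rewrite ?complexReM ?complexImM /=; ring.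
exists (p ++ ip'); rewrite L2norm_sqE; last first.
  by apply: L2_sub => //; exact: L2_trig_sum.
have mq : measurable_fun setT q by apply: measurable_real_trig; exists p.
have mq' : measurable_fun setT q' by apply: measurable_real_trig; exists p'.
have H : (\int[mu]_t (sqmod ((f - trig_sum (p ++ ip')) t))%:E <= e%:E)%E.
  rewrite (eq_integral (fun t =>
    ((Re (f t) - q t) ^+ 2)%:E + ((Im (f t) - q' t) ^+ 2)%:E)%E); last first.
    move=> t _; rewrite -[(f - _) t]/(f t - trig_sum (p ++ ip') t) trig_sum_cat pE ipE -EFinD.
    rewrite /sqmod complexReD complexImD complexReN complexImN complexReD complexImD /=.
    by congr (_%:E); ring.
  rewrite ge0_integralD//; try (by move=> t _; rewrite lee_fin sqr_ge0); try exact: measurable_sqB.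
  by rewrite [e]splitr EFinD; exact: leeD.
rewrite /Rintegral -lee_fin fineK// ge0_fin_numE.
  exact: le_lt_trans H (ltry _).
by apply: integral_ge0 => t _; rewrite lee_fin sqmod_ge0.
Unshelve. all: end_near. Qed.

End trig_dense.

(** * Fourier sums *)

Section fourier.
Variables (R : realType) (d : nat).
Local Notation Re := (@complex.Re R).
Local Notation Im := (@complex.Im R).
Local Notation mu := (torus_measure R d).
Local Notation T := (d.-tuple (measurableTypeR R)).
Local Notation freq := {ffun 'I_d -> int}.
Implicit Types (f g h : torus_fun R d) (k l : freq) (p : seq (R[i] * freq)) (K : seq freq).

Definition torus_volume : R := fine (mu setT).

Lemma torus_volume_gt0 : 0 < torus_volume.
Proof.
rewrite /torus_volume fine_gt0//.
have := @torus_measure_box R d (fun=> setT) (fun=> measurableT).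
rewrite (_ : [set t | _] = setT); last by apply/seteqP; split.
move=> ->; apply/andP; split.
  elim/big_ind : _ => //; first exact: mule_gt0.
  move=> _ _; rewrite setTI /circle_set lebesgue_measure_itv /= lte_fin circle_length_gt0.
  by rewrite sube0 lte_fin circle_length_gt0.
rewrite ltey_eq; apply/orP; left; apply: (@big_rec _ (fun x => x \is a fin_num)) => // _ x _ xf.
rewrite fin_numM// setTI /circle_set lebesgue_measure_itv /= lte_fin circle_length_gt0.
by rewrite sube0.
Qed.

Definition exp_fun k : torus_fun R d := fun t => cexp k (row_of t).

Lemma L2_exp k : L2 R d (exp_fun k).
Proof. exact: (L2_row (@ccontinuous_cexp R d k)). Qed.

Lemma conjc_cexp k (x : 'rV[R]_d) : conjc (cexp k x) = cexp (- k) x.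
Proof. by rewrite cexpN. Qed.

(** If k_j is nonzero, i k_j times the exponential is its own j-th derivative, and periodic
    derivatives integrate to 0. *)
Lemma torus_integral_cexp k : torus_integral (exp_fun k) = (k == 0)%:R * Complex torus_volume 0.
Proof.
have [->|k0] := eqVneq k 0.
  rewrite mul1r; apply: complexP => /=.
    transitivity (\int[mu]_(t in setT) (1 : R)).
      by apply: eq_Rintegral => t _; rewrite /exp_fun /= phase0 cos0.
    by rewrite /Rintegral integral_cst// mul1e.
  transitivity (\int[mu]_(t in setT) (0 : R)); last by rewrite /Rintegral integral0.
  by apply: eq_Rintegral => t _; rewrite /exp_fun /= phase0 sin0.
rewrite mul0r.
have [j kj] : exists j, k j != 0.
  apply/existsP; apply: contraNT k0; rewrite negb_exists => /forallP H.
  by apply/eqP/ffunP => j; rewrite ffunE; apply/eqP; have := H j; rewrite negbK.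
have [de Ee] := @cderivable_cexp R d k j.
have ce := @ccontinuous_cexp R d k.
have := torus_integral_partial0 de; rewrite Ee => /(_ _ (cexp_periodic k)) H.
have : Complex 0 (k j)%:~R * torus_integral (exp_fun k) = 0.
  rewrite -(cintegrableZ _ (cintegrable_row ce)).2; apply: H.
  by apply: ccontinuousM => //; exact: ccontinuous_cst.
move=> /eqP; rewrite mulf_eq0 => /orP[|/eqP//].
by rewrite eq_complex /= eqxx /= intr_eq0 (negbTE kj).
Qed.

Lemma ip_exp k l : ip (exp_fun k) (exp_fun l) = (k == l)%:R * Complex torus_volume 0.
Proof.
rewrite -subr_eq0 -torus_integral_cexp /ip; congr torus_integral.
by apply/funext => t; rewrite /exp_fun conjc_cexp -cexpD.
Qed.

Lemma trig_sum_nil : trig_sum [::] = 0 :> torus_fun R d.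
Proof. by apply/funext => t; rewrite /trig_sum big_nil. Qed.

Lemma trig_sum_cons (u : R[i] * freq) p :
  trig_sum (u :: p) = u.1 *: exp_fun u.2 + trig_sum p :> torus_fun R d.
Proof. by apply/funext => t; rewrite /trig_sum big_cons. Qed.

Lemma ip_0l h : L2 R d h -> ip 0 h = 0.
Proof.
move=> Lh; have := ip_linear 1 (@L2_0 R d) (@L2_0 R d) Lh.
by rewrite scale1r addr0 mul1r => /eqP; rewrite -subr_eq0 opprD addrA subrr add0r oppr_eq0 => /eqP.
Qed.

Lemma ip_trig_suml p h : L2 R d h ->
  ip (trig_sum p) h = \sum_(u <- p) u.1 * ip (exp_fun u.2) h.
Proof.
move=> Lh; elim: p => [|u p IH]; first by rewrite trig_sum_nil big_nil ip_0l.
rewrite trig_sum_cons big_cons ip_linear ?IH//; first exact: L2_exp.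
exact: L2_trig_sum.
Qed.

Lemma ip_trig_sumr p h : L2 R d h ->
  ip h (trig_sum p) = \sum_(u <- p) conjc u.1 * ip h (exp_fun u.2).
Proof.
move=> Lh; rewrite (ip_conj (L2_trig_sum p) Lh) ip_trig_suml// rmorph_sum /=.
by apply: eq_bigr => u _; rewrite rmorphM; congr (_ * _); rewrite (ip_conj (L2_exp u.2) Lh).
Qed.

(** Normalised so that Fourier sums are sums of [coef f k *: exp_fun k]. The unitary coefficient
    c_k(f) is (2 pi)^(d/2) times this one, whence the factor [torus_volume] in the norm formulas. *)
Definition coef f k : R[i] := ip f (exp_fun k) / Complex torus_volume 0.

Definition exp_seq K (a : freq -> R[i]) := [seq (a k, k) | k <- K].

Definition fourier_sum K f : torus_fun R d := trig_sum (exp_seq K (coef f)).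

Lemma volume_neq0 : Complex torus_volume 0 != 0 :> R[i].
Proof. by rewrite eq_complex /= negb_and gt_eqF ?torus_volume_gt0. Qed.

Lemma coef_linear (c : R[i]) f g k : L2 R d f -> L2 R d g ->
  coef (c *: f + g) k = c * coef f k + coef g k.
Proof. by move=> Lf Lg; rewrite /coef ip_linear ?mulrDl ?mulrA//; exact: L2_exp. Qed.

Lemma coefB f g k : L2 R d f -> L2 R d g -> coef (f - g) k = coef f k - coef g k.
Proof. by move=> Lf Lg; rewrite addrC -scaleN1r coef_linear// mulN1r addrC. Qed.

Lemma coef_exp_sum K (a : freq -> R[i]) k : uniq K ->
  coef (trig_sum (exp_seq K a)) k = if k \in K then a k else 0.
Proof.
move=> uK; rewrite /coef ip_trig_suml; last exact: L2_exp.
rewrite big_map /=; under eq_bigr do rewrite ip_exp.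
case: ifPn => kK.
  rewrite (bigD1_seq k)//= eqxx mul1r big1 ?addr0 ?mulfK ?volume_neq0//.
  by move=> l /negbTE ->; rewrite mul0r mulr0.
rewrite big1_seq ?mul0r// => l /= lK.
rewrite (_ : (l == k) = false) ?mul0r ?mulr0//.
by apply: contraNF kK => /eqP <-.
Qed.

Lemma L2norm_exp_sum K (a : freq -> R[i]) : uniq K ->
  L2norm (trig_sum (exp_seq K a)) ^+ 2 = torus_volume * \sum_(k <- K) sqmod (a k).
Proof.
move=> uK; have LK := @L2_trig_sum R d (exp_seq K a).
have := ip_sq LK; rewrite ip_trig_sumr// big_map /=.
have E k : ip (trig_sum (exp_seq K a)) (exp_fun k) =
    (if k \in K then a k else 0) * Complex torus_volume 0.
  by rewrite -(coef_exp_sum a k uK) /coef divfK ?volume_neq0.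
rewrite (eq_big_seq (fun k => Complex (torus_volume * sqmod (a k)) 0)); last first.
  move=> k kK; rewrite E kK; apply: complexP;
    rewrite ?complexReM ?complexImM /= ?complexReM ?complexImM conjcRe conjcIm /sqmod /=; ring.
have -> : \sum_(k <- K) Complex (torus_volume * sqmod (a k)) 0 =
    Complex (\sum_(k <- K) torus_volume * sqmod (a k)) 0 :> R[i].
  elim: K {uK LK E} => [|k K IH]; first by rewrite !big_nil.
  by rewrite !big_cons IH; apply: complexP => //=; rewrite addr0.
by rewrite -mulr_sumr => -[].
Qed.

Lemma pythagoras f g : L2 R d f -> L2 R d g -> ip f g = 0 ->
  L2norm (f + g) ^+ 2 = L2norm f ^+ 2 + L2norm g ^+ 2.
Proof.
move=> Lf Lg fg; have Lfg := L2_add Lf Lg.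
have gf : ip g f = 0 by rewrite (ip_conj Lf Lg) fg conjc0.
have addl h h' h'' : L2 R d h -> L2 R d h' -> L2 R d h'' -> ip (h + h') h'' = ip h h'' + ip h' h''.
  by move=> *; rewrite -[h]scale1r ip_linear ?scale1r ?mul1r.
have := ip_sq Lfg; rewrite addl// [ip f _](ip_conj Lfg Lf) [ip g _](ip_conj Lfg Lg) !addl//.
by rewrite fg gf addr0 add0r !ip_sq// => -[<-].
Qed.

Lemma ip_sub_fourier_sum K f k : L2 R d f -> uniq K -> k \in K ->
  ip (f - fourier_sum K f) (exp_fun k) = 0.
Proof.
move=> Lf uK kK; have := coefB k Lf (L2_trig_sum (exp_seq K (coef f))).
rewrite coef_exp_sum// kK subrr => /eqP; rewrite mulf_eq0 invr_eq0 (negbTE volume_neq0) orbF.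
by move/eqP.
Qed.

Lemma fourier_sum_orthogonal K f p : L2 R d f -> uniq K -> all (fun u => u.2 \in K) p ->
  ip (f - fourier_sum K f) (trig_sum p) = 0.
Proof.
move=> Lf uK /allP pK; rewrite ip_trig_sumr; last by apply: L2_sub => //; exact: L2_trig_sum.
by rewrite big1_seq// => u /= /pK uK2; rewrite ip_sub_fourier_sum// mulr0.
Qed.

Lemma all_exp_seq K (a : freq -> R[i]) : all (fun u => u.2 \in K) (exp_seq K a).
Proof. by apply/allP => _ /mapP[k kK ->]. Qed.

Lemma L2norm_sub_fourier_sum K f : L2 R d f -> uniq K ->
  L2norm f ^+ 2 = L2norm (f - fourier_sum K f) ^+ 2 + torus_volume * \sum_(k <- K) sqmod (coef f k).
Proof.
move=> Lf uK; rewrite -L2norm_exp_sum// -pythagoras ?subrK//.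
- by apply: L2_sub => //; exact: L2_trig_sum.
- exact: L2_trig_sum.
- by apply: fourier_sum_orthogonal => //; exact: all_exp_seq.
Qed.

Lemma bessel K f : L2 R d f -> uniq K ->
  torus_volume * \sum_(k <- K) sqmod (coef f k) <= L2norm f ^+ 2.
Proof. by move=> Lf uK; rewrite (L2norm_sub_fourier_sum Lf uK) lerDr sqr_ge0. Qed.

(** The Fourier sum minus [p] has frequencies in [K], hence is orthogonal to the remainder. *)
Lemma fourier_sum_best K f p : L2 R d f -> uniq K -> all (fun u => u.2 \in K) p ->
  L2norm (f - fourier_sum K f) ^+ 2 <= L2norm (f - trig_sum p) ^+ 2.
Proof.
move=> Lf uK pK; set q := exp_seq K (coef f) ++ [seq (- u.1, u.2) | u <- p].
have -> : f - trig_sum p = (f - fourier_sum K f) + trig_sum q.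
  apply/funext => t; rewrite -[LHS]/(f t - trig_sum p t).
  rewrite -[RHS]/(f t - fourier_sum K f t + trig_sum q t).
  rewrite trig_sum_cat addrA subrK; congr (_ + _).
  by rewrite /trig_sum big_map -sumrN; apply: eq_bigr => u _; rewrite mulNr.
have Lq := @L2_trig_sum R d q.
rewrite [leRHS]pythagoras//; first by rewrite lerDl sqr_ge0.
  by apply: L2_sub => //; exact: L2_trig_sum.
apply: fourier_sum_orthogonal => //; rewrite all_cat all_exp_seq /= all_map.
by apply/allP => u /(allP pK).
Qed.

(** The converse of Bessel's inequality, and the place where completeness enters. A polynomial close
    to [f] yields a finite [K], its set of frequencies; the Fourier sum over [K] is at least as
    close. *)
Lemma parseval_le f B : L2 R d f ->
  (forall K, uniq K -> torus_volume * \sum_(k <- K) sqmod (coef f k) <= B) ->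
  L2norm f ^+ 2 <= B.
Proof.
move=> Lf H; apply/ler_addgt0Pl => e e0.
have [p pe] := trig_sum_dense Lf e0.
pose K := undup [seq u.2 | u <- p]; have uK : uniq K by exact: undup_uniq.
rewrite (L2norm_sub_fourier_sum Lf uK) lerD ?H//.
apply: le_trans pe; apply: fourier_sum_best => //.
by apply/allP => u up; rewrite mem_undup; exact: map_f.
Qed.

End fourier.

(** * Approximation numbers of the embedding *)

Section mixed_smoothness.
Variables (R : realType) (d m : nat).
Local Notation Re := (@complex.Re R).
Local Notation Im := (@complex.Im R).
Local Notation freq := {ffun 'I_d -> int}.
Local Notation multi := {ffun 'I_d -> 'I_m.+1}.
Local Notation vol := (torus_volume R d).
Implicit Types (f g h : torus_fun R d) (k l : freq) (K : seq freq).

Lemma freq_factorN k s :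
  freq_factor R (- k) s = (-1) ^+ size s * freq_factor R k s.
Proof.
elim: s => [|j s IH]; first by rewrite /freq_factor !big_nil mulr1.
rewrite /freq_factor !big_cons -/(freq_factor R _ _) -/(freq_factor R k s) IH exprS ffunE mulrNz.
have -> : Complex 0 (- (k j)%:~R) = - Complex 0 (k j)%:~R :> R[i].
  by apply: complexP; rewrite ?complexReN ?complexImN /= ?oppr0.
by ring.
Qed.

(** The test function is the conjugate exponential. The sign from the definition of the
    distributional derivative cancels the one from differentiating e^(-ikx). *)
Lemma coef_distr_deriv (alpha : 'I_d -> nat) f g k : L2 R d f -> distr_deriv alpha f g ->
  coef g k = freq_factor R k (multi_seq alpha) * coef f k.
Proof.
move=> Lf fg; rewrite /coef mulrA; congr (_ / _).
have E h : torus_integral (fun t => h t * cexp (- k) (row_of t)) = ip h (exp_fun k).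
  by congr torus_integral; apply/funext => t; rewrite /exp_fun conjc_cexp.
have := fg (cexp (- k)) (@smooth_cexp R d (- k)) (@cexp_periodic R d (- k)).
rewrite E => ->; set s := multi_seq alpha; rewrite -size_multi_seq -/s.
have -> : iter_partial s (cexp (- k)) =
    (fun x => (-1) ^+ size s * freq_factor R k s * cexp (- k) x) :> ('rV[R]_d -> R[i]).
  have e1 : cexp (- k) = (fun x => 1 * cexp (- k) x) :> ('rV[R]_d -> R[i]).
    by apply/funext => x; rewrite mul1r.
  by rewrite [in LHS]e1 iter_partial_cexp mul1r freq_factorN.
set c := (-1) ^+ size s; set w := freq_factor R k s.
have -> : (fun t => f t * (c * w * cexp (- k) (row_of t))) =
    (fun t => (c * w) * (f t * conjc (exp_fun k t))).
  by apply/funext => t; rewrite /exp_fun conjc_cexp mulrCA.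
rewrite (cintegrableZ _ (cintegrable_ip Lf (L2_exp R k))).2 !mulrA.
by rewrite /c -expr2 sqrr_sign mul1r.
Qed.

Lemma sqmod_freq_factor (alpha : 'I_d -> nat) k :
  sqmod (freq_factor R k (multi_seq alpha)) = (\prod_j `|k j|%N ^ (2 * alpha j))%:R.
Proof.
have sq1 j : sqmod (Complex 0 (k j)%:~R : R[i]) = (`|k j|%N ^ 2)%:R.
  by rewrite /sqmod /= expr0n add0r natrX natr_absz intr_norm real_normK// num_real.
have sqp (s : seq 'I_d) : sqmod (freq_factor R k s) = (\prod_(j <- s) `|k j|%N ^ 2)%:R.
  elim: s => [|j s IH]; first by rewrite /freq_factor !big_nil /sqmod /= expr1n expr0n addr0.
  by rewrite /freq_factor !big_cons sqmodM IH sq1 natrM.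
rewrite sqp /multi_seq big_flatten /= big_map big_enum /=; congr (_%:R).
apply: eq_bigr => j _; rewrite big_nseq expnM.
by elim: (alpha j) => [|a IH]; rewrite ?expn0// iterS IH -expnS.
Qed.

Definition weight k : nat := \prod_j \sum_(a < m.+1) `|k j|%N ^ (2 * a).

(** Distributivity: choosing one exponent [a] in each factor amounts to choosing a multi-index. *)
Lemma weight_sum k :
  weight k = (\sum_(alpha : multi) \prod_j `|k j|%N ^ (2 * alpha j))%N.
Proof. by rewrite /weight bigA_distr_bigA. Qed.

Lemma weight_gt0 k : (0 < weight k)%N.
Proof. by apply: prodn_gt0 => j; rewrite big_ord_recl /= muln0 expn0. Qed.

Lemma Dmulti_Hmix f (alpha : multi) : Hmix R d m f ->
  L2 R d (Dmulti (fun j => alpha j) f) /\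
  distr_deriv (fun j => alpha j) f (Dmulti (fun j => alpha j) f).
Proof.
move=> [_ /(_ alpha)[g Lg fg]]; rewrite /Dmulti; case: xgetP => [h -> //|].
by move=> /(_ g) H; exfalso; apply: H.
Qed.

Lemma Hmix_norm_sq f : Hmix_norm m f ^+ 2 =
  \sum_(alpha : multi) L2norm (Dmulti (fun j => alpha j) f) ^+ 2.
Proof. by rewrite sqr_sqrtr// sumr_ge0// => alpha _; rewrite sqr_ge0. Qed.

Lemma sum_weight K f :
  \sum_(alpha : multi) \sum_(k <- K)
    sqmod (freq_factor R k (multi_seq (fun j => alpha j)) * coef f k)
  = \sum_(k <- K) (weight k)%:R * sqmod (coef f k).
Proof.
rewrite exchange_big /=; apply: eq_bigr => k _.
rewrite weight_sum natr_sum mulr_suml; apply: eq_bigr => alpha _.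
by rewrite sqmodM sqmod_freq_factor.
Qed.

Lemma Hmix_bessel K f : Hmix R d m f -> uniq K ->
  vol * \sum_(k <- K) (weight k)%:R * sqmod (coef f k) <= Hmix_norm m f ^+ 2.
Proof.
move=> Hf uK; rewrite Hmix_norm_sq -sum_weight mulr_sumr; apply: ler_sum => alpha _.
have [Lg fg] := Dmulti_Hmix alpha Hf.
apply: le_trans (bessel Lg uK); rewrite ler_wpM2l ?(ltW (torus_volume_gt0 R d))//.
by apply: ler_sum => k _; rewrite (coef_distr_deriv k Hf.1 fg).
Qed.

Lemma Hmix_trig_sum p : Hmix R d m (trig_sum p).
Proof.
split; first exact: L2_trig_sum.
move=> alpha.
exists (trig_sum [seq (u.1 * freq_factor R u.2 (multi_seq (fun j => alpha j)), u.2) | u <- p]).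
  exact: L2_trig_sum.
exact: trig_sum_distr_deriv.
Qed.

Lemma sum_uniq_support (K K' : seq freq) (F : freq -> R) : uniq K -> uniq K' ->
  (forall k, 0 <= F k) -> (forall k, k \notin K' -> F k = 0) ->
  \sum_(k <- K) F k <= \sum_(k <- K') F k.
Proof.
move=> uK uK' F0 FK'.
have -> : \sum_(k <- K) F k = \sum_(k <- K | k \in K') F k.
  rewrite [RHS]big_mkcond /=; apply: eq_bigr => k _; case: ifPn => // /FK' ->//.
rewrite -big_filter (perm_big [seq k <- K' | k \in K]) /=.
  by rewrite big_filter big_mkcond /=; apply: ler_sum => k _; case: ifP.
apply: uniq_perm; rewrite ?filter_uniq// => k.
by rewrite !mem_filter andbC.
Qed.

(** [Dmulti] need not return the termwise derivative of the sum, but it has the same coefficients,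
    and [parseval_le] bounds its norm by them. *)
Lemma Hmix_norm_exp_sum K (a : freq -> R[i]) : uniq K ->
  Hmix_norm m (trig_sum (exp_seq K a)) ^+ 2 <=
  vol * \sum_(k <- K) (weight k)%:R * sqmod (a k).
Proof.
move=> uK; set f := trig_sum _; have Hf : Hmix R d m f by exact: Hmix_trig_sum.
have -> : \sum_(k <- K) (weight k)%:R * sqmod (a k) =
    \sum_(k <- K) (weight k)%:R * sqmod (coef f k).
  by apply: eq_big_seq => k kK; rewrite coef_exp_sum// kK.
rewrite Hmix_norm_sq -sum_weight mulr_sumr; apply: ler_sum => alpha _.
have [Lg fg] := Dmulti_Hmix alpha Hf.
apply: parseval_le => // K' uK'; rewrite ler_wpM2l ?(ltW (torus_volume_gt0 R d))//.
under eq_bigr do rewrite (coef_distr_deriv _ Hf.1 fg).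
apply: sum_uniq_support => // [k|k kK]; first exact: sqmod_ge0.
rewrite coef_exp_sum// (negbTE kK) mulr0.
by rewrite /sqmod /= expr0n addr0.
Qed.

Definition freq_of (s : seq int) : freq := [ffun j : 'I_d => s`_j].

Lemma weight_freq_of s : size s = d -> weight (freq_of s) = mix_weight m s.
Proof.
move=> sd; rewrite /weight /mix_weight (big_nth 0) big_mkord sd.
by apply: eq_bigr => j _; rewrite ffunE.
Qed.

Lemma freq_of_surj k : exists2 s, size s = d & freq_of s = k.
Proof.
exists [seq k j | j <- enum 'I_d]; first by rewrite size_map size_enum_ord.
apply/ffunP => j; rewrite ffunE (nth_map j) ?size_enum_ord//.
by rewrite nth_ord_enum.
Qed.

Definition hyp_cross (r : nat) : seq freq :=
  [seq freq_of s | s <- int_box r d & (mix_weight m s <= r ^ (2 * m))%N].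

Lemma size_hyp_cross r : size (hyp_cross r) = mix_count d m r.
Proof. by rewrite size_map size_filter. Qed.

Lemma uniq_hyp_cross r : uniq (hyp_cross r).
Proof.
rewrite map_inj_in_uniq ?filter_uniq ?uniq_int_box// => s s'.
rewrite !mem_filter !mem_int_box => /andP[_ /andP[/eqP sd _]] /andP[_ /andP[/eqP sd' _]] E.
apply: (@eq_from_nth _ 0); first by rewrite sd sd'.
move=> n; rewrite sd => nd.
by have /ffunP/(_ (Ordinal nd)) := E; rewrite !ffunE.
Qed.

Lemma mem_hyp_cross r k : (0 < m)%N -> (k \in hyp_cross r) = (weight k <= r ^ (2 * m))%N.
Proof.
move=> m0; apply/mapP/idP => [[s]|].
  rewrite mem_filter mem_int_box => /andP[sr /andP[/eqP sd _]] ->.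
  by rewrite weight_freq_of.
have [s sd <-] := freq_of_surj k; rewrite weight_freq_of// => sr.
by exists s => //; rewrite mem_filter sr (@mem_mix_box d m).
Qed.


(** This carries linearity and rank conditions, which hold only up to functions of norm zero, over
    to equalities of coefficients. *)
Lemma coef_null h k : L2 R d h -> L2norm h = 0 -> coef h k = 0.
Proof.
move=> Lh h0; have := bessel Lh (isT : uniq [:: k]).
rewrite big_seq1 h0 expr0n /= => H.
have : sqmod (coef h k) <= 0 by rewrite -(pmulr_rle0 _ (torus_volume_gt0 R d)).
rewrite /sqmod => H2; have /eqP : Re (coef h k) ^+ 2 + Im (coef h k) ^+ 2 = 0.
  by apply/eqP; rewrite eq_le H2 addr_ge0// sqr_ge0.
by rewrite paddr_eq0 ?sqr_ge0// !sqrf_eq0 => /andP[/eqP a /eqP b]; exact: complexP.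
Qed.

Lemma coef0 k : coef (0 : torus_fun R d) k = 0.
Proof. by rewrite /coef ip_0l ?mul0r//; exact: L2_exp. Qed.

Lemma L2_sum n (c : 'I_n -> R[i]) (y : 'I_n -> torus_fun R d) :
  (forall i, L2 R d (y i)) -> L2 R d (\sum_i c i *: y i).
Proof.
move=> Ly; elim/big_ind : _ => [|f g Lf Lg|j _]; first exact: L2_0.
  exact: L2_add.
exact: L2_scale.
Qed.

Lemma coef_sum n (c : 'I_n -> R[i]) (y : 'I_n -> torus_fun R d) k :
  (forall i, L2 R d (y i)) -> coef (\sum_i c i *: y i) k = \sum_i c i * coef (y i) k.
Proof.
move=> Ly; have H (s : seq 'I_n) : L2 R d (\sum_(i <- s) c i *: y i) /\
    coef (\sum_(i <- s) c i *: y i) k = \sum_(i <- s) c i * coef (y i) k.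
  elim: s => [|j s [IH1 IH2]]; first by rewrite !big_nil coef0; split=> //; exact: L2_0.
  rewrite !big_cons coef_linear// IH2; split=> //.
  by apply: L2_add => //; exact: L2_scale.
by have [] := H (index_enum _).
Qed.

Lemma exp_fun_trig_sum k : exp_fun k = trig_sum [:: (1, k)] :> torus_fun R d.
Proof. by rewrite trig_sum_cons trig_sum_nil addr0 scale1r. Qed.

Lemma L2norm_0 : L2norm (0 : torus_fun R d) = 0.
Proof.
have := @L2norm_exp_sum R d [::] (fun=> 0) isT.
by rewrite big_nil mulr0 trig_sum_nil => /eqP; rewrite sqrf_eq0 => /eqP.
Qed.

Lemma trig_sum_exp_seq K (a : freq -> R[i]) :
  trig_sum (exp_seq K a) = \sum_(i < size K) a K`_i *: exp_fun K`_i :> torus_fun R d.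
Proof.
transitivity (\sum_(k <- K) a k *: exp_fun k : torus_fun R d).
  elim: K => [|k K IH]; first by rewrite trig_sum_nil big_nil.
  by rewrite /= trig_sum_cons IH big_cons.
by rewrite (big_nth 0) big_mkord.
Qed.

Lemma Hmix_L2 f : Hmix R d m f -> L2 R d f. Proof. by case. Qed.

Local Notation approx := (approx_number (Hmix R d m) (@Hmix_norm R d m) (L2 R d) (@L2norm R d)).

Lemma sum_coef_le1 K f : Hmix R d m f -> Hmix_norm m f <= 1 -> uniq K ->
  vol * \sum_(k <- K) (weight k)%:R * sqmod (coef f k) <= 1.
Proof.
move=> Hf f1 uK; apply: (le_trans (Hmix_bessel Hf uK)).
by rewrite exprn_ile1// sqrtr_ge0.
Qed.

Lemma fourier_sum_bounded_linear K : uniq K ->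
  bounded_linear (Hmix R d m) (@Hmix_norm R d m) (L2 R d) (@L2norm R d) (fourier_sum K).
Proof.
move=> uK; split.
- by move=> f _; exact: L2_trig_sum.
- move=> a f g /Hmix_L2 Lf /Hmix_L2 Lg.
  rewrite (_ : _ - _ = 0) ?L2norm_0//; apply/eqP; rewrite subr_eq0; apply/eqP.
  rewrite /fourier_sum !trig_sum_exp_seq scaler_sumr -big_split /=; apply: eq_bigr => j _.
  by rewrite coef_linear// scalerDl scalerA.
- apply: (@le_lt_trans _ _ 1%:E); last exact: ltry.
  apply: ge_ereal_sup => _ [f [Hf f1] <-]; rewrite lee_fin.
  rewrite -(ler_pXn2r (_ : 0 < 2)%N) ?nnegrE ?L2norm_ge0// expr1n L2norm_exp_sum//.
  apply: le_trans (sum_coef_le1 Hf f1 uK).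
  rewrite ler_wpM2l ?(ltW (torus_volume_gt0 R d))//; apply: ler_sum => k _.
  by rewrite ler_peMl ?sqmod_ge0// ler1n weight_gt0.
Qed.

Lemma fourier_sum_rank K n : (size K < n)%N ->
  rank_lt (Hmix R d m) (L2 R d) (@L2norm R d) n (fourier_sum K).
Proof.
move=> Kn; exists (size K); split=> //; exists (fun j => exp_fun K`_j); split.
  by move=> j; exact: L2_exp.
move=> f _; exists (fun j => coef f K`_j).
by rewrite /fourier_sum trig_sum_exp_seq subrr L2norm_0.
Qed.

(** The remainder has no coefficient on the cross, and off it the weight exceeds r^(2m); hence
    r^(2m) times its squared norm is bounded by the weighted sum, which is at most 1. *)
Lemma approx_number_le n r : (0 < m)%N -> (0 < r)%N -> (mix_count d m r < n)%N ->
  (approx n idfun <= (r%:R ^- m)%:E)%E.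
Proof.
move=> m0 r0 rn; set K := hyp_cross r; have uK : uniq K by exact: uniq_hyp_cross.
have rR : (0 : R) < r%:R by rewrite ltr0n.
have vol0 := ltW (torus_volume_gt0 R d).
apply: (@le_trans _ _ (opnorm (Hmix R d m) (@Hmix_norm R d m) (@L2norm R d)
    (idfun \- fourier_sum K))).
  apply: ereal_inf_lbound; exists (fourier_sum K) => //; split.
    exact: fourier_sum_bounded_linear.
  by apply: fourier_sum_rank; rewrite size_hyp_cross.
apply: ge_ereal_sup => _ [f [Hf f1] <-]; rewrite lee_fin.
have Lf := Hmix_L2 Hf; have LK : L2 R d (fourier_sum K f) by exact: L2_trig_sum.
rewrite -(ler_pXn2r (_ : 0 < 2)%N) ?nnegrE ?L2norm_ge0 ?invr_ge0 ?exprn_ge0//.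
rewrite -[X in L2norm X]/(f - fourier_sum K f).
apply: parseval_le; first exact: L2_sub.
move=> K' uK'.
have r2 : (0 : R) < (r ^ (2 * m))%:R by rewrite ltr0n expn_gt0 r0.
have -> : (r%:R ^- m) ^+ 2 = ((r ^ (2 * m))%:R)^-1 :> R.
  by rewrite exprVn -exprM natrX mulnC.
rewrite -[leRHS]mul1r ler_pdivlMr//.
apply: le_trans (sum_coef_le1 Hf f1 uK').
rewrite -mulrA ler_wpM2l// mulr_suml; apply: ler_sum => k _.
rewrite coefB// coef_exp_sum//; case: ifPn => kK.
  rewrite subrr {1}/sqmod /= expr0n addr0 mul0r mulr_ge0 ?sqmod_ge0//.
rewrite subr0 mulrC ler_wpM2r ?sqmod_ge0// ler_nat ltnW//.
by rewrite ltnNge -mem_hyp_cross.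
Qed.

Lemma kernel_coefs K (n : nat) (c : freq -> 'I_n -> R[i]) : uniq K -> (n < size K)%N ->
  exists a : freq -> R[i], (exists2 k, k \in K & a k != 0) /\
    forall j, \sum_(k <- K) a k * c k j = 0.
Proof.
move=> uK nK; pose M : 'M[R[i]]_(size K, n) := \matrix_(x, j) c K`_x j.
have : kermx M != 0.
  rewrite -mxrank_eq0 mxrank_ker subn_eq0 -ltnNge.
  exact: leq_ltn_trans (rank_leq_col M) nK.
case/rowV0Pn => v /sub_kermxP vM v0.
(* The kernel vector, reindexed by frequencies and extended by 0 outside [K]. *)
pose a k : R[i] := if insub (index k K) is Some x then v ord0 x else 0.
have aE (x : 'I_(size K)) : a K`_x = v ord0 x.
  by rewrite /a index_uniq// valK.
exists a; split.
  have [x vx] : exists x, v ord0 x != 0.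
    apply/existsP; apply: contraNT v0; rewrite negb_exists => /forallP H.
    by apply/eqP/rowP => x; rewrite mxE; apply/eqP; have := H x; rewrite negbK.
  by exists K`_x; [exact: mem_nth|rewrite aE].
move=> j; rewrite (big_nth 0) big_mkord.
have /rowP/(_ j) := vM; rewrite !mxE => vMj; rewrite -[RHS]vMj.
by apply: eq_bigr => x _; rewrite aE mxE.
Qed.

Lemma approx_number_ge n r : (0 < m)%N -> (0 < n)%N -> (0 < r)%N -> (n <= mix_count d m r)%N ->
  ((r%:R ^- m)%:E <= approx n idfun)%E.
Proof.
move=> m0 n0 r0 nr; have rR : (0 : R) < r%:R by rewrite ltr0n.
have vol0 := torus_volume_gt0 R d.
apply: le_ereal_inf_tmp => _ [A [[AL Alin _] [n1 [n1n [y [Ly Arank]]]]] <-].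
(* These [n] frequencies outnumber the [n1 < n] generators of the range of [A]. *)
pose K := take n (@hyp_cross r).
have uK : uniq K by apply: take_uniq; exact: uniq_hyp_cross.
have sK : size K = n by rewrite size_takel// size_hyp_cross.
have Hexp k : Hmix R d m (exp_fun k) by rewrite exp_fun_trig_sum; exact: Hmix_trig_sum.
have [c cP] : exists c : freq -> 'I_n1 -> R[i], forall k,
    L2norm (A (exp_fun k) - \sum_i c k i *: y i) = 0.
  have ex k := Arank _ (Hexp k).
  by exists (fun k => sval (cid (ex k))) => k; exact: (svalP (cid (ex k))).
have cA k l : coef (A (exp_fun k)) l = \sum_i c k i * coef (y i) l.
  rewrite -coef_sum//; apply/eqP; rewrite -subr_eq0 -coefB; last 2 first.
  - exact/AL/Hexp.
  - exact: L2_sum.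
  apply/eqP/coef_null; last exact: cP.
  by apply: L2_sub; [exact/AL/Hexp|exact: L2_sum].
have linA (b : R[i]) f g l : Hmix R d m f -> Hmix R d m g -> Hmix R d m (b *: f + g) ->
    coef (A (b *: f + g)) l = b * coef (A f) l + coef (A g) l.
  move=> Hf Hg Hfg; have Lf := AL _ Hf; have Lg := AL _ Hg; have Lfg := AL _ Hfg.
  rewrite -coef_linear//; apply/eqP; rewrite -subr_eq0 -coefB//; last first.
    by apply: L2_add => //; exact: L2_scale.
  apply/eqP/coef_null; last exact: Alin.
  by apply: L2_sub => //; apply: L2_add => //; exact: L2_scale.
(* [A 0] may be a nonzero representative of the null class; only its coefficients are known to
   vanish. *)
have A0 l : coef (A 0) l = 0.
  have H0 : Hmix R d m 0 by rewrite -trig_sum_nil; exact: Hmix_trig_sum.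
  have := linA 1 0 0 l H0 H0; rewrite scale1r addr0 mul1r => /(_ H0)/eqP.
  by rewrite -subr_eq0 opprD addrA subrr add0r oppr_eq0 => /eqP.
have Atrig p l : coef (A (trig_sum p)) l = \sum_(u <- p) u.1 * coef (A (exp_fun u.2)) l.
  elim: p => [|u p IH]; first by rewrite trig_sum_nil big_nil A0.
  have HH := Hmix_trig_sum (u :: p); rewrite trig_sum_cons in HH *.
  by rewrite big_cons linA ?IH//; exact: Hmix_trig_sum.
have [a0 [[k0 k0K ak0] aker]] : exists a : freq -> R[i], (exists2 k, k \in K & a k != 0) /\
    forall j, \sum_(k <- K) a k * c k j = 0.
  by apply: kernel_coefs => //; rewrite sK.
(* [S] bounds the squared Sobolev norm of the polynomial with coefficients [a0]; division by its
   root puts the polynomial into the unit ball. *)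
pose S := vol * \sum_(k <- K) (weight k)%:R * sqmod (a0 k).
have S0 : 0 < S.
  rewrite mulr_gt0// (bigD1_seq k0)//= ltr_pwDl//.
    rewrite mulr_gt0 ?ltr0n ?weight_gt0// lt_neqAle sqmod_ge0 andbT eq_sym.
    apply: contra ak0; rewrite /sqmod paddr_eq0 ?sqr_ge0// !sqrf_eq0 => /andP[/eqP e1 /eqP e2].
    by apply/eqP; exact: complexP.
  by apply: sumr_ge0 => k _; rewrite mulr_ge0 ?sqmod_ge0.
pose s := (Num.sqrt S)^-1.
pose a k := Complex s 0 * a0 k.
have sa k : sqmod (a k) = S^-1 * sqmod (a0 k).
  rewrite /a sqmodM; congr (_ * _); rewrite /sqmod /= expr0n addr0 exprVn sqr_sqrtr//.
  exact: ltW.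
have Sa : vol * \sum_(k <- K) (weight k)%:R * sqmod (a k) = 1.
  under eq_bigr do rewrite sa mulrCA.
  by rewrite -mulr_sumr mulrCA -/S mulVf// gt_eqF.
pose f := trig_sum (exp_seq K a); have Hf : Hmix R d m f by exact: Hmix_trig_sum.
have Lf := Hmix_L2 Hf; have LAf := AL _ Hf.
have f1 : Hmix_norm m f <= 1.
  rewrite -(ler_pXn2r (_ : 0 < 2)%N) ?nnegrE ?sqrtr_ge0// expr1n -Sa.
  exact: Hmix_norm_exp_sum.
have Af l : coef (A f) l = 0.
  rewrite /f Atrig big_map /=; under eq_bigr do rewrite cA mulr_sumr.
  rewrite exchange_big big1//= => j _; under eq_bigr do rewrite mulrA.
  rewrite -mulr_suml /a; under eq_bigr do rewrite -mulrA.
  by rewrite -mulr_sumr aker mulr0 mul0r.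
have Lr : r%:R ^- m <= L2norm f.
  rewrite -(ler_pXn2r (_ : 0 < 2)%N) ?nnegrE ?L2norm_ge0 ?invr_ge0 ?exprn_ge0//.
  have r2 : (0 : R) < (r ^ (2 * m))%:R by rewrite ltr0n expn_gt0 r0.
  have -> : (r%:R ^- m) ^+ 2 = ((r ^ (2 * m))%:R)^-1 :> R.
    by rewrite exprVn -exprM natrX mulnC.
  rewrite -[leLHS]mul1r ler_pdivrMr// L2norm_exp_sum// -[leLHS]Sa -mulrA ler_pM2l//.
  rewrite mulr_suml big_seq [leRHS]big_seq; apply: ler_sum => k kK.
  rewrite mulrC ler_wpM2l ?sqmod_ge0// ler_nat -mem_hyp_cross//.
  exact: mem_take kK.
apply: (@le_trans _ _ (L2norm (f - A f))%:E); last first.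
  by apply: ereal_sup_ubound; exists f.
rewrite lee_fin (le_trans Lr)//.
rewrite -(ler_pXn2r (_ : 0 < 2)%N) ?nnegrE ?L2norm_ge0//.
(* [f] and [f - A f] have the same coefficients, so [parseval_le] for the former and Bessel's
   inequality for the latter compare their norms. *)
apply: parseval_le => // K' uK'.
have Ld : L2 R d (f - A f) by exact: L2_sub.
apply: le_trans (bessel Ld uK'); rewrite ler_pM2l//; apply: ler_sum => k _.
by rewrite coefB// Af subr0.
Qed.

End mixed_smoothness.

Theorem corollary4p20 (R : realType) (d m : nat) (hd : (0 < d)%N) (hm : (0 < m)%N) :
  ((n%:R ^+ m / ln (n%:R : R) ^+ ((d - 1) * m))%:E *
     approx_number (Hmix R d m) (@Hmix_norm R d m) (L2 R d) (@L2norm R d) n idfun)%E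
    @[n --> \oo] -->
  (((2 ^+ d / ((d - 1)`!)%:R) ^+ m : R)%:E)%E.
Proof.
case: d hd => [//|d] _; rewrite subn1 /=.
apply: (@cvg_inverse_count R d m (mix_count d.+1 m)).
- by rewrite divr_gt0 ?exprn_gt0// ltr0n fact_gt0.
- by move=> r; exact: leq_mix_count.
- exact: cvg_mix_count.
- by move=> n r r0 rn; exact: approx_number_le.
- by move=> n r n0 r0 nr; exact: approx_number_ge.
Qed.
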